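(* Let $k$ be a field of characteristic zero, let $N\ge2$, let $q\in k$ be a primitive $N$th root of unity, and let $W_q=k\{x,y\}/(xy-qyx-1)$ and $W_{\mathrm{qp}}=k\{x,y\}/(xy-qyx)$. Then the center of $W_q$ is $k[x^N,y^N]$; $H^1(W_q)$ is the submodule of the free module over the center (the free module of rank 2 on $x\partial_x$ and $y\partial_y$) spanned by the classes of $x\partial_x-y\partial_y$ and the lifts to $W_q$ of the derivations $x^Nx\partial_x$ and $y^Ny\partial_y$ of $W_{\mathrm{qp}}$; and $H^2(W_q)$ is the free module over the center spanned by the class of the lift $w_q$ to $W_q$ of the 2-cocycle $x\partial_x\wedge y\partial_y$ of $W_{\mathrm{qp}}$.
   Context: $H^n(A)=H^n(A,A)$ denotes Hochschild cohomology of an algebra $A$ with coefficients in itself, which is a module over the center of $A$; $k\{x,y\}$ is the free associative algebra. On $W_{\mathrm{qp}}$, $x\partial_x$ is the derivation with $x\mapsto x,\ y\mapsto0$, and $y\partial_y$ the derivation with $x\mapsto0,\ y\mapsto y$. Since $x^N,y^N$ are central in $W_{\mathrm{qp}}$, $x^N(x\partial_x)$ and $y^N(y\partial_y)$ are again derivations of $W_{\mathrm{qp}}$. For derivations $D_1,D_2$, $D_1\wedge D_2=\tfrac12(D_1\smile D_2-D_2\smile D_1)$, where $(D_1\smile D_2)(a,b)=D_1(a)D_2(b)$. On $W_q$, $x\partial_x-y\partial_y$ denotes the derivation with $x\mapsto x,\ y\mapsto-y$; it is the lift of the derivation of $W_{\mathrm{qp}}$ of the same name. The center of $W_{\mathrm{qp}}$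 is likewise $k[x^N,y^N]$, and is identified with that of $W_q$. The free module of rank 2 in the statement is the free module over $k[x^N,y^N]$ with basis the symbols $x\partial_x,\ y\partial_y$ (these derivations of $W_{\mathrm{qp}}$ do not themselves lift to $W_q$); in it the class of a lift is represented by the element which is lifted, so that the three spanning classes correspond to $x\partial_x-y\partial_y$, $x^N\cdot x\partial_x$ and $y^N\cdot y\partial_y$. $W_q(\hbar)=k[\hbar]\{x,y\}/(xy-qyx-\hbar)$ is a deformation of $W_{\mathrm{qp}}$: using the basis $x^iy^j$ ($i,j\ge0$) it is identified as a module with $W_{\mathrm{qp}}[\hbar]$, with multiplication of the form $a*b=ab+\hbar m_1(a,b)+\hbar^2m_2(a,b)+\cdots$, a finite sum for each $a,b\in W_{\mathrm{qp}}$. Setting $\hbar=1$ gives $W_q$. A lift to $W_q(\hbar)$ of a Hochschild $n$-cocycle $z$ of $W_{\mathrm{qp}}$ is an $n$-cocycle $z_{\hbar}=z+\hbar z_1+\hbar^2z_2+\cdots$ for the deformed multiplication, with $z_i$ $n$-cochains of $W_{\mathrm{qp}}$ extended multilinearly (so for $n=1$, a derivation lifting a derivation). A lift of $z$ to $W_q$ is obtained by setting $\hbar=1$ in such a $z_{\hbar}$ for which $z_{\hbar}(a_1,\dots,a_n)$ is a finite sum for all $a_1,\dots,a_n\in W_{\mathrm{qp}}$.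
   Formalization: H^1(W_q) is spanned over the center by the three classes, but its identification with the submodule of the free module is proved only k-linear, and linear over the center up to lower degree, since H^1(W_q) is free of rank 2 and that submodule is not free; suitable lifts are asserted to exist. *)

(* Defs.v *)
From HB Require Import structures.
From mathcomp Require Import all_boot ssralg poly matrix.
From mathcomp Require Import generic_quotient ring_quotient.
From mathcomp Require Import boolp finmap.
From mathcomp Require Import monalg.

Set Implicit Arguments.
Unset Strict Implicit.
Unset Printing Implicit Defensive.

Import GRing.Theory.

Local Open Scope fset_scope.
Local Open Scope ring_scope.
Local Open Scope quotient_scope.

Lemma fgscaleAr (K : monomType) (R : comNzRingType) (c : R)
  (f g : {malg R[K]}) : fgscale c (fgmul f g) = fgmul f (fgscale c g).
Proof.
rewrite (fgmullw (fsubset_refl _) (msuppZ_le c g)); apply/malgP=> k.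
rewrite fgscaleE /fgmul !raddf_sum mulr_sumr; apply: eq_bigr => m1 _ /=.
rewrite !raddf_sum mulr_sumr; apply: eq_bigr => m2 _ /=.
by rewrite !mcoeffU fgscaleE mulrnAr mulrCA.
Qed.

(* The free associative algebra on x and y; its multiplication is locked to
   keep unification away from the construction of {malg _}. *)
Definition free_alg (R : comNzRingType) : Type := {malg R[{fmonom bool}]}.
HB.instance Definition _ (R : comNzRingType) :=
  GRing.Lmodule.copy (free_alg R) {malg R[{fmonom bool}]}.

HB.lock Definition free_mul (R : comNzRingType) (f g : free_alg R) :
  free_alg R := fgmul f g.
HB.lock Definition free_one (R : comNzRingType) : free_alg R := fgone _ R.
HB.lock Definition free_x (R : comNzRingType) : free_alg R := << fmu false >>.
HB.lock Definition free_y (R : comNzRingType) : free_alg R := << fmu true >>.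

Section FreeAlgebra.
Context (R : comNzRingType).

Fact free_mulA : associative (@free_mul R).
Proof. by move=> f g e; rewrite !free_mul.unlock fgmulA. Qed.
Fact free_mul1 : left_id (free_one R) (@free_mul R).
Proof. by move=> f; rewrite free_mul.unlock free_one.unlock fgmul1g. Qed.
Fact free_mulr1 : right_id (free_one R) (@free_mul R).
Proof. by move=> f; rewrite free_mul.unlock free_one.unlock fgmulg1. Qed.
Fact free_mulDl : left_distributive (@free_mul R) +%R.
Proof. by move=> f g e; rewrite free_mul.unlock fgmulgDl. Qed.
Fact free_mulDr : right_distributive (@free_mul R) +%R.
Proof. by move=> f g e; rewrite free_mul.unlock fgmulgDr. Qed.
Fact free_one_neq0 : free_one R != 0.
Proof. by rewrite free_one.unlock fgoner_eq0. Qed.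

HB.instance Definition _ := GRing.Zmodule_isNzRing.Build (free_alg R)
  free_mulA free_mul1 free_mulr1 free_mulDl free_mulDr free_one_neq0.

Fact free_scaleAl (c : R) (f g : free_alg R) : c *: free_mul f g = free_mul (c *: f) g.
Proof. by rewrite free_mul.unlock; apply: (@fgscaleAl _ R). Qed.
HB.instance Definition _ :=
  GRing.Lmodule_isLalgebra.Build R (free_alg R) free_scaleAl.

Fact free_scaleAr (c : R) (f g : free_alg R) : c *: free_mul f g = free_mul f (c *: g).
Proof. by rewrite free_mul.unlock; apply: fgscaleAr. Qed.
HB.instance Definition _ :=
  GRing.Lalgebra_isAlgebra.Build R (free_alg R) free_scaleAr.

Lemma free_mulE (f g : free_alg R) : f * g = fgmul f g.
Proof. by rewrite -[LHS]/(free_mul f g) free_mul.unlock. Qed.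

Lemma free_oneE : 1 = fgone {fmonom bool} R :> free_alg R.
Proof. by rewrite -[LHS]/(free_one R) free_one.unlock. Qed.
End FreeAlgebra.

Section Eval.
Context (R : comNzRingType) (B : nzRingType).
Context (phi : {rmorphism R -> B}) (u v : B).
Hypothesis phi_central : forall c b, phi c * b = b * phi c.

Definition word_eval (m : {fmonom bool}) : B :=
  \prod_(i <- (m : seq bool)) (if i then v else u).

Lemma word_eval_mmorphism : mmorphism word_eval.
Proof.
split=> [m1 m2|]; last by rewrite /word_eval fm1 big_nil.
by rewrite /word_eval fmM big_cat.
Qed.
HB.instance Definition _ :=
  isMultiplicative.Build _ _ word_eval word_eval_mmorphism.

Definition free_eval : free_alg R -> B := mmap phi word_eval.

Lemma free_eval_zmod : zmod_morphism free_eval.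
Proof. exact: mmap_is_additive. Qed.
HB.instance Definition _ :=
  GRing.isZmodMorphism.Build _ _ free_eval free_eval_zmod.

Lemma free_evalM : {morph free_eval : f g / f * g}.
Proof.
move=> f g; rewrite free_mulE.
have [fM _] := @commr_mmap_is_multiplicative _ _ _ phi word_eval
  (fun g m m' => phi_central (mcoeff m g) (word_eval m')).
exact: fM.
Qed.

Lemma free_eval1 : free_eval 1 = 1.
Proof. by rewrite free_oneE; apply: mmap1. Qed.

Lemma free_evalZ c g : free_eval (c *: g) = phi c * free_eval g.
Proof. exact: mmapZ. Qed.

Lemma free_eval_x : free_eval (free_x R) = u.
Proof.
rewrite /free_eval free_x.unlock mmapU /= rmorph1 mul1r.
by rewrite /word_eval fmuE /= big_seq1.
Qed.

Lemma free_eval_y : free_eval (free_y R) = v.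
Proof.
rewrite /free_eval free_y.unlock mmapU /= rmorph1 mul1r.
by rewrite /word_eval fmuE /= big_seq1.
Qed.
End Eval.

Section Ideal.
Context (R : comNzRingType) (q h : R).

Definition weyl_rel : free_alg R :=
  free_x R * free_y R - q *: (free_y R * free_x R) - h *: 1.

Definition weyl_ideal : {pred free_alg R} := fun f =>
  `[< exists s : seq (free_alg R * free_alg R),
        f = \sum_(ab <- s) ab.1 * weyl_rel * ab.2 >].

Lemma weyl_ideal_zmod : zmod_closed weyl_ideal.
Proof.
split=> [|f g /asboolP[s ->] /asboolP[t ->]]; apply/asboolP.
  by exists [::]; rewrite big_nil.
exists (s ++ [seq (- ab.1, ab.2) | ab <- t]).
rewrite big_cat big_map /= -sumrN; congr (_ + _).
by apply: eq_bigr => ab _; rewrite !mulNr.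
Qed.
HB.instance Definition _ :=
  GRing.isZmodClosed.Build (free_alg R) weyl_ideal weyl_ideal_zmod.

Lemma weyl_idealMl f g : g \in weyl_ideal -> f * g \in weyl_ideal.
Proof.
move=> /asboolP[s ->]; apply/asboolP.
exists [seq (f * ab.1, ab.2) | ab <- s]; rewrite big_map mulr_sumr.
apply: eq_bigr => -[a b] _ /=.
by rewrite (mulrA f (a * _) b) (mulrA f a weyl_rel).
Qed.

Lemma weyl_idealMr f g : f \in weyl_ideal -> f * g \in weyl_ideal.
Proof.
move=> /asboolP[s ->]; apply/asboolP.
exists [seq (ab.1, ab.2 * g) | ab <- s]; rewrite big_map mulr_suml.
apply: eq_bigr => -[a b] _ /=.
by rewrite (mulrA (a * _) b g).
Qed.

Lemma weyl_idealZ c f : f \in weyl_ideal -> c *: f \in weyl_ideal.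
Proof. by move=> If; rewrite -[f]mul1r scalerAl weyl_idealMl. Qed.

Lemma weyl_rel_in : weyl_rel \in weyl_ideal.
Proof.
by apply/asboolP; exists [:: (1, 1)]; rewrite big_seq1 mul1r mulr1.
Qed.

(* Representation on R[Y]: y is multiplication by Y and x maps Y^n to
   h (1 + q + ... + q^(n-1)) Y^(n-1). *)
Let qn n : R := \sum_(j < n) q ^+ j.

Let act_x (p : {poly R}) : {poly R} :=
  \poly_(i < size p) (h * qn i.+1 * p`_i.+1).

Let act_letter (b : bool) p := if b then 'X * p else act_x p.

Let coef_act_x p i : (act_x p)`_i = h * qn i.+1 * p`_i.+1.
Proof.
rewrite coef_poly; case: ltnP => // le_pi.
by rewrite nth_default ?mulr0 // ltnW.
Qed.

Let act_letter_lin b : linear (act_letter b).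
Proof.
move=> c p r; case: b => /=; first by rewrite mulrDr scalerAr.
apply/polyP=> i; rewrite coefD coefZ !coef_act_x coefD coefZ mulrDr.
by congr (_ + _); rewrite mulrCA.
Qed.

Let act_word (s : seq bool) p := foldr act_letter p s.

Let act_word_lin s : linear (act_word s).
Proof. by elim: s => [|b s IH] c p r //=; rewrite IH act_letter_lin. Qed.

Let act (f : free_alg R) p : {poly R} :=
  \sum_(m <- msupp f) mcoeff m f *: act_word m p.

Let actEw (d : {fset {fmonom bool}}) f p : msupp f `<=` d ->
  act f p = \sum_(m <- d) mcoeff m f *: act_word m p.
Proof.
move=> le; rewrite /act (big_fset_incl _ le) => //= x xd /mcoeff_outdom ->.
by rewrite scale0r.
Qed.

Let actU c m p : act << c *g m >> p = c *: act_word m p.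
Proof. by rewrite (actEw _ msuppU_le) big_seq_fset1 mcoeffUU. Qed.

Let actB f g p : act (f - g) p = act f p - act g p.
Proof.
pose E := (msupp f `|` msupp g `|` msupp (f - g)).
have sf : msupp f `<=` E by rewrite /E -fsetUA fsubsetUl.
have sg : msupp g `<=` E by rewrite /E fsetUAC fsubsetUr.
have sfg : msupp (f - g) `<=` E by rewrite /E fsubsetUr.
rewrite (actEw _ sf) (actEw _ sg) (actEw _ sfg).
rewrite -sumrB; apply: eq_bigr => m _.
by rewrite mcoeffB scalerBl.
Qed.

Let act0 p : act 0 p = 0.
Proof. by rewrite -(subrr 0) actB subrr. Qed.

Let actD f g p : act (f + g) p = act f p + act g p.
Proof.
have -> : f + g = f - (0 - g) by rewrite sub0r opprK.
by rewrite !actB act0 sub0r opprK.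
Qed.

Let act_sum (I : Type) (s : seq I) (F : I -> free_alg R) p :
  act (\sum_(i <- s) F i) p = \sum_(i <- s) act (F i) p.
Proof. by apply: (big_morph (act^~ p)) => // f g; apply: actD. Qed.

Let act_lin f : linear (act f).
Proof.
move=> c p r; rewrite /act scaler_sumr -big_split; apply: eq_bigr => m _.
by rewrite act_word_lin scalerDr !scalerA mulrC.
Qed.

Let actr0 f : act f 0 = 0.
Proof. by have := act_lin f (-1) 0 0; rewrite !scaleN1r oppr0 addr0 addNr. Qed.

Let act_wordZ s c p : act_word s (c *: p) = c *: act_word s p.
Proof.
have w0 : act_word s 0 = 0.
  by have := act_word_lin s (-1) 0 0; rewrite !scaleN1r oppr0 addr0 addNr.
by have := act_word_lin s c p 0; rewrite w0 !addr0.
Qed.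

Let act_word_sum (I : Type) (r : seq I) (F : I -> {poly R}) s :
  act_word s (\sum_(i <- r) F i) = \sum_(i <- r) act_word s (F i).
Proof.
apply: (big_morph (act_word s)) => [p t|].
  by rewrite -[p in LHS]scale1r act_word_lin scale1r.
by rewrite -[X in act_word s X](scale0r 0) act_wordZ scale0r.
Qed.

Let actM f g p : act (f * g) p = act f (act g p).
Proof.
rewrite free_mulE act_sum {2}/act; apply: eq_bigr => m _.
rewrite act_sum {2}/act act_word_sum scaler_sumr; apply: eq_bigr => m' _.
by rewrite actU act_wordZ scalerA fmM /act_word foldr_cat.
Qed.

Let actZ c f p : act (c *: f) p = c *: act f p.
Proof.
rewrite /act (big_fset_incl _ (msuppZ_le c f)) => [|m _ /mcoeff_outdom ->].
  rewrite scaler_sumr; apply: eq_bigr => m _.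
  by rewrite (mcoeffZ c f m) scalerA.
by rewrite scale0r.
Qed.

Let act1 p : act 1 p = p.
Proof. by rewrite free_oneE /fgone actU fm1 scale1r. Qed.

Let actx p : act (free_x R) p = act_x p.
Proof. by rewrite free_x.unlock actU fmuE scale1r. Qed.

Let acty p : act (free_y R) p = 'X * p.
Proof. by rewrite free_y.unlock actU fmuE scale1r. Qed.

Let act_rel p : act weyl_rel p = 0.
Proof.
rewrite /weyl_rel !actB (actZ q (free_y R * _)) (actZ h 1) (act1 p).
rewrite (actM (free_x R)) (actM (free_y R)).
rewrite (actx p) (acty p) (actx ('X * p)) (acty (act_x p)); apply/polyP=> i.
rewrite !coefB !coefZ coef_act_x coef0 ![('X * _)`_ _]coefXM.
case: i => [|i].
  by rewrite /qn big_ord1 expr0 mulr1 mulr0 subr0 subrr.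
rewrite coef_act_x [qn i.+2]/qn big_ord_recl expr0.
have -> : \sum_(j < i.+1) q ^+ lift ord0 j = q * qn i.+1.
  by rewrite /qn mulr_sumr; apply: eq_bigr => j _; rewrite /= /bump /= exprS.
by rewrite mulrDr mulr1 mulrDl !mulrA [h * q]mulrC addrK subrr.
Qed.

Lemma weyl_ideal1 : 1 \notin weyl_ideal.
Proof.
apply/negP=> /asboolP[s /(congr1 (act^~ 1))]; rewrite act_sum big1 => [|ab _].
  by rewrite act1 => /eqP; rewrite oner_eq0.
by rewrite !actM act_rel actr0.
Qed.

End Ideal.

(* R{x, y} / (xy - q yx - h): the quantum plane W_qp for h = 0, the q-Weyl
   algebra W_q for h = 1, and the deformation W_q(hbar) of W_qp for R = k[X] and
   h = 'X, where 'X plays the role of hbar. *)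
Definition weyl (R : comNzRingType) (q h : R) : Type :=
  Quotient.quot (weyl_ideal q h).

Section Weyl.
Context (R : comNzRingType) (q h : R).
Local Notation W := (weyl q h).

HB.instance Definition _ := GRing.Zmodule.copy W (Quotient.quot (weyl_ideal q h)).

Definition weyl_pi (f : free_alg R) : W := \pi_(Quotient.quot (weyl_ideal q h)) f.
Definition weyl_repr (a : W) : free_alg R :=
  repr (a : Quotient.quot (weyl_ideal q h)).

Lemma weyl_reprK a : weyl_pi (weyl_repr a) = a.
Proof. exact: reprK. Qed.

Lemma weyl_pi_eq f g : reflect (weyl_pi f = weyl_pi g) (f - g \in weyl_ideal q h).
Proof. by rewrite Quotient.idealrBE; apply: eqP. Qed.

Lemma weyl_piK f : weyl_repr (weyl_pi f) - f \in weyl_ideal q h.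
Proof. by apply/weyl_pi_eq; rewrite weyl_reprK. Qed.

Fact weyl_pi_zmod : zmod_morphism weyl_pi.
Proof. by move=> f g; rewrite /weyl_pi !piE. Qed.
HB.instance Definition _ := GRing.isZmodMorphism.Build _ _ weyl_pi weyl_pi_zmod.

End Weyl.

HB.lock Definition weyl_one (R : comNzRingType) (q h : R) : weyl q h := weyl_pi q h 1.
HB.lock Definition weyl_mul (R : comNzRingType) (q h : R) (a b : weyl q h) :
  weyl q h := weyl_pi q h (weyl_repr a * weyl_repr b).
HB.lock Definition weyl_scale (R : comNzRingType) (q h : R) (c : R)
  (a : weyl q h) : weyl q h := weyl_pi q h (c *: weyl_repr a).

Section WeylAlgebra.
Context (R : comNzRingType) (q h : R).
Local Notation W := (weyl q h).
Local Notation pi := (weyl_pi q h).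

Fact weyl_piM_lock f g : pi (f * g) = weyl_mul (pi f) (pi g).
Proof.
rewrite weyl_mul.unlock; apply/esym/weyl_pi_eq.
set f' := weyl_repr _; set g' := weyl_repr _.
have -> : f' * g' - f * g = (f' - f) * g' + f * (g' - g).
  by rewrite mulrBl mulrBr addrA subrK.
apply: rpredD; first exact/weyl_idealMr/weyl_piK.
exact/weyl_idealMl/weyl_piK.
Qed.

Fact weyl_piZ_lock c f : pi (c *: f) = weyl_scale c (pi f).
Proof.
rewrite weyl_scale.unlock; apply/esym/weyl_pi_eq.
by rewrite -scalerBr; apply/weyl_idealZ/weyl_piK.
Qed.

Fact weyl_mulA : associative (@weyl_mul R q h).
Proof.
move=> a b c; rewrite -[a]weyl_reprK -[b]weyl_reprK -[c]weyl_reprK.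
by rewrite -!weyl_piM_lock mulrA.
Qed.
Fact weyl_mul1 : left_id (weyl_one q h) (@weyl_mul R q h).
Proof.
by move=> a; rewrite -[a]weyl_reprK weyl_one.unlock -weyl_piM_lock mul1r.
Qed.
Fact weyl_mulr1 : right_id (weyl_one q h) (@weyl_mul R q h).
Proof.
by move=> a; rewrite -[a]weyl_reprK weyl_one.unlock -weyl_piM_lock mulr1.
Qed.
Fact weyl_mulDl : left_distributive (@weyl_mul R q h) +%R.
Proof.
move=> a b c; rewrite -[a]weyl_reprK -[b]weyl_reprK -[c]weyl_reprK.
by rewrite -raddfD -!weyl_piM_lock -raddfD mulrDl.
Qed.
Fact weyl_mulDr : right_distributive (@weyl_mul R q h) +%R.
Proof.
move=> a b c; rewrite -[a]weyl_reprK -[b]weyl_reprK -[c]weyl_reprK.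
by rewrite -raddfD -!weyl_piM_lock -raddfD mulrDr.
Qed.
Fact weyl_one_neq0 : weyl_one q h != 0.
Proof.
apply/eqP; rewrite weyl_one.unlock -(raddf0 pi) => /weyl_pi_eq.
by rewrite subr0 => I1; have := weyl_ideal1 q h; rewrite I1.
Qed.
HB.instance Definition _ := GRing.Zmodule_isNzRing.Build W
  weyl_mulA weyl_mul1 weyl_mulr1 weyl_mulDl weyl_mulDr weyl_one_neq0.

Fact weyl_scaleA c d (a : W) :
  weyl_scale c (weyl_scale d a) = weyl_scale (c * d) a.
Proof. by rewrite -[a]weyl_reprK -!weyl_piZ_lock scalerA. Qed.
Fact weyl_scale1 : left_id 1 (@weyl_scale R q h).
Proof. by move=> a; rewrite -[a]weyl_reprK -weyl_piZ_lock scale1r. Qed.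
Fact weyl_scaleDr : right_distributive (@weyl_scale R q h) +%R.
Proof.
move=> c a b; rewrite -[a]weyl_reprK -[b]weyl_reprK.
by rewrite -raddfD -!weyl_piZ_lock -raddfD scalerDr.
Qed.
Fact weyl_scaleDl (a : W) : {morph (@weyl_scale R q h)^~ a : c d / c + d}.
Proof.
move=> c d; rewrite -[a]weyl_reprK.
by rewrite -!weyl_piZ_lock -raddfD scalerDl.
Qed.
HB.instance Definition _ := GRing.Zmodule_isLmodule.Build R W
  weyl_scaleA weyl_scale1 weyl_scaleDr weyl_scaleDl.

Lemma weyl_pi1 : pi 1 = 1.
Proof. by rewrite -[RHS]/(weyl_one q h) weyl_one.unlock. Qed.
Lemma weyl_piM : {morph pi : f g / f * g}.
Proof. exact: weyl_piM_lock. Qed.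
Lemma weyl_piZ c f : pi (c *: f) = c *: pi f.
Proof. exact: weyl_piZ_lock. Qed.

Fact weyl_scaleAl c (a b : W) : c *: (a * b) = c *: a * b.
Proof.
rewrite -[a]weyl_reprK -[b]weyl_reprK.
by rewrite -weyl_piM -!weyl_piZ -weyl_piM scalerAl.
Qed.
HB.instance Definition _ := GRing.Lmodule_isLalgebra.Build R W weyl_scaleAl.
Fact weyl_scaleAr c (a b : W) : c *: (a * b) = a * (c *: b).
Proof.
rewrite -[a]weyl_reprK -[b]weyl_reprK.
by rewrite -weyl_piM -!weyl_piZ -weyl_piM scalerAr.
Qed.
HB.instance Definition _ := GRing.Lalgebra_isAlgebra.Build R W weyl_scaleAr.

Definition weyl_x : W := pi (free_x R).
Definition weyl_y : W := pi (free_y R).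

Lemma weyl_relation : weyl_x * weyl_y - q *: (weyl_y * weyl_x) = h%:A.
Proof.
apply/eqP; rewrite -subr_eq0; apply/eqP.
rewrite /weyl_x /weyl_y -!weyl_piM -weyl_pi1 -!weyl_piZ -!raddfB -(raddf0 pi).
by apply/weyl_pi_eq; rewrite subr0 weyl_rel_in.
Qed.

Section Universal.
Context (B : nzRingType) (phi : {rmorphism R -> B}) (u v : B).

Definition weyl_eval (a : W) : B := free_eval phi u v (weyl_repr a).

Hypothesis phi_central : forall c b, phi c * b = b * phi c.
Hypothesis uv_rel : u * v - phi q * (v * u) = phi h.

Lemma weyl_eval_pi f : weyl_eval (pi f) = free_eval phi u v f.
Proof.
apply/eqP; rewrite -subr_eq0 /weyl_eval -raddfB; apply/eqP.
have /asboolP[s ->] := weyl_piK q h f.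
rewrite raddf_sum big1 // => -[a b] _ /=.
rewrite !free_evalM // /weyl_rel !raddfB /= !free_evalZ !free_evalM //.
rewrite free_eval1 free_eval_x free_eval_y uv_rel mulr1 subrr.
by rewrite mulr0 mul0r.
Qed.

Lemma weyl_eval_zmod : zmod_morphism weyl_eval.
Proof.
move=> a b; rewrite -[a]weyl_reprK -[b]weyl_reprK.
by rewrite -raddfB !weyl_eval_pi raddfB.
Qed.
Lemma weyl_evalM : {morph weyl_eval : a b / a * b}.
Proof.
move=> a b; rewrite -[a]weyl_reprK -[b]weyl_reprK.
by rewrite -weyl_piM !weyl_eval_pi free_evalM.
Qed.
Lemma weyl_eval1 : weyl_eval 1 = 1.
Proof. by rewrite -weyl_pi1 weyl_eval_pi free_eval1. Qed.
Lemma weyl_evalZ c a : weyl_eval (c *: a) = phi c * weyl_eval a.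
Proof. by rewrite -[a]weyl_reprK -weyl_piZ !weyl_eval_pi free_evalZ. Qed.
Lemma weyl_eval_x : weyl_eval weyl_x = u.
Proof. by rewrite weyl_eval_pi free_eval_x. Qed.
Lemma weyl_eval_y : weyl_eval weyl_y = v.
Proof. by rewrite weyl_eval_pi free_eval_y. Qed.
End Universal.
End WeylAlgebra.

Arguments weyl_x {R} q h.
Arguments weyl_y {R} q h.

Section Specialization.
Context (k : fieldType) (q : k).

Definition weyl_hbar := weyl (q%:P) ('X : {poly k}).
HB.instance Definition _ := GRing.Algebra.copy weyl_hbar (weyl (q%:P) ('X : {poly k})).

(* The specialization of the parameter 'X at t. *)
Definition hbar_at (t : k) : weyl_hbar -> weyl q t :=
  weyl_eval (in_alg (weyl q t) \o horner_eval t) (weyl_x q t) (weyl_y q t).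

Context (t : k).

Let phi_central (c : {poly k}) (b : weyl q t) :
  (in_alg (weyl q t) \o horner_eval t) c * b =
  b * (in_alg (weyl q t) \o horner_eval t) c.
Proof. by rewrite /= -scalerAl -scalerAr mul1r mulr1. Qed.

Let xy_rel : let phi := in_alg (weyl q t) \o horner_eval t in
  weyl_x q t * weyl_y q t - phi q%:P * (weyl_y q t * weyl_x q t) = phi 'X.
Proof.
rewrite /= /horner_eval hornerC hornerX -scalerAl mul1r.
exact: weyl_relation.
Qed.

Fact hbar_at_zmod : zmod_morphism (hbar_at t).
Proof. exact: weyl_eval_zmod phi_central xy_rel. Qed.
Fact hbar_at_monoid : monoid_morphism (hbar_at t).
Proof.
split; first exact: weyl_eval1 phi_central xy_rel.
exact: weyl_evalM phi_central xy_rel.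
Qed.
HB.instance Definition _ :=
  GRing.isZmodMorphism.Build weyl_hbar (weyl q t) (hbar_at t) hbar_at_zmod.
HB.instance Definition _ :=
  GRing.isMonoidMorphism.Build weyl_hbar (weyl q t) (hbar_at t) hbar_at_monoid.

Lemma hbar_atZ c a : hbar_at t (c *: a) = c.[t] *: hbar_at t a.
Proof.
by rewrite [LHS](weyl_evalZ phi_central xy_rel) /= -scalerAl mul1r.
Qed.
Lemma hbar_at_x : hbar_at t (weyl_x q%:P 'X) = weyl_x q t.
Proof. exact: weyl_eval_x phi_central xy_rel. Qed.
Lemma hbar_at_y : hbar_at t (weyl_y q%:P 'X) = weyl_y q t.
Proof. exact: weyl_eval_y phi_central xy_rel. Qed.
End Specialization.

Section Hochschild.
Context (R : comNzRingType) (A : algType R).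

Definition cochain n := {ffun 'I_n -> A} -> A.

Definition multilinear n (f : cochain n) :=
  forall (a : {ffun 'I_n -> A}) (i : 'I_n) (c : R) (u v : A),
    f (finfun [eta a with i |-> c *: u + v]) =
    c *: f (finfun [eta a with i |-> u]) + f (finfun [eta a with i |-> v]).

(* (a_0, ..., a_i * a_(i+1), ..., a_n) *)
Definition merge n (i : 'I_n) (a : {ffun 'I_n.+1 -> A}) : {ffun 'I_n -> A} :=
  [ffun j : 'I_n =>
     if (j < i)%N then a (widen_ord (leqnSn n) j)
     else if j == i then a (widen_ord (leqnSn n) j) * a (lift ord0 j)
     else a (lift ord0 j)].

Definition hoch_diff n (f : cochain n) : cochain n.+1 := fun a =>
  a ord0 * f [ffun j => a (lift ord0 j)]
  + \sum_(i < n) (-1) ^+ i.+1 * f (merge i a)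
  + (-1) ^+ n.+1 * (f [ffun j => a (widen_ord (leqnSn n) j)] * a ord_max).

Definition cocycle n (f : cochain n) :=
  multilinear f /\ (forall a, hoch_diff f a = 0).

Definition coboundary n : cochain n -> Prop :=
  match n with
  | 0 => fun f => forall a, f a = 0
  | n'.+1 => fun f => exists g : cochain n',
      multilinear g /\ forall a, f a = hoch_diff g a
  end.

(* [f] = [g] in H^n(A) = H^n(A, A). *)
Definition cohomologous n (f g : cochain n) := coboundary (f \- g).

Definition central (c : A) := forall a : A, c * a = a * c.

Definition derivation (D : A -> A) :=
  linear D /\ forall a b, D (a * b) = D a * b + a * D b.

Definition cochain1 (D : A -> A) : cochain 1 := fun a => D (a ord0).

Definition cup (D1 D2 : A -> A) : cochain 2 :=
  fun a => D1 (a ord0) * D2 (a ord_max).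

End Hochschild.

Definition wedge (k : fieldType) (A : algType k) (D1 D2 : A -> A) :
  cochain A 2 := fun a => 2^-1 *: (cup D1 D2 a - cup D2 D1 a).

Section Lifts.
Context (k : fieldType) (q : k).

(* An n-cocycle Z of the k[X]-algebra W_q('X) is determined by its values on
   k-combinations of the x^i y^j, i.e. by a series z + 'X z_1 + 'X^2 z_2 + ...
   of n-cochains of the quantum plane which is finite on each argument; its
   constant term z and its sum at 'X = 1 are the reductions of Z along the
   specializations of 'X at 0 and at 1. *)
Definition hbar_lift n (z : cochain (weyl q 0) n)
    (Z : cochain (weyl_hbar q) n) :=
  cocycle Z /\
  forall a, hbar_at 0 (Z a) = z [ffun i => hbar_at 0 (a i)].

Definition lift_to_weyl n (z : cochain (weyl q 0) n)
    (w : cochain (weyl q 1) n) :=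
  exists Z, hbar_lift z Z /\
    forall a, hbar_at 1 (Z a) = w [ffun i => hbar_at 1 (a i)].
End Lifts.

From mathcomp Require Import mpoly.

(* k[u, v]; the variables u = 'X_0 and v = 'X_1 stand for x^N and y^N. *)
Notation center_poly k := (mpoly.mpoly 2 k).

Section Center.
Context (k : fieldType) (N : nat) (q h : k).

Definition center_eval (P : center_poly k) : weyl q h :=
  mmap (in_alg (weyl q h))
    (fun i : 'I_2 => if i == ord0 then weyl_x q h ^+ N else weyl_y q h ^+ N) P.

Definition center_act n (P : center_poly k) (f : cochain (weyl q h) n) :
  cochain (weyl q h) n := fun a => center_eval P * f a.
End Center.

Arguments center_eval {k} N q h P.
Arguments center_act {k} N {q h n} P f.

(* The free k[u, v]-module on the symbols x d/dx and y d/dy. *)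
Notation euler_module k := 'rV[center_poly k]_2.

Section EulerModule.
Context (k : fieldType).

Definition euler_x : euler_module k := delta_mx ord0 ord0.
Definition euler_y : euler_module k := delta_mx ord0 ord_max.

Definition gen_E : euler_module k := euler_x - euler_y.
Definition gen_u : euler_module k := 'X_ord0 *: euler_x.
Definition gen_v : euler_module k := 'X_ord_max *: euler_y.

Definition H1_submodule (m : euler_module k) :=
  exists P0 P1 P2 : center_poly k, m = P0 *: gen_E + P1 *: gen_u + P2 *: gen_v.

(* msize is the total degree plus one. *)
Definition degree_lt (d : nat) (m : euler_module k) :=
  forall i, (msize (m ord0 i) <= d)%N.
End EulerModule.

(* The derivation a x d/dx + b y d/dy of the quantum plane, for m = (a, b) and
   dx = x d/dx, dy = y d/dy. *)
Definition euler_derivation (k : fieldType) (N : nat) (q : k)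
    (dx dy : weyl q 0 -> weyl q 0) (m : euler_module k) :
    weyl q 0 -> weyl q 0 :=
  fun a => center_eval N q 0 (m ord0 ord0) * dx a
           + center_eval N q 0 (m ord0 ord_max) * dy a.

(* Main.v *)
(* The monomials y^j x^i form a basis of R{x, y}/(xy - q yx - h) over any
   commutative ring R; independence follows from the left regular action on
   R[X][Y]. With this basis, low-degree Hochschild cohomology is that of the
   complex A -> A^2 -> A given by c |-> ([x, c], [y, c]) and
   (a, b) |-> a y - q y a + x b - q b x: a derivation is determined by its values
   (a, b) on (x, y), and a 2-cocycle f is a coboundary exactly when
   f(x, y) - q f(y, x) + h f(1, 1) lies in the image of the second map.
   At h = 1, that image has as complement the free module over the center on yx.
   The class of yx is hit by the derivative q d/dq of the multiplication in the
   basis y^j x^i, which at h = 0 is the cup product of x d/dx and y d/dy.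
   H^1 is found by induction on the total degree in x and y: the leading component
   of a derivation of W_q is a derivation of the quantum plane, hence inner plus
   P x d/dx + Q y d/dy, and the relation in degree 0 forces P + Q to have no
   constant term. *)
Require Import Defs.
From HB Require Import structures.
From mathcomp Require Import all_boot ssralg poly matrix.
From mathcomp Require Import boolp finmap monalg.
From mathcomp Require Import mpoly.
From mathcomp Require Import ring zify.

Set Implicit Arguments.
Unset Strict Implicit.
Unset Printing Implicit Defensive.

Import GRing.Theory.
Local Open Scope ring_scope.

(** * The ring of R-linear operators on polynomials in two variables *)

Section Operators.
Context (R : comNzRingType).
Local Notation V := {poly {poly R}}.

(** Keeping h as a parameter over any R lets one formula serve three times: a derivation or
    2-cocycle written over k[X] with h = 'X specializes to the quantum plane at 0 and to W_q at 1,
    so lifts need no order-by-order construction. The obstacle in H^1 is the action of the center.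
    The generators satisfy u v [gen_E] = v [gen_u] - u [gen_v], while their lifts carry correction
    terms, and the relation is controlled only modulo lower degree. The map from the submodule to
    derivations therefore rests on a fixed k-linear choice of coefficients, and it respects the
    center up to classes of smaller degree. Injectivity in H^1 comes from x^N and y^N: inner
    derivations kill them, whereas a lift sends x^N to N P x^N plus lower terms, P being the
    coefficient of x d/dx; so N must be nonzero in k. Directness in H^2 comes from explicit linear
    forms that vanish on the image of the second map and read off the coefficients of P in P yx. *)

Record op := Op {
  op_fun :> V -> V;
  op_linear : forall c P Q, op_fun (c%:P *: P + Q) = c%:P *: op_fun P + op_fun Q }.

HB.instance Definition _ := gen_eqMixin op.
HB.instance Definition _ := gen_choiceMixin op.

Lemma op_eq (f g : op) : op_fun f =1 op_fun g -> f = g.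
Proof.
case: f g => [f Hf] [g Hg] /= /funext fg; rewrite fg in Hf *.
by congr Op; apply: Prop_irrelevance.
Qed.

Lemma opD (f : op) : {morph f : P Q / P + Q}.
Proof. by move=> P Q; rewrite -[P in LHS](scale1r P) op_linear !scale1r. Qed.
Lemma op0 (f : op) : f 0 = 0.
Proof. by apply: (addrI (f 0)); rewrite -opD !addr0. Qed.
Lemma opZ (f : op) c P : f (c%:P *: P) = c%:P *: f P.
Proof. by rewrite -[X in f X](addr0) op_linear op0 addr0. Qed.

Let add_lin (f g : op) c P Q :
  f (c%:P *: P + Q) + g (c%:P *: P + Q) =
  c%:P *: (f P + g P) + (f Q + g Q).
Proof. by rewrite !op_linear scalerDr addrACA. Qed.
Let opp_lin (f : op) c P Q :
  - f (c%:P *: P + Q) = c%:P *: (- f P) + - f Q.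
Proof. by rewrite op_linear opprD scalerN. Qed.
Let comp_lin (f g : op) c P Q :
  f (g (c%:P *: P + Q)) = c%:P *: f (g P) + f (g Q).
Proof. by rewrite !op_linear. Qed.
Let zero_lin (c : R) (P Q : V) : 0 = c%:P *: 0 + 0 :> V.
Proof. by rewrite scaler0 addr0. Qed.

Definition op_add f g := Op (add_lin f g).
Definition op_opp f := Op (opp_lin f).
Definition op_zero := @Op (fun=> 0) zero_lin.
Definition op_one := @Op id (fun _ _ _ => erefl).
Definition op_mul f g := Op (comp_lin f g).

Fact op_addA : associative op_add.
Proof. by move=> f g e; apply: op_eq => P /=; rewrite addrA. Qed.
Fact op_addC : commutative op_add.
Proof. by move=> f g; apply: op_eq => P /=; rewrite addrC. Qed.
Fact op_add0 : left_id op_zero op_add.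
Proof. by move=> f; apply: op_eq => P /=; rewrite add0r. Qed.
Fact op_addN : left_inverse op_zero op_opp op_add.
Proof. by move=> f; apply: op_eq => P /=; rewrite addNr. Qed.
HB.instance Definition _ :=
  GRing.isZmodule.Build op op_addA op_addC op_add0 op_addN.

Fact op_mulA : associative op_mul.
Proof. by move=> f g e; apply: op_eq. Qed.
Fact op_mul1 : left_id op_one op_mul.
Proof. by move=> f; apply: op_eq. Qed.
Fact op_mulr1 : right_id op_one op_mul.
Proof. by move=> f; apply: op_eq. Qed.
Fact op_mulDl : left_distributive op_mul +%R.
Proof. by move=> f g e; apply: op_eq. Qed.
Fact op_mulDr : right_distributive op_mul +%R.
Proof. by move=> f g e; apply: op_eq => P /=; rewrite opD. Qed.
Fact op_one_neq0 : op_one != 0.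
Proof.
by apply/eqP => /(congr1 (fun f : op => f 1)) /= /eqP; rewrite oner_eq0.
Qed.
HB.instance Definition _ := GRing.Zmodule_isNzRing.Build op
  op_mulA op_mul1 op_mulr1 op_mulDl op_mulDr op_one_neq0.

Let scal_lin (d c : R) (P Q : V) :
  d%:P *: (c%:P *: P + Q) = c%:P *: (d%:P *: P) + d%:P *: Q.
Proof. by rewrite scalerDr !scalerA mulrC. Qed.
Definition op_scal d := Op (scal_lin d).

Fact op_scal_zmod : zmod_morphism op_scal.
Proof. by move=> c d; apply: op_eq => P /=; rewrite polyCB scalerBl. Qed.
Fact op_scal_monoid : monoid_morphism op_scal.
Proof.
split=> [|c d]; apply: op_eq => P /=; first by rewrite polyC1 scale1r.
by rewrite polyCM scalerA.
Qed.
HB.instance Definition _ :=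
  GRing.isZmodMorphism.Build R op op_scal op_scal_zmod.
HB.instance Definition _ :=
  GRing.isMonoidMorphism.Build R op op_scal op_scal_monoid.

Lemma op_scalC c f : op_scal c * f = f * op_scal c.
Proof. by apply: op_eq => P; rewrite /= opZ. Qed.
End Operators.

(** * The basis y^j x^i, coordinates, and linear maps given on the basis *)

Section PBW.
Context (R : comNzRingType) (q h : R).
Local Notation V := {poly {poly R}}.
Local Notation A := (weyl q h).
Local Notation x := (weyl_x q h).
Local Notation y := (weyl_y q h).

Definition qn n : R := \sum_(j < n) q ^+ j.

Lemma qn0 : qn 0 = 0. Proof. by rewrite /qn big_ord0. Qed.
Lemma qn1 : qn 1 = 1. Proof. by rewrite /qn big_ord1 expr0. Qed.
Lemma qnS n : qn n.+1 = 1 + q * qn n.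
Proof.
rewrite /qn big_ord_recl expr0 mulr_sumr; congr (_ + _).
by apply: eq_bigr => j _; rewrite /= /bump /= exprS.
Qed.
Lemma qnE n : (q - 1) * qn n = q ^+ n - 1.
Proof. by rewrite -subrX1. Qed.

(* P`_j`_i is the coefficient of y^j x^i. *)
Definition act_y (P : V) : V := 'X * P.
(** The rule x y^j = q^j y^j x + h [j]_q y^(j-1) read on coefficients: the one of y^j receives a
    contribution from y^(j+1), whence the index [j.+1] in [qn]. *)
Definition act_x (P : V) : V :=
  \poly_(j < size P) ((q ^+ j)%:P * ('X * P`_j) + (h * qn j.+1)%:P * P`_j.+1).

Lemma coef_act_x P j :
  (act_x P)`_j = (q ^+ j)%:P * ('X * P`_j) + (h * qn j.+1)%:P * P`_j.+1.
Proof.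
rewrite coef_poly; case: ltnP => // le_Pj.
by rewrite !nth_default ?mulr0 ?addr0 // ltnW.
Qed.

Fact act_y_linear c P Q : act_y (c%:P *: P + Q) = c%:P *: act_y P + act_y Q.
Proof. by rewrite /act_y mulrDr scalerAr. Qed.
Fact act_x_linear c P Q : act_x (c%:P *: P + Q) = c%:P *: act_x P + act_x Q.
Proof.
apply/polyP => j; rewrite coefD coefZ !coef_act_x !coefD !coefZ; ring.
Qed.
Definition op_x := Op act_x_linear.
Definition op_y := Op act_y_linear.

Fact op_rel : op_x * op_y - op_scal q * (op_y * op_x) = op_scal h.
Proof.
apply: op_eq => P /=; apply/polyP => j.
rewrite /act_y coefB !coefZ coef_act_x !coefXM.
case: j => [|j] /=; first by rewrite qn1; ring.
by rewrite coef_act_x [qn j.+2]qnS exprS !polyCM polyCD polyCM polyC1; ring.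
Qed.

Definition weyl_act : A -> op R := weyl_eval (@op_scal R) op_x op_y.

Fact weyl_act_zmod : zmod_morphism weyl_act.
Proof. exact: weyl_eval_zmod (@op_scalC R) op_rel. Qed.
Fact weyl_act_monoid : monoid_morphism weyl_act.
Proof.
split; first exact: weyl_eval1 (@op_scalC R) op_rel.
exact: weyl_evalM (@op_scalC R) op_rel.
Qed.
HB.instance Definition _ := GRing.isZmodMorphism.Build _ _ weyl_act weyl_act_zmod.
HB.instance Definition _ :=
  GRing.isMonoidMorphism.Build _ _ weyl_act weyl_act_monoid.

Lemma weyl_actZ c a : weyl_act (c *: a) = op_scal c * weyl_act a.
Proof. exact: weyl_evalZ (@op_scalC R) op_rel _ _. Qed.
Lemma weyl_act_x : weyl_act x = op_x.
Proof. exact: weyl_eval_x (@op_scalC R) op_rel. Qed.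
Lemma weyl_act_y : weyl_act y = op_y.
Proof. exact: weyl_eval_y (@op_scalC R) op_rel. Qed.

(** Applying the action to 1 produces the normal form of [a], so the coordinates exist as linear
    forms before the monomials are known to span. *)
Definition cf j i (a : A) : R := (weyl_act a 1)`_j`_i.

Fact cf_linear j i : linear_for *%R (cf j i).
Proof.
move=> c a b; rewrite /cf rmorphD /= weyl_actZ /= coefD coefZ coefD.
by rewrite mul_polyC coefZ.
Qed.
HB.instance Definition _ j i :=
  GRing.isLinear.Build R A R *%R (cf j i) (cf_linear j i).

Lemma cf0 j i : cf j i 0 = 0. Proof. exact: linear0. Qed.
Lemma cfD j i : {morph cf j i : a b / a + b}. Proof. exact: linearD. Qed.
Lemma cfN j i : {morph cf j i : a / - a}. Proof. exact: linearN. Qed.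
Lemma cfZ j i c a : cf j i (c *: a) = c * cf j i a. Proof. exact: linearZ. Qed.
Lemma cfP j i c a b : cf j i (c *: a + b) = c * cf j i a + cf j i b.
Proof. by rewrite cfD cfZ. Qed.
Definition cfE := (cf0, cfD, cfN, cfZ).

Definition pbw_mono j i : A := y ^+ j * x ^+ i.
Local Notation mono := pbw_mono.

Lemma cf_mono j i J I : cf J I (mono j i) = ((J == j) && (I == i))%:R.
Proof.
have actX n : weyl_act (x ^+ n) 1 = ('X^n)%:P.
  elim: n => [|n IH]; first by rewrite expr0 rmorph1.
  rewrite exprS rmorphM /= weyl_act_x /= IH; apply/polyP => k.
  rewrite coef_act_x !coefC; case: k => [|k] /=; last by rewrite !mulr0 addr0.
  by rewrite expr0 mul1r mulr0 addr0 exprS.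
have actY n P : weyl_act (y ^+ n) P = 'X^n * P.
  elim: n => [|n IH]; first by rewrite !expr0 rmorph1 mul1r.
  by rewrite exprS rmorphM /= weyl_act_y /= IH /act_y exprS mulrA.
rewrite /cf /pbw_mono rmorphM /= actX actY coefMC coefXn.
by case: (J == j); rewrite ?mul0r ?coef0 // mul1r coefXn.
Qed.

(** Every element is the image of a combination of words, and a word is built by adding letters on
    the left. No normal form is involved. *)
Lemma weyl_ind (P : A -> Prop) :
  P 1 -> (forall c a b, P a -> P b -> P (c *: a + b)) ->
  (forall a, P a -> P (x * a)) -> (forall a, P a -> P (y * a)) ->
  forall a, P a.
Proof.
move=> P1 Plin Px Py a.
have P0 : P 0 by rewrite -(addNr 1) -scaleN1r; apply: Plin.
rewrite -(weyl_reprK a); set f : free_alg R := weyl_repr a.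
rewrite [f]monalgE raddf_sum; elim/big_rec: _ => // m b _ Pb.
pose U (m : {fmonom bool}) : free_alg R := << m >>.
have UE c : << c *g m >> = c *: U m :> free_alg R.
  apply/malgP => k; rewrite monalg.mcoeffZ !monalg.mcoeffU.
  by rewrite mulr_natr.
rewrite UE -[X in P (X + b)]/(weyl_pi q h _) weyl_piZ.
apply: Plin => // {b Pb UE}.
rewrite -(fmK m); elim: (fmonom_val m) => [|b s IH].
  have <- : mone = FMonom [::] :> {fmonom bool} by apply/eqP; rewrite fmP fm1.
  by have := P1; rewrite -weyl_pi1 free_oneE.
have -> : U (FMonom (b :: s)) = (if b then free_y R else free_x R) * U (FMonom s).
  rewrite free_mulE free_x.unlock free_y.unlock.
  have -> : (if b then << fmu true >> else << fmu false >>) = << fmu b >>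
    :> {malg R[{fmonom bool}]} by case: b.
  rewrite fgmulUU mulr1; congr mkmalgU.
  by apply/eqP; rewrite fmP fmM fmuE.
by rewrite weyl_piM; case: b; [apply: Py | apply: Px].
Qed.

Lemma weyl_xy : x * y = q *: (y * x) + h%:A.
Proof. by rewrite -weyl_relation addrC subrK. Qed.

Lemma monoS j i : mono j.+1 i = y * mono j i.
Proof. by rewrite /pbw_mono exprS mulrA. Qed.
Lemma monoSr j i : mono j i.+1 = mono j i * x.
Proof. by rewrite /pbw_mono exprSr mulrA. Qed.
Lemma mono0 j : mono j 0 = y ^+ j.
Proof. by rewrite /pbw_mono expr0 mulr1. Qed.
Lemma mono0r i : mono 0 i = x ^+ i.
Proof. by rewrite /pbw_mono expr0 mul1r. Qed.
Lemma x_mono j i :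
  x * mono j i = q ^+ j *: mono j i.+1 + (h * qn j) *: mono j.-1 i.
Proof.
elim: j => [|j IH].
  by rewrite !mono0r expr0 scale1r qn0 mulr0 scale0r addr0 exprS.
rewrite monoS mulrA weyl_xy mulrDl -weyl_scaleAl -mulrA IH mulr_algl mulrDr.
rewrite -!weyl_scaleAr -!monoS scalerDr !scalerA -exprS -addrA /=; congr (_ + _).
case: j {IH} => [|j]; first by rewrite qn0 !mulr0 scale0r add0r qn1 mulr1.
rewrite /= -scalerDl [qn j.+2]qnS; congr (_ *: _); ring.
Qed.

Lemma mono_y j i :
  mono j i * y = q ^+ i *: mono j.+1 i + (h * qn i) *: mono j i.-1.
Proof.
elim: i => [|i IH].
  by rewrite !mono0 expr0 scale1r qn0 mulr0 scale0r addr0 exprSr.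
rewrite monoSr -mulrA weyl_xy mulrDr -weyl_scaleAr mulrA IH mulr_algr mulrDl.
rewrite -!weyl_scaleAl -!monoSr scalerDr !scalerA -exprS -addrA /=; congr (_ + _).
case: i {IH} => [|i]; first by rewrite qn0 !mulr0 scale0r add0r qn1 mulr1.
rewrite /= -scalerDl [qn i.+2]qnS; congr (_ *: _); ring.
Qed.

(** Spanning by the monomials. The predicate is generalized in the induction: for x * a the
    hypothesis is applied to [fun b => P (x * b)], because x times a monomial is again a combination
    of monomials. *)
Lemma mono_ind (P : A -> Prop) :
  P 0 -> (forall c a b, P a -> P b -> P (c *: a + b)) ->
  (forall j i, P (mono j i)) -> forall a, P a.
Proof.
move=> P0 Plin Pmono a; move: P P0 Plin Pmono.
elim/weyl_ind: a => [|c a b IHa IHb|a IH|a IH] P P0 Plin Pmono.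
- by have := Pmono 0 0; rewrite mono0 expr0.
- exact: Plin (IHa P P0 Plin Pmono) (IHb P P0 Plin Pmono).
- apply: (IH (fun b => P (x * b))) => [|c b d|j i]; first by rewrite mulr0.
    by rewrite mulrDr -weyl_scaleAr; apply: Plin.
  by rewrite x_mono; apply: (Plin) => //; rewrite -[_ *: _]addr0; apply: Plin.
- apply: (IH (fun b => P (y * b))) => [|c b d|j i]; first by rewrite mulr0.
    by rewrite mulrDr -weyl_scaleAr; apply: Plin.
  by rewrite -monoS.
Qed.

Definition cf_bounded (a : A) n :=
  forall j i, (n <= j)%N || (n <= i)%N -> cf j i a = 0.

Lemma cf_bounded_ex a : exists n, cf_bounded a n.
Proof.
elim/mono_ind: a => [|c a b [n Ha] [m Hb]|j i].
- by exists 0 => j i _; rewrite cf0.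
- exists (maxn n m) => j i; rewrite !geq_max => H; rewrite cfP Ha ?Hb.
  + by rewrite mulr0 addr0.
  + by case/orP: H => /andP[_ ->]; rewrite ?orbT.
  + by case/orP: H => /andP[-> _]; rewrite ?orbT.
- exists (maxn j.+1 i.+1) => J I; rewrite !geq_max cf_mono.
  by case: eqP => [->|] //; case: eqP => [->|] //; rewrite !ltnn andbF.
Qed.

Lemma cf_bounded_le a n m : (n <= m)%N -> cf_bounded a n -> cf_bounded a m.
Proof.
move=> le_nm H j i /orP[] /(leq_trans le_nm) le; apply: H; rewrite le ?orbT //.
Qed.

Section LinearExtension.
Context (V : lmodType R) (G : nat -> nat -> V).

Definition mono_sum n a := \sum_(j < n) \sum_(i < n) cf j i a *: G j i.

(** The linear map with values [G] on the basis. The truncation is some bound of the support, chosen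
    classically; [mono_extE] makes the choice irrelevant. *)
Definition mono_ext a := mono_sum (projT1 (cid (cf_bounded_ex a))) a.

Let mono_sum_le a n m : (n <= m)%N -> cf_bounded a n ->
  mono_sum n a = mono_sum m a.
Proof.
move=> le_nm Ha; rewrite /mono_sum.
rewrite (big_ord_widen _ (fun j => \sum_(i < n) cf j i a *: G j i) le_nm).
rewrite big_mkcond; apply: eq_bigr => j _; case: ltnP => [lt_jn|le_nj].
  rewrite (big_ord_widen _ (fun i => cf j i a *: G j i) le_nm) big_mkcond.
  by apply: eq_bigr => i _; case: ltnP => // le; rewrite Ha ?le ?orbT ?scale0r.
by rewrite big1 // => i _; rewrite Ha ?le_nj ?scale0r.
Qed.

Lemma mono_extE a n : cf_bounded a n -> mono_ext a = mono_sum n a.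
Proof.
rewrite /mono_ext; case: cid => m Hm Hn /=.
by rewrite (mono_sum_le (leq_maxl m n) Hm) (mono_sum_le (leq_maxr m n) Hn).
Qed.

Fact mono_ext_linear : linear mono_ext.
Proof.
move=> c a b; have [n Ha] := cf_bounded_ex a; have [m Hb] := cf_bounded_ex b.
pose M := maxn n m.
have {}Ha := cf_bounded_le (leq_maxl n m) Ha.
have {}Hb := cf_bounded_le (leq_maxr n m) Hb.
have Hab : cf_bounded (c *: a + b) (maxn n m).
  by move=> j i H; rewrite cfP Ha ?Hb ?mulr0 ?addr0.
rewrite (mono_extE Ha) (mono_extE Hb) (mono_extE Hab) /mono_sum.
rewrite scaler_sumr -big_split; apply: eq_bigr => j _ /=.
rewrite scaler_sumr -big_split; apply: eq_bigr => i _ /=.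
by rewrite cfP scalerDl scalerA.
Qed.
HB.instance Definition _ :=
  GRing.isLinear.Build R A V *:%R mono_ext mono_ext_linear.

Lemma mono_ext_mono j i : mono_ext (mono j i) = G j i.
Proof.
have Hb : cf_bounded (mono j i) (maxn j i).+1.
  move=> J I; rewrite !gtn_max cf_mono.
  by case: eqP => [->|] //; case: eqP => [->|] //; rewrite !ltnn andbF.
have lt_j : (j < (maxn j i).+1)%N by rewrite ltnS leq_maxl.
have lt_i : (i < (maxn j i).+1)%N by rewrite ltnS leq_maxr.
rewrite (mono_extE Hb) /mono_sum (bigD1 (Ordinal lt_j)) //=.
rewrite [X in _ + X]big1 => [|J neq]; last first.
  rewrite big1 // => I _; rewrite cf_mono.
  by rewrite (_ : (J == j :> nat) = false) ?scale0r //; apply/negbTE.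
rewrite addr0 (bigD1 (Ordinal lt_i)) //= cf_mono !eqxx scale1r.
rewrite big1 ?addr0 // => I neq; rewrite cf_mono.
by rewrite (_ : (I == i :> nat) = false) ?andbF ?scale0r //; apply/negbTE.
Qed.
End LinearExtension.

Lemma mono_expand a n : cf_bounded a n ->
  a = \sum_(j < n) \sum_(i < n) cf j i a *: mono j i.
Proof.
move=> /(mono_extE mono); rewrite -/(mono_sum mono n a) => <-.
elim/mono_ind: a => [|c a b Ha Hb|j i]; first by rewrite linear0.
  by rewrite linearP /= -Ha -Hb.
by rewrite mono_ext_mono.
Qed.

Lemma cf_inj a b : (forall j i, cf j i a = cf j i b) -> a = b.
Proof.
move=> eq_ab; have [n Ha] := cf_bounded_ex a.
have Hb : cf_bounded b n by move=> j i H; rewrite -eq_ab Ha.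
rewrite (mono_expand Ha) (mono_expand Hb).
by apply: eq_bigr => j _; apply: eq_bigr => i _; rewrite eq_ab.
Qed.

Lemma cf_y_mul j i a : cf j i (y * a) = if j is j'.+1 then cf j' i a else 0.
Proof.
elim/mono_ind: a => [|c a b Ha Hb|J I].
- by rewrite mulr0 cf0; case: j => // j; rewrite cf0.
- rewrite mulrDr -weyl_scaleAr cfP Ha Hb.
  by case: j {Ha Hb} => [|j]; rewrite ?cfP //= mulr0 addr0.
- by rewrite -monoS cf_mono; case: j => // j; rewrite cf_mono.
Qed.

Lemma cf_mul_x j i a : cf j i (a * x) = if i is i'.+1 then cf j i' a else 0.
Proof.
elim/mono_ind: a => [|c a b Ha Hb|J I].
- by rewrite mul0r cf0; case: i => // i; rewrite cf0.
- rewrite mulrDl -weyl_scaleAl cfP Ha Hb.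
  by case: i {Ha Hb} => [|i]; rewrite ?cfP //= mulr0 addr0.
- by rewrite -monoSr cf_mono; case: i => [|i]; rewrite ?andbF ?cf_mono.
Qed.

Lemma cf_x_mul j i a : cf j i (x * a) =
  q ^+ j * (if i is i'.+1 then cf j i' a else 0) + h * qn j.+1 * cf j.+1 i a.
Proof.
elim/mono_ind: a => [|c a b Ha Hb|J I].
- by rewrite mulr0 !cf0; case: i => [|i]; rewrite ?cf0; ring.
- rewrite mulrDr -weyl_scaleAr !cfP Ha Hb.
  by case: i {Ha Hb} => [|i]; rewrite ?cfP //=; ring.
- rewrite x_mono cfD !cfZ !cf_mono.
  have -> : (if i is i'.+1 then cf j i' (mono J I) else 0) =
      ((j == J) && (i == I.+1))%:R.
    by case: i => [|i]; rewrite ?andbF ?cf_mono.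
  congr (_ + _); first by case: eqP => [->|] //=; rewrite !mulr0.
  case: J => [|J] /=; first by rewrite qn0 !mulr0 mul0r.
  by rewrite eqSS; case: eqP => [->|] //=; rewrite !mulr0.
Qed.

Lemma cf_mul_y j i a : cf j i (a * y) =
  q ^+ i * (if j is j'.+1 then cf j' i a else 0) + h * qn i.+1 * cf j i.+1 a.
Proof.
elim/mono_ind: a => [|c a b Ha Hb|J I].
- by rewrite mul0r !cf0; case: j => [|j]; rewrite ?cf0; ring.
- rewrite mulrDl -weyl_scaleAl !cfP Ha Hb.
  by case: j {Ha Hb} => [|j]; rewrite ?cfP //=; ring.
- rewrite mono_y cfD !cfZ !cf_mono.
  have -> : (if j is j'.+1 then cf j' i (mono J I) else 0) =
      ((j == J.+1) && (i == I))%:R.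
    by case: j => [|j]; rewrite ?cf_mono.
  rewrite ![(j == _) && _]andbC.
  congr (_ + _); first by case: (i =P I) => [->|] //=; rewrite !mulr0.
  case: I => [|I] /=; first by rewrite qn0 !mulr0 mul0r.
  by rewrite eqSS; case: (i =P I) => [->|] //=; rewrite !mulr0.
Qed.
End PBW.

(** Linear identities in the noncommutative algebra are compared coordinate by coordinate; products
    become atoms and [ring] works in the commutative ring of scalars. *)
Ltac weyl_abel := apply: cf_inj => ? ?; rewrite ?cfE;
  first [solve [repeat match goal with |- context[cf ?j ?i ?a] =>
    generalize (cf j i a) end; intros; ring] | ring].

(** * Derivations and 2-cocycles through the Koszul complex; the derivative in q *)

Section LowDegree.
Context (R : comNzRingType) (q h : R).
Local Notation A := (weyl q h).
Local Notation x := (weyl_x q h).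
Local Notation y := (weyl_y q h).
Implicit Types (f : A -> A -> A) (g : A -> A).

Definition hoch1 g (a b : A) : A := a * g b - g (a * b) + g a * b.

Definition cocycle2 f :=
  [/\ forall a, linear (f a), forall b, linear (f^~ b)
    & forall a b c, a * f b c + f a (b * c) = f (a * b) c + f a b * c].

Definition koszul1 (a b : A) : A :=
  a * y - q *: (y * a) + (x * b - q *: (b * x)).
(** For f = [hoch1 g] the terms g(xy) and q g(yx) cancel up to h g(1), and [hoch1 g 1 1] is g(1):
    this is the origin of the last summand. *)
Definition koszul2 f : A := f x y - q *: f y x + h *: f 1 1.

Lemma koszul1P c a b a' b' :
  koszul1 (c *: a + a') (c *: b + b') = c *: koszul1 a b + koszul1 a' b'.
Proof.
rewrite /koszul1 !mulrDl !mulrDr -!weyl_scaleAl -!weyl_scaleAr.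
weyl_abel.
Qed.

Lemma linD g : linear g -> {morph g : a b / a + b}.
Proof. by move=> H a b; rewrite -[a in LHS]scale1r H scale1r. Qed.
Lemma lin0 g : linear g -> g 0 = 0.
Proof. by move=> H; apply: (addrI (g 0)); rewrite -linD // !addr0. Qed.
Lemma linZ g c a : linear g -> g (c *: a) = c *: g a.
Proof. by move=> H; rewrite -[X in g X]addr0 H lin0 // addr0. Qed.

Lemma hoch1_cocycle g : linear g -> cocycle2 (hoch1 g).
Proof.
move=> gl; split=> [a c b b'|b c a a'|a b c]; rewrite /hoch1.
- rewrite !(mulrDr, gl) -!weyl_scaleAr gl; weyl_abel.
- rewrite !(mulrDl, gl) -!weyl_scaleAl gl; weyl_abel.
- rewrite !(mulrDl, mulrDr, mulrBl, mulrBr, mulNr, mulrN, mulrA); weyl_abel.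
Qed.

Lemma cocycle2_lin c f f' : cocycle2 f -> cocycle2 f' ->
  cocycle2 (fun a b => c *: f a b + f' a b).
Proof.
move=> [f1 f2 fA] [f1' f2' fA']; split=> [a d b b'|b d a a'|a b e] /=.
- by rewrite f1 f1'; weyl_abel.
- by rewrite f2 f2'; weyl_abel.
- have H := fA a b e; have H' := fA' a b e.
  rewrite !(mulrDl, mulrDr) -!weyl_scaleAr -!weyl_scaleAl addrACA -scalerDr H H'.
  weyl_abel.
Qed.

Lemma cocycle2_1l f b : cocycle2 f -> f 1 b = f 1 1 * b.
Proof.
by move=> [_ _ /(_ 1 1 b)]; rewrite !mul1r => /addrI.
Qed.
Lemma cocycle2_1r f a : cocycle2 f -> f a 1 = a * f 1 1.
Proof.
by move=> [_ _ /(_ a 1 1)]; rewrite !mulr1 => /addIr.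
Qed.

(** The cocycle identity gives f(xa, b) = x f(a, b) + f(x, ab) - f(x, a) b, and likewise for y, so
    first arguments 1, x and y determine a cocycle. *)
Lemma cocycle2_eq0 f : cocycle2 f -> f 1 1 = 0 ->
  (forall b, f x b = 0) -> (forall b, f y b = 0) -> forall a b, f a b = 0.
Proof.
move=> fc f11 fx fy a; have [_ f2 fA] := fc.
elim/weyl_ind: a => [|c a a' Ha Ha'|a Ha|a Ha] b.
- by rewrite cocycle2_1l // f11 mul0r.
- by rewrite f2 Ha Ha' scaler0 addr0.
- by have := fA x a b; rewrite Ha !fx mulr0 mul0r !addr0.
- by have := fA y a b; rewrite Ha !fy mulr0 mul0r !addr0.
Qed.

Lemma koszul2_hoch1 g : linear g -> koszul2 (hoch1 g) = koszul1 (g x) (g y).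
Proof.
move=> gl; rewrite /koszul2 /hoch1 weyl_xy (gl q) (linZ _ _ gl) !mul1r !mulr1.
by rewrite /koszul1; weyl_abel.
Qed.

Lemma koszul2_lin c f f' : koszul2 (fun a b => c *: f a b + f' a b) =
  c *: koszul2 f + koszul2 f'.
Proof. by rewrite /koszul2; weyl_abel. Qed.

(* The splitting is defined on the basis by forcing the difference of the two
   cocycles to vanish on the pairs (x, x^i) and (y, y^j x^i). *)
Lemma cocycle2_split f a0 b0 : cocycle2 f -> koszul2 f = koszul1 a0 b0 ->
  exists g, [/\ linear g, g x = a0, g y = b0 & forall a b, f a b = hoch1 g a b].
Proof.
move=> fc fk; have [f1 f2 fA] := fc.
(* The recursion solves f(x, x^i) = x g(x^i) - g(x^(i+1)) + a0 x^i for g(x^(i+1)). The initial value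
   is f(1, 1), since [hoch1 g 1 1] is g(1). *)
pose GX := fix GX i : A :=
  if i is i'.+1 then x * GX i' + a0 * x ^+ i' - f x (x ^+ i') else f 1 1.
pose G := fix G j i : A := if j is j'.+1
  then y * G j' i + b0 * pbw_mono q h j' i - f y (pbw_mono q h j' i) else GX i.
pose g : A -> A := mono_ext G.
have gl : linear g by exact: mono_ext_linear.
have gm j i : g (pbw_mono q h j i) = G j i by rewrite /g mono_ext_mono.
have g1 : g 1 = f 1 1.
  by have := gm 0 0; rewrite mono0 expr0.
have gx : g x = a0.
  have := gm 0 1%N; rewrite mono0r expr1 /= !expr0 mulr1 => ->.
  by rewrite (cocycle2_1r x) // addrAC subrr add0r.
have gy : g y = b0.
  have := gm 1%N 0; rewrite mono0 expr1 /= mono0 !expr0 mulr1 => ->.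
  by rewrite (cocycle2_1r y) // addrAC subrr add0r.
exists g; split=> // a b; apply/eqP; rewrite -subr_eq0; apply/eqP.
have -> : f a b - hoch1 g a b = -1 *: hoch1 g a b + f a b.
  by rewrite scaleN1r addrC.
pose F a b := -1 *: hoch1 g a b + f a b; rewrite -/(F a b).
have Fc : cocycle2 F by apply: cocycle2_lin => //; apply: hoch1_cocycle.
have [F1 F2 FA] := Fc.
have F11 : F 1 1 = 0.
  by rewrite /F /hoch1 !mul1r !mulr1 subrr add0r g1 scaleN1r addNr.
have Fy c : F y c = 0.
  elim/mono_ind: c => [|d c c' H H'|j i]; first by rewrite (lin0 (F1 _)).
    by rewrite F1 H H' scaler0 addr0.
  by rewrite /F /hoch1 -monoS !gm gy /=; weyl_abel.
have FxX i : F x (x ^+ i) = 0.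
  rewrite /F /hoch1 -exprS -!mono0r !gm gx /= !mono0r; weyl_abel.
(* The hypothesis on [koszul2 f] enters here: once F(y, -) and F(1, 1) vanish, [koszul2 F] reduces
   to F(x, y). *)
have Fxy : F x y = 0.
  have : koszul2 F = 0.
    rewrite koszul2_lin koszul2_hoch1 // gx gy fk scaleN1r addNr //.
  by rewrite /koszul2 Fy F11 !scaler0 subr0 addr0.
(* The cocycle identities on (x, y, c) and (y, x, c), joined by the relation for xy, carry the
   vanishing of F(x, -) from powers of x to all monomials. *)
have FxY c : F x (y * c) = q *: (y * F x c).
  have := FA x y c; rewrite Fy Fxy mulr0 mul0r add0r addr0 => ->.
  have := FA y x c; rewrite !Fy mul0r !addr0 => ->.
  by rewrite weyl_xy F2 (linZ h 1 (F2 c)) cocycle2_1l // F11 mul0r scaler0 addr0.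
apply: cocycle2_eq0 => // c.
elim/mono_ind: c => [|d c c' H H'|j i]; first by rewrite (lin0 (F1 _)).
  by rewrite F1 H H' scaler0 addr0.
elim: j => [|j IH]; first by rewrite mono0r.
by rewrite monoS FxY IH mulr0 scaler0.
Qed.

(** A derivation is a linear map whose Hochschild differential is zero, so the splitting lemma
    applied to the zero cocycle yields one with prescribed values. *)
Lemma derivation_ex a0 b0 : koszul1 a0 b0 = 0 ->
  exists D : A -> A, [/\ derivation D, D x = a0 & D y = b0].
Proof.
move=> k0; have [||g [gl gx gy gD]] := @cocycle2_split (fun _ _ => 0) a0 b0.
- by split=> [a c b b'|b c a a'|a b c]; rewrite ?scaler0 ?mulr0 ?mul0r addr0.
- by rewrite k0 /koszul2 !scaler0 subr0 addr0.
exists g; split=> //; split=> // a b.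
have := gD a b; rewrite /hoch1 => /esym E.
by rewrite -[LHS]addr0 -E; weyl_abel.
Qed.

Lemma derivation1 (D : A -> A) : derivation D -> D 1 = 0.
Proof.
by move=> [_ /(_ 1 1)]; rewrite !mulr1 mul1r -[X in X = _]addr0 => /addrI.
Qed.

Lemma koszul1_derivation (D : A -> A) : derivation D -> koszul1 (D x) (D y) = 0.
Proof.
move=> DD; have [Dl DM] := DD.
have := congr1 D (weyl_xy q h); rewrite (Dl q) !DM (linZ _ _ Dl) derivation1 //.
rewrite scaler0 addr0 => E; rewrite /koszul1.
transitivity (D x * y + x * D y - q *: (D y * x + y * D x)); first by weyl_abel.
by rewrite E subrr.
Qed.

(* dqn j and zeta b are q d/dq of [j]_q and of the product x b, the basis y^j x^i
   being fixed. *)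
Fixpoint dqn j : R := if j is j'.+1 then q * (qn q j' + dqn j') else 0.

Definition zeta : A -> A := mono_ext (fun j i =>
  (j%:R * q ^+ j) *: pbw_mono q h j i.+1 + (h * dqn j) *: pbw_mono q h j.-1 i).

Fact zeta_linear : linear zeta. Proof. exact: mono_ext_linear. Qed.
HB.instance Definition _ := GRing.isLinear.Build R A A *:%R zeta zeta_linear.

Lemma zeta_mono j i : zeta (pbw_mono q h j i) =
  (j%:R * q ^+ j) *: pbw_mono q h j i.+1 + (h * dqn j) *: pbw_mono q h j.-1 i.
Proof. exact: mono_ext_mono. Qed.

(** Right multiplication by x only shifts the basis; not involving q, it commutes with q d/dq. *)
Lemma zeta_mulx a : zeta (a * x) = zeta a * x.
Proof.
elim/mono_ind: a => [|c a b Ha Hb|j i]; first by rewrite mul0r linear0 mul0r.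
  by rewrite mulrDl -weyl_scaleAl !zeta_linear Ha Hb mulrDl weyl_scaleAl.
by rewrite -monoSr !zeta_mono mulrDl -!weyl_scaleAl -!monoSr.
Qed.

(** Leibniz rule for q d/dq on x y a = q y x a + h a; left multiplication by y shifts the basis and
    does not involve q. *)
Lemma zeta_muly a : zeta (y * a) = q *: (y * zeta a) + q *: (y * (x * a)).
Proof.
elim/mono_ind: a => [|c a b Ha Hb|j i].
- by rewrite !(mulr0, linear0) addr0.
- rewrite !mulrDr -!weyl_scaleAr !zeta_linear Ha Hb.
  by rewrite !mulrDr -!weyl_scaleAr; weyl_abel.
rewrite -monoS !zeta_mono x_mono !mulrDr -!weyl_scaleAr -!monoS.
case: j => [|j] /=.
  rewrite /qn big_ord0; weyl_abel.
by rewrite -[j.+2%:R]natr1 -[j.+1%:R]natr1 !exprS; weyl_abel.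
Qed.

Lemma zeta_mulY j a :
  zeta (y ^+ j * a) = q ^+ j *: (y ^+ j * zeta a) + zeta (y ^+ j) * a.
Proof.
elim: j => [|j IH].
  rewrite !expr0 !mul1r scale1r -[1](mono0 q h 0) zeta_mono.
  by rewrite /= mulr0 mul0r !scale0r addr0 mul0r addr0.
rewrite exprS -mulrA !zeta_muly IH !mulrDr !mulrDl -!weyl_scaleAr -!weyl_scaleAl.
by rewrite !mulrA [q ^+ j.+1]exprS; weyl_abel.
Qed.

Lemma zeta_mulX j i : zeta (pbw_mono q h j i) = zeta (y ^+ j) * x ^+ i.
Proof.
elim: i => [|i IH]; first by rewrite mono0 expr0 mulr1.
by rewrite monoSr zeta_mulx IH exprSr mulrA.
Qed.

(** This is q d/dq of x^i b, by the Leibniz rule for the product of x with x^(i-1) b. *)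
Fixpoint zetaX i (b : A) : A :=
  if i is i'.+1 then x * zetaX i' b + zeta (x ^+ i' * b) else 0.

Fact zetaX_linear i : linear (zetaX i).
Proof.
elim: i => [|i IH] c a b /=; first by rewrite scaler0 addr0.
rewrite IH !mulrDr -!weyl_scaleAr zeta_linear; weyl_abel.
Qed.

(* q d/dq of the product a b, the basis y^j x^i being fixed. *)
Definition dq_prod (a b : A) : A :=
  mono_ext (fun j i => y ^+ j * zetaX i b) a.

Lemma dq_prod_mono j i b : dq_prod (pbw_mono q h j i) b = y ^+ j * zetaX i b.
Proof. exact: mono_ext_mono. Qed.

Lemma dq_prod_linl b : linear (dq_prod^~ b).
Proof. exact: mono_ext_linear. Qed.

Lemma dq_prod_linr a : linear (dq_prod a).
Proof.
move=> c b b'; elim/mono_ind: a => [|d a a' Ha Ha'|j i].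
- by rewrite !(lin0 (dq_prod_linl _)) scaler0 addr0.
- by rewrite !dq_prod_linl Ha Ha'; weyl_abel.
- by rewrite !dq_prod_mono zetaX_linear mulrDr -weyl_scaleAr.
Qed.

Lemma dq_prod_1 b : dq_prod 1 b = 0.
Proof. by rewrite -[1](mono0 q h 0) dq_prod_mono mulr0. Qed.
Lemma dq_prod_y b : dq_prod y b = 0.
Proof. by rewrite -[y]expr1 -[y ^+ 1](mono0 q h 1%N) dq_prod_mono mulr0. Qed.
Lemma dq_prod_x b : dq_prod x b = zeta b.
Proof.
by rewrite -[x]expr1 -mono0r dq_prod_mono /= mulr0 add0r !expr0 !mul1r.
Qed.

Lemma dq_prod_muly a b : dq_prod (y * a) b = y * dq_prod a b.
Proof.
elim/mono_ind: a => [|c a a' H H'|j i].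
- by rewrite mulr0 !(lin0 (dq_prod_linl _)) mulr0.
- by rewrite mulrDr -weyl_scaleAr !dq_prod_linl H H' mulrDr weyl_scaleAr.
- by rewrite -monoS !dq_prod_mono exprS mulrA.
Qed.

(** Differentiating (xa) b = x (ab) in q gives this, which is the cocycle identity on (x, a, b).
    Induction on the first argument extends it to all triples. *)
Lemma dq_prod_mulx a b :
  dq_prod (x * a) b = x * dq_prod a b + zeta (a * b) - zeta a * b.
Proof.
elim/mono_ind: a => [|c a a' H H'|j i].
- by rewrite mulr0 !(lin0 (dq_prod_linl _)) !(mulr0, mul0r, linear0); weyl_abel.
- rewrite !mulrDr -weyl_scaleAr !dq_prod_linl H H' !mulrDr !mulrDl -!weyl_scaleAr.
  by rewrite -!weyl_scaleAl !zeta_linear !mulrDl -!weyl_scaleAl; weyl_abel.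
rewrite x_mono dq_prod_linl (linZ _ _ (dq_prod_linl b)) !dq_prod_mono /=.
rewrite zeta_mulX /pbw_mono -mulrA zeta_mulY mulrA -[x * y ^+ j]/(x * (y ^+ j)).
rewrite -[y ^+ j in X in _ = X + _ - _](mono0 q h) x_mono mulrDl -!weyl_scaleAl.
rewrite !mono0 monoSr mono0 mulrDr -!mulrA; weyl_abel.
Qed.

Lemma dq_prod_cocycle : cocycle2 dq_prod.
Proof.
split; [exact: dq_prod_linr | exact: dq_prod_linl | move=> a b c].
elim/weyl_ind: a b c => [|d a a' H H'|a H|a H] b c.
- by rewrite !dq_prod_1 !mul1r mul0r !addr0.
- rewrite !mulrDl -!weyl_scaleAl !dq_prod_linl !mulrDl -!weyl_scaleAl.
  by rewrite addrACA -scalerDr H H'; weyl_abel.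
- rewrite -[x * a * b]mulrA !dq_prod_mulx -mulrA -addrA.
  have -> : dq_prod a (b * c) = dq_prod (a * b) c + dq_prod a b * c - a * dq_prod b c.
    by rewrite -H; weyl_abel.
  rewrite !(mulrDr, mulrDl, mulrN, mulNr, mulrA); weyl_abel.
- rewrite -[y * a * b]mulrA !dq_prod_muly -!mulrA -!mulrDr H mulrDr //.
Qed.

(** The product xy = q yx + h has derivative q yx, whereas yx and 1 are already basis elements. *)
Lemma koszul2_dq_prod : koszul2 dq_prod = q *: (y * x).
Proof.
rewrite /koszul2 dq_prod_x dq_prod_y dq_prod_1 !scaler0 subr0 addr0.
have := zeta_mono 1 0; rewrite mono0 expr1 => ->.
by rewrite /= /qn big_ord0 addr0 mulr0 mulr0 scale0r addr0 mul1r monoSr mono0 expr1.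
Qed.

(** At h = 0 this is the composite of D1 = x d/dx and D2 = y d/dy, and its Hochschild differential
    is minus the sum of the cup products of D1, D2 in both orders. Adding half of that differential
    turns the cup product [dq_prod] into the wedge without changing the class. *)
Definition euler_square : A -> A := mono_ext (fun j i => (i * j)%:R *: pbw_mono q h j i).

Fact euler_square_linear : linear euler_square.
Proof. exact: mono_ext_linear. Qed.

Lemma euler_square_mono j i :
  euler_square (pbw_mono q h j i) = (i * j)%:R *: pbw_mono q h j i.
Proof. exact: mono_ext_mono. Qed.

Definition sym_dq_prod (e : R) (a b : A) : A :=
  e *: hoch1 euler_square a b + dq_prod a b.

Lemma sym_dq_prod_cocycle e : cocycle2 (sym_dq_prod e).
Proof.
apply: cocycle2_lin; last exact: dq_prod_cocycle.
exact/hoch1_cocycle/euler_square_linear.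
Qed.

Lemma koszul2_sym_dq_prod e : koszul2 (sym_dq_prod e) = q *: (y * x).
Proof.
rewrite koszul2_lin koszul2_dq_prod koszul2_hoch1; last exact: euler_square_linear.
have -> : euler_square x = 0.
  by rewrite -[x]expr1 -mono0r euler_square_mono scale0r.
have -> : euler_square y = 0.
  by rewrite -[y]expr1 -[y ^+ 1](mono0 q h) euler_square_mono scale0r.
by rewrite /koszul1 !(mulr0, mul0r, subr0, scaler0, addr0, oppr0, add0r).
Qed.
End LowDegree.

(** * Elements with given coordinates and the filtration by total degree *)

Lemma big_pair_pick (V : nmodType) n (F : nat -> nat -> V) J I :
  (J < n)%N -> (I < n)%N ->
  (forall j i, (j != J) || (i != I) -> F j i = 0) ->
  \sum_(j < n) \sum_(i < n) F j i = F J I.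
Proof.
move=> ltJ ltI F0; rewrite (bigD1 (Ordinal ltJ)) //= [X in _ + X]big1 => [|j nj].
  rewrite addr0 (bigD1 (Ordinal ltI)) //= big1 ?addr0 // => i ni.
  by rewrite F0 // orbC -[_ == I]/(i == Ordinal ltI) ni.
by rewrite big1 // => i _; rewrite F0 // -[_ == J]/(j == Ordinal ltJ) nj.
Qed.

Section Coordinates.
Context (R : comNzRingType) (q h : R).
Local Notation A := (weyl q h).
Local Notation x := (weyl_x q h).
Local Notation y := (weyl_y q h).
Local Notation mono := (pbw_mono q h).

Lemma cf_ex n (G : nat -> nat -> R) :
  (forall j i, (n <= j)%N || (n <= i)%N -> G j i = 0) ->
  exists c : A, forall j i, cf j i c = G j i.
Proof.
move=> G0; exists (\sum_(j < n) \sum_(i < n) G j i *: mono j i) => J I.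
rewrite raddf_sum.
under eq_bigr => j _ do rewrite raddf_sum.
under eq_bigr => j _ do under eq_bigr => i _ do rewrite /= cfZ cf_mono.
have [le_n|] := boolP ((n <= J)%N || (n <= I)%N); last first.
  rewrite negb_or -!ltnNge => /andP[ltJ ltI].
  rewrite (big_pair_pick (F := fun j i => G j i * ((J == j) && (I == i))%:R) ltJ ltI).
    by rewrite !eqxx mulr1.
  move=> j i; rewrite -negb_and [j == J]eq_sym [i == I]eq_sym => /negbTE->.
  by rewrite mulr0.
rewrite (G0 _ _ le_n) big1 // => j _; rewrite big1 // => i _.
have [eJ|] := eqVneq J j; last by rewrite mulr0.
have [eI|] := eqVneq I i; last by rewrite mulr0.
by move: le_n; rewrite eJ eI leqNgt ltn_ord leqNgt ltn_ord.
Qed.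

Definition deg_lt n (a : A) := forall j i, (n <= j + i)%N -> cf j i a = 0.

Lemma deg_lt_ex a : exists n, deg_lt n a.
Proof.
have [n H] := cf_bounded_ex a; exists (n + n)%N => j i le; apply: H; lia.
Qed.
Lemma deg_lt0 n : deg_lt n 0.
Proof. by move=> j i _; rewrite cf0. Qed.
Lemma deg_lt_lin n c a b : deg_lt n a -> deg_lt n b -> deg_lt n (c *: a + b).
Proof. by move=> Ha Hb j i le; rewrite cfP Ha ?Hb ?mulr0 ?addr0. Qed.
Lemma deg_ltD n a b : deg_lt n a -> deg_lt n b -> deg_lt n (a + b).
Proof. by move=> Ha Hb; rewrite -[a]scale1r; apply: deg_lt_lin. Qed.
Lemma deg_ltZ n c a : deg_lt n a -> deg_lt n (c *: a).
Proof. by move=> Ha; rewrite -[_ *: _]addr0; apply/deg_lt_lin/deg_lt0. Qed.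
Lemma deg_ltN n a : deg_lt n a -> deg_lt n (- a).
Proof. by rewrite -scaleN1r; apply: deg_ltZ. Qed.
Lemma deg_ltW n m a : (n <= m)%N -> deg_lt n a -> deg_lt m a.
Proof. by move=> le H j i le'; apply: H; apply: leq_trans le'. Qed.
Lemma deg_lt_mono j i : deg_lt (j + i).+1 (mono j i).
Proof.
move=> J I; rewrite cf_mono; case: eqP => // ->; case: eqP => // ->.
by rewrite ltnn.
Qed.
Lemma deg_lt_sum (I : Type) (r : seq I) (P : pred I) (F : I -> A) n :
  (forall i, P i -> deg_lt n (F i)) -> deg_lt n (\sum_(i <- r | P i) F i).
Proof.
move=> HF; elim/big_rec: _ => [|i a Pi Ha]; first exact: deg_lt0.
exact/deg_ltD/Ha/HF.
Qed.

Lemma deg_lt_y_mul n a : deg_lt n a -> deg_lt n.+1 (y * a).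
Proof. by move=> H [|j] i le; rewrite cf_y_mul //; apply: H. Qed.
Lemma deg_lt_mul_x n a : deg_lt n a -> deg_lt n.+1 (a * x).
Proof.
by move=> H j [|i] le; rewrite cf_mul_x //; apply: H; rewrite addnS in le.
Qed.
Lemma deg_lt_x_mul n a : deg_lt n a -> deg_lt n.+1 (x * a).
Proof.
move=> H j i le; rewrite cf_x_mul [cf j.+1 i a]H ?mulr0 ?addr0; last by lia.
by case: i le => [|i] le; rewrite ?mulr0 // H ?mulr0 //; lia.
Qed.
Lemma deg_lt_mul_y n a : deg_lt n a -> deg_lt n.+1 (a * y).
Proof.
move=> H j i le; rewrite cf_mul_y [cf j i.+1 a]H ?mulr0 ?addr0; last by lia.
by case: j le => [|j] le; rewrite ?mulr0 // H ?mulr0 //; lia.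
Qed.
Lemma deg_lt_mono_mul n j i a : deg_lt n a -> deg_lt (n + (j + i)) (mono j i * a).
Proof.
move=> H; rewrite -mulrA addnC -addnA; elim: j => [|j IH]; last first.
  by rewrite exprS -mulrA; apply: deg_lt_y_mul.
rewrite expr0 mul1r; elim: i => [|i IH]; first by rewrite expr0 mul1r.
by rewrite exprS -mulrA; apply: deg_lt_x_mul.
Qed.

End Coordinates.

(** * Central elements x^N, y^N and the evaluation of k[u, v] in the algebra *)

Section Central.
Context (R : comNzRingType) (q h : R).
Local Notation A := (weyl q h).
Local Notation x := (weyl_x q h).
Local Notation y := (weyl_y q h).

Lemma central_xy (c : A) : c * x = x * c -> c * y = y * c -> central c.
Proof.
move=> cx cy; elim/weyl_ind => [|d a b Ha Hb|a Ha|a Ha].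
- by rewrite mulr1 mul1r.
- by rewrite mulrDr mulrDl -weyl_scaleAr Ha Hb weyl_scaleAl.
- by rewrite mulrA cx -mulrA Ha mulrA.
- by rewrite mulrA cy -mulrA Ha mulrA.
Qed.

Context (N : nat) (qN : q ^+ N = 1) (qnN : qn q N = 0).

(** Here x^N y = q^N y x^N + h [N]_q x^(N-1). Both assumptions are used: for a general R, q^N = 1
    gives only (q - 1) [N]_q = 0. *)
Lemma central_xN : central (x ^+ N).
Proof.
apply: central_xy; first by rewrite -exprSr exprS.
rewrite -(mono0r q h) mono_y qN qnN mulr0 scale0r addr0 scale1r.
by rewrite monoS mono0r.
Qed.
Lemma central_yN : central (y ^+ N).
Proof.
apply: central_xy; last by rewrite -exprSr exprS.
rewrite -(mono0 q h) x_mono qN qnN mulr0 scale0r addr0 scale1r.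
by rewrite monoSr mono0.
Qed.
End Central.

Definition mk2 (a b : nat) : 'X_{1..2} :=
  [multinom (if i == ord0 then a else b) | i < 2].

Lemma mk2_0 a b : mk2 a b ord0 = a. Proof. by rewrite mnmE. Qed.
Lemma mk2_1 a b : mk2 a b ord_max = b. Proof. by rewrite mnmE. Qed.
Lemma ord2P (i : 'I_2) : (i = ord0) \/ (i = ord_max).
Proof. by case: i => -[|[|//]] H; [left | right]; apply: val_inj. Qed.
Lemma mnm2P (m m' : 'X_{1..2}) :
  m ord0 = m' ord0 -> m ord_max = m' ord_max -> m = m'.
Proof. by move=> e0 e1; apply/mnmP => i; case: (ord2P i) => ->. Qed.
Lemma mk2K (m : 'X_{1..2}) : mk2 (m ord0) (m ord_max) = m.
Proof. by apply: mnm2P; rewrite ?mk2_0 ?mk2_1. Qed.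
Lemma mdeg2 (m : 'X_{1..2}) : mdeg m = (m ord0 + m ord_max)%N.
Proof.
rewrite mdegE big_ord_recl big_ord1.
by have -> : lift ord0 ord0 = ord_max :> 'I_2 by exact: val_inj.
Qed.

Section CenterEval.
Context (k : fieldType) (N : nat) (q h : k).
Hypotheses (qN : q ^+ N = 1) (qnN : qn q N = 0).
Local Notation A := (weyl q h).
Local Notation x := (weyl_x q h).
Local Notation y := (weyl_y q h).
Local Notation mono := (pbw_mono q h).
Local Notation cev := (center_eval N q h).
Implicit Types P Q : center_poly k.

Local Notation gen := (fun i : 'I_2 => if i == ord0 then x ^+ N else y ^+ N).

Lemma mmap1_gen (m : 'X_{1..2}) :
  mmap1 gen m = mono (N * m ord_max) (N * m ord0).
Proof.
rewrite /mmap1 big_ord_recl big_ord1 /=.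
have -> : lift ord0 ord0 = ord_max :> 'I_2 by exact: val_inj.
rewrite /= -!exprM /pbw_mono; set n0 := (N * _)%N.
have -> : y ^+ (N * m ord_max) = (y ^+ N) ^+ m ord_max by rewrite exprM.
elim: (m ord_max) => [|n IH]; first by rewrite expr0 mulr1 mul1r.
by rewrite exprS -mulrA -IH mulrA -central_yN // mulrA.
Qed.

Lemma center_evalE P :
  cev P = \sum_(m <- msupp P) P@_m *: mono (N * m ord_max) (N * m ord0).
Proof.
by rewrite /center_eval /mmap; apply: eq_bigr => m _; rewrite mmap1_gen mulr_algl.
Qed.

Fact center_eval_zmod : zmod_morphism cev.
Proof. exact: mmap_is_additive. Qed.
HB.instance Definition _ := GRing.isZmodMorphism.Build _ _ cev center_eval_zmod.

Lemma center_eval0 : cev 0 = 0. Proof. exact: raddf0. Qed.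
Lemma center_evalD P Q : cev (P + Q) = cev P + cev Q. Proof. exact: raddfD. Qed.
Lemma center_evalB P Q : cev (P - Q) = cev P - cev Q. Proof. exact: raddfB. Qed.
Lemma center_evalZ c P : cev (c *: P) = c *: cev P.
Proof. by rewrite /center_eval mmapZ mulr_algl. Qed.
Lemma center_evalX m : cev 'X_[m] = mono (N * m ord_max) (N * m ord0).
Proof. by rewrite /center_eval mmapX mmap1_gen. Qed.
Lemma center_evalC c : cev c%:MP = c%:A.
Proof. by rewrite /center_eval mmapC. Qed.
Lemma center_eval1 : cev 1 = 1.
Proof. by rewrite (center_evalC 1) scale1r. Qed.

Lemma center_eval_central P : central (cev P).
Proof.
move=> a; rewrite center_evalE mulr_suml mulr_sumr; apply: eq_bigr => m _.
rewrite -weyl_scaleAl -weyl_scaleAr; congr (_ *: _).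
have comm n b : (forall c : A, b * c = c * b) -> forall c : A, b ^+ n * c = c * b ^+ n.
  move=> cb c; elim: n => [|n IH]; first by rewrite mulr1 mul1r.
  by rewrite exprS -mulrA IH mulrA cb mulrA.
rewrite /pbw_mono !exprM -mulrA (comm _ (x ^+ N)); last exact: central_xN.
by rewrite mulrA (comm _ (y ^+ N)) ?mulrA //; apply: central_yN.
Qed.

Lemma center_evalM P Q : cev (P * Q) = cev P * cev Q.
Proof.
have [|p m m'|] := @commr_mmap_is_multiplicative 2 k A gen (in_alg A).
- by move=> i a; rewrite /GRing.comm; case: (i == ord0);
    [rewrite central_xN | rewrite central_yN].
- by rewrite /GRing.comm mulr_algl mulr_algr.
- by move=> fM _; apply: fM.
Qed.

Lemma center_eval_mono P s r : cev P * mono s r =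
  \sum_(m <- msupp P) P@_m *: mono (s + N * m ord_max) (r + N * m ord0).
Proof.
rewrite center_eval_central center_evalE mulr_sumr; apply: eq_bigr => m _.
rewrite -weyl_scaleAr -(center_evalX m) -center_eval_central center_evalX.
rewrite /pbw_mono mulrA -[_ * x ^+ _ * y ^+ _]mulrA.
have -> : x ^+ (N * m ord0) * y ^+ s = y ^+ s * x ^+ (N * m ord0).
  have := center_eval_central 'X_[mk2 (m ord0) 0] (y ^+ s).
  by rewrite center_evalX mk2_0 mk2_1 muln0 mono0r.
by rewrite mulrA -exprD -mulrA -exprD addnC [(_ + r)%N]addnC.
Qed.

Lemma cf_center P s r J I : (0 < N)%N -> cf J I (cev P * mono s r) =
  if [&& (s <= J)%N, (N %| J - s)%N, (r <= I)%N & (N %| I - r)%N]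
  then P@_(mk2 ((I - r) %/ N) ((J - s) %/ N)) else 0.
Proof.
move=> N0; rewrite center_eval_mono raddf_sum /=.
under eq_bigr => m _ do rewrite cfZ cf_mono.
case: ifP => [/and4P[leJ /dvdnP[b eJ] leI /dvdnP[a eI]]|nJI].
  have -> : J = (s + N * b)%N by lia.
  have -> : I = (r + N * a)%N by lia.
  rewrite !addKn !mulKn //.
  under eq_bigr => m _ do rewrite !eqn_add2l !eqn_pmul2l //.
  have Em (m : 'X_{1..2}) : (b == m ord_max) && (a == m ord0) = (m == mk2 a b).
    apply/andP/eqP => [[/eqP-> /eqP->]|->]; first by rewrite mk2K.
    by rewrite mk2_0 mk2_1.
  under eq_bigr => m _ do rewrite Em mulr_natr mulrb.
  rewrite -big_mkcond /=.
  have [Hin|Hout] := boolP (mk2 a b \in msupp P).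
    by rewrite (big_rem _ Hin) eqxx /= big1_seq ?addr0 // => m; rewrite rem_filter //
      mem_filter => /andP[/eqP-> /andP[/negP[]/=]].
  rewrite (memN_msupp_eq0 Hout) big1_seq // => m /andP[/eqP-> mP].
  by rewrite mP in Hout.
rewrite big1 // => m _; case: andP => [[/eqP eJ /eqP eI]|]; last by rewrite mulr0.
by move: nJI; rewrite eJ eI !addKn !leq_addr !dvdn_mulr.
Qed.

Lemma deg_lt_center n n' P a : deg_lt n a ->
  (forall m, m \in msupp P -> N * mdeg m + n <= n')%N -> deg_lt n' (cev P * a).
Proof.
move=> Ha HP; rewrite center_evalE mulr_suml big_seq; apply: deg_lt_sum => m /HP le.
rewrite -weyl_scaleAl; apply: deg_ltZ.
apply: deg_ltW (deg_lt_mono_mul Ha); rewrite -mulnDr [(_ + m ord0)%N]addnC -mdeg2.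
by rewrite addnC.
Qed.

End CenterEval.

(** * Primitive roots of unity: the center of W_q and the cokernel of [koszul1] *)

Section RootOfUnity.
Context (k : fieldType) (N : nat) (q : k).
Hypotheses (N_ge2 : (2 <= N)%N) (q_prim : N.-primitive_root q).

Lemma prim_expr : q ^+ N = 1. Proof. exact: prim_expr_order. Qed.
Lemma prim_eq1 n : (q ^+ n == 1) = (N %| n)%N.
Proof. by rewrite (prim_order_dvd q_prim). Qed.
Lemma prim_neq0 : q != 0.
Proof.
apply/eqP => q0; have /eqP := prim_expr; rewrite q0 expr0n.
by case: N N_ge2 => // n _; rewrite eq_sym oner_eq0.
Qed.
Lemma prim_sub1 : q - 1 != 0.
Proof.
rewrite subr_eq0 -[q]expr1 prim_eq1 gtnNdvd //; exact: ltnW.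
Qed.
Lemma qn_eq0 n : (qn q n == 0) = (N %| n)%N.
Proof.
rewrite -prim_eq1 -[RHS]subr_eq0 -qnE mulf_eq0.
by rewrite (negbTE prim_sub1).
Qed.
Lemma qn_N : qn q N = 0.
Proof. by apply/eqP; rewrite qn_eq0. Qed.
End RootOfUnity.

Section WeylAtRoot.
Context (k : fieldType) (N : nat) (q : k).
Hypotheses (N_ge2 : (2 <= N)%N) (q_prim : N.-primitive_root q).
Local Notation A := (weyl q 1).
Local Notation x := (weyl_x q 1).
Local Notation y := (weyl_y q 1).
Local Notation mono := (pbw_mono q 1).
Local Notation cev := (center_eval N q 1).
Let qN := prim_expr q_prim.
Let qnN := qn_N N_ge2 q_prim.
Let N0 : (0 < N)%N := ltnW N_ge2.
Let q0 := prim_neq0 N_ge2 q_prim.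

Lemma center_eval_inj : injective cev.
Proof.
move=> P P' eq_PP; apply/mpolyP => m.
have E Q : cf (N * m ord_max) (N * m ord0) (cev Q) = Q@_m.
  have -> : cev Q = cev Q * mono 0 0 by rewrite mono0 expr0 mulr1.
  rewrite cf_center //.
  by rewrite !subn0 !dvdn_mulr // !mulKn // mk2K.
by rewrite -!E eq_PP.
Qed.

(** Commuting with x ties the coordinates (j, i) and (j+1, i+1), with coefficients q^j - 1 and
    [j+1]_q; commuting with y does the same with i. These relations remove every coordinate whose
    two indices are not both multiples of N. *)
Lemma centralP (c : A) : central c <-> exists P, c = cev P.
Proof.
split=> [cc|[P ->]]; last exact: center_eval_central.
have rel_x j i : qn q j * (q - 1) * cf j i c + qn q j.+1 * cf j.+1 i.+1 c = 0.
  have := congr1 (cf j i.+1) (cc x); rewrite cf_mul_x cf_x_mul mul1r => E.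
  by rewrite [_ * (q - 1)]mulrC qnE mulrBl mul1r addrAC -E subrr.
have rel_y j i : qn q i * (q - 1) * cf j i c + qn q i.+1 * cf j.+1 i.+1 c = 0.
  have := congr1 (cf j.+1 i) (cc y); rewrite cf_y_mul cf_mul_y mul1r => E.
  by rewrite [_ * (q - 1)]mulrC qnE mulrBl mul1r addrAC E subrr.
have cf_Ndvd_l j i : ~~ (N %| j)%N -> cf j i c = 0.
  (* The induction is on a distance from j up to a multiple of N. The relation passes from j+1 down
     to j and starts where [j+1]_q = 0. *)
  have [n] : {n | (N %| j + n)%N} by exists (N * j - j)%N; rewrite subnKC ?dvdn_mulr // leq_pmull.
  elim: n j i => [|n IH] j i; first by rewrite addn0 => ->.
  rewrite addnS -addSn => /IH{}IH nj; apply/eqP.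
  have : qn q j * (q - 1) * cf j i c == 0.
    rewrite -[X in X == 0]addr0 -[X in _ + X == 0](mul0r 0).
    have := rel_x j i; have [dv|/IH->] := boolP (N %| j.+1)%N.
      by move: dv; rewrite -(qn_eq0 N_ge2 q_prim) => /eqP ->; rewrite !mul0r => ->.
    by rewrite mulr0 mul0r => ->.
  by rewrite !mulf_eq0 (qn_eq0 N_ge2 q_prim) (negbTE nj) (negbTE (prim_sub1 N_ge2 q_prim)).
have cf_Ndvd_r j i : ~~ (N %| i)%N -> cf j i c = 0.
  have [n] : {n | (N %| i + n)%N} by exists (N * i - i)%N; rewrite subnKC ?dvdn_mulr // leq_pmull.
  elim: n j i => [|n IH] j i; first by rewrite addn0 => ->.
  rewrite addnS -addSn => /IH{}IH ni; apply/eqP.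
  have : qn q i * (q - 1) * cf j i c == 0.
    have := rel_y j i; have [dv|/IH->] := boolP (N %| i.+1)%N.
      by move: dv; rewrite -(qn_eq0 N_ge2 q_prim) => /eqP ->; rewrite mul0r addr0 => ->.
    by rewrite mulr0 addr0 => ->.
  by rewrite !mulf_eq0 (qn_eq0 N_ge2 q_prim) (negbTE ni) (negbTE (prim_sub1 N_ge2 q_prim)).
have [n Hn] := deg_lt_ex c.
exists (\sum_(m : 'X_{1..2 < n}) cf (N * m ord_max) (N * m ord0) c *: 'X_[m]).
set P := \sum_(m : _) _; have -> : cev P = cev P * mono 0 0 by rewrite mono0 expr0 mulr1.
apply: cf_inj => j i; rewrite cf_center // {}/P.
rewrite !subn0; case: ifP => [/and4P[_ /divnK ej _ /divnK ei]|]; last first.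
  move=> nd; have [dj|/cf_Ndvd_l//] := boolP (N %| j)%N.
  by have [di|/cf_Ndvd_r//] := boolP (N %| i)%N; rewrite dj di in nd.
set m := mk2 _ _; have [lt_mn|le_nm] := ltnP (mdeg m) n.
  rewrite (mcoeff_mpoly (fun m => cf (N * m ord_max) (N * m ord0) c)) //.
  by rewrite mk2_0 mk2_1 ![(N * _)%N]mulnC ej ei.
rewrite raddf_sum /= big1 => [|m' _]; last first.
  rewrite mcoeffZ mcoeffX; case: eqP => [em|]; last by rewrite mulr0.
  by have := bmdeg m'; rewrite em ltnNge le_nm.
apply: Hn; move: le_nm; rewrite mdeg2 mk2_0 mk2_1 -{2}ej -{2}ei -mulnDl addnC.
by move=> le_nm; apply: leq_trans le_nm _; rewrite leq_pmulr.
Qed.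

Lemma koszul1_mono_l j i : koszul1 (mono j i) 0 =
  (q ^+ i - q) *: mono j.+1 i + qn q i *: mono j i.-1.
Proof.
by rewrite /koszul1 mono_y -monoS mul1r mulr0 mul0r scaler0; weyl_abel.
Qed.

Lemma koszul1_mono_r j i : koszul1 0 (mono j i) =
  (q ^+ j - q) *: mono j i.+1 + qn q j *: mono j.-1 i.
Proof.
by rewrite /koszul1 x_mono -monoSr mul1r mulr0 mul0r scaler0; weyl_abel.
Qed.

(** Since q^(i+1) - q = q (q - 1) [i]_q, substituting [i]_q mu^i into the relation between
    neighbours leaves q (q - 1) mu + 1 = 0. *)
Let mu : k := (q * (1 - q))^-1.

(* On the diagonals i = j (mod N) the relations koszul1_mono_l between neighbours
   have the solution [i]_q mu^i; on the other diagonals the image of koszul1 is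
   everything. *)
Definition coker_coef (m : 'X_{1..2}) j i : k :=
  if [&& (j %/ N == m ord_max)%N, (i %/ N == m ord0)%N & (j %% N == i %% N)%N]
  then qn q i * mu ^+ (i %% N) else 0.

Lemma qn_mod i : qn q (i %% N) = qn q i.
Proof.
apply: (mulfI (prim_sub1 N_ge2 q_prim)); rewrite !qnE.
by rewrite (prim_expr_mod q_prim).
Qed.

Lemma coker_coef0 m j i : (N %| i)%N -> coker_coef m j i = 0.
Proof.
by rewrite /coker_coef -(qn_eq0 N_ge2 q_prim) => /eqP ->; rewrite mul0r; case: ifP.
Qed.

Lemma coker_coefE m b a r : (r < N)%N -> coker_coef m (b * N + r) (a * N + r) =
  if (b == m ord_max) && (a == m ord0) then qn q r * mu ^+ r else 0.
Proof.
move=> lt_r; rewrite /coker_coef !divnMDl // !modnMDl !(divn_small lt_r).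
by rewrite !(modn_small lt_r) !addn0 eqxx andbT -(qn_mod (_ + _)) modnMDl modn_small.
Qed.

(** When N divides i or i+1 both products vanish, so blocks of length N do not interact and a
    solution may live on the single block named by [m]. Inside a block the identity is the choice of
    [mu]. *)
Lemma coker_coefS m j i :
  (q ^+ i.+1 - q) * coker_coef m j.+1 i.+1 + qn q i.+1 * coker_coef m j i = 0.
Proof.
have [dS|ndS] := boolP (N %| i.+1)%N.
  move: (dS); rewrite coker_coef0 // -(qn_eq0 N_ge2 q_prim) => /eqP ->.
  by rewrite mulr0 mul0r addr0.
have [d|nd] := boolP (N %| i)%N.
  move: (d); rewrite (coker_coef0 _ _ d) -(prim_eq1 q_prim) exprS => /eqP ->.
  by rewrite mulr1 subrr mul0r mulr0 addr0.
have [e|ne] := eqVneq (j %% N)%N (i %% N)%N; last first.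
  rewrite /coker_coef (negbTE ne) !andbF.
  have /negbTE -> : (j.+1 %% N != i.+1 %% N)%N by rewrite -(addn1 j) -(addn1 i) eqn_modDr.
  by rewrite !andbF !mulr0 addr0.
have lt_r : ((i %% N).+1 < N)%N.
  rewrite ltn_neqAle ltn_pmod // andbT; apply: contra ndS => /eqP eN.
  by rewrite (divn_eq i N) -addnS eN dvdn_addl // dvdn_mull.
have Ej := divn_eq j N; have Ei := divn_eq i N.
move: e lt_r Ej Ei; move: (j %% N)%N (i %% N)%N (j %/ N)%N (i %/ N)%N.
move=> _ r b a -> lt_r -> ->; rewrite -!addnS !coker_coefE //; last exact: ltnW.
case: ifP => _; last by rewrite !mulr0 addr0.
rewrite -[qn q (_ + _)]qn_mod modnMDl modn_small // exprD mulnC exprM qN expr1n mul1r.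
have : (q ^+ r - 1) = (q - 1) * qn q r by rewrite qnE.
have [u1 u2] : q != 0 /\ 1 - q != 0.
  by split=> //; rewrite -opprB oppr_eq0 (prim_sub1 N_ge2).
move=> E; rewrite !exprS.
have -> : q * q ^+ r - q = q * ((q - 1) * qn q r) by rewrite -E; ring.
rewrite /mu; field.
by rewrite u1 u2.
Qed.

(** One linear form for each monomial of k[u, v]. It kills the image of [koszul1] and takes P yx to
    [mu] times the coefficient of P at [m], which makes the complement direct and free. *)
Definition coker_form m : A -> k :=
  mono_ext (V := k^o) (fun j i => coker_coef m j i : k^o).

Fact coker_form_linear m : linear_for *%R (coker_form m).
Proof. by move=> c a b; apply: (@mono_ext_linear k q 1 k^o _). Qed.
HB.instance Definition _ m :=
  GRing.isLinear.Build k A k *%R (coker_form m) (coker_form_linear m).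

Lemma coker_form_mono m j i : coker_form m (mono j i) = coker_coef m j i.
Proof. exact: (@mono_ext_mono k q 1 k^o). Qed.

Lemma coker_formP m c a b :
  coker_form m (c *: a + b) = c * coker_form m a + coker_form m b.
Proof. exact: coker_form_linear. Qed.

Lemma koszul1_linl c a a' : koszul1 (c *: a + a') 0 = c *: koszul1 a 0 + koszul1 a' 0 :> A.
Proof. by rewrite -koszul1P scaler0 addr0. Qed.
Lemma koszul1_linr c b b' : koszul1 0 (c *: b + b') = c *: koszul1 0 b + koszul1 0 b' :> A.
Proof. by rewrite -koszul1P scaler0 addr0. Qed.
Lemma koszul1_00 : koszul1 0 0 = 0 :> A.
Proof. by rewrite /koszul1 !mul0r !mulr0 scaler0 subr0 addr0. Qed.
Lemma koszul1_lr a b : koszul1 a b = koszul1 a 0 + koszul1 0 b :> A.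
Proof. by rewrite -[koszul1 a 0]scale1r -koszul1P scaler0 scale1r addr0 add0r. Qed.

(** The second family of relations has q^j and [j]_q where the first has q^i and [i]_q. The form is
    supported where j = i modulo N, and there the two families coincide. *)
Lemma coker_form_koszul1 m a b : coker_form m (koszul1 a b) = 0.
Proof.
have K0 : coker_form m 0 = 0 by exact: linear0.
rewrite koszul1_lr -[koszul1 a 0]scale1r coker_formP mul1r.
have -> : coker_form m (koszul1 a 0) = 0.
  elim/mono_ind: a => [|c a a' H H'|j i]; first by rewrite koszul1_00.
    by rewrite koszul1_linl coker_formP H H' mulr0 addr0.
  rewrite koszul1_mono_l coker_formP -[_ *: mono j _]addr0 coker_formP K0 addr0.
  rewrite !coker_form_mono; case: i => [|i]; last exact: coker_coefS.
  by rewrite !coker_coef0 ?dvdn0 // !mulr0 addr0.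
rewrite add0r; elim/mono_ind: b => [|c b b' H H'|j i]; first by rewrite koszul1_00.
  by rewrite koszul1_linr coker_formP H H' mulr0 addr0.
rewrite koszul1_mono_r coker_formP -[_ *: mono _ i]addr0 coker_formP K0 addr0.
rewrite !coker_form_mono; case: j => [|j] /=.
  rewrite qn0 mul0r addr0; have [d|nd] := boolP (N %| i.+1)%N.
    by rewrite coker_coef0 // mulr0.
  rewrite /coker_coef mod0n [(0 == _)%N]eq_sym -/(dvdn _ _) (negbTE nd).
  by rewrite !andbF mulr0.
have [e|ne] := eqVneq (j %% N)%N (i %% N)%N; last first.
  rewrite /coker_coef (negbTE ne) !andbF.
  have /negbTE -> : (j.+1 %% N != i.+1 %% N)%N by rewrite -(addn1 j) -(addn1 i) eqn_modDr.
  by rewrite !andbF !mulr0 addr0.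
have eS : (j.+1 %% N = i.+1 %% N)%N.
  by apply/eqP; rewrite -(addn1 j) -(addn1 i) eqn_modDr e.
by rewrite -(prim_expr_mod q_prim) -(qn_mod j.+1) eS (prim_expr_mod q_prim) qn_mod coker_coefS.
Qed.

Lemma coker_form_center m P : coker_form m (cev P * (y * x)) = P@_m * mu.
Proof.
have -> : y * x = mono 1 1 by rewrite /pbw_mono !expr1.
rewrite center_eval_mono // raddf_sum /= [in RHS](mpolyE P).
rewrite raddf_sum mulr_suml; apply: eq_bigr => m' _ /=.
rewrite -[X in coker_form _ X]addr0 coker_formP coker_form_mono mcoeffZ mcoeffX.
have -> : coker_form m 0 = 0 by exact: linear0.
rewrite addr0 -mulrA ![(1 + _)%N]addnC ![(N * _)%N]mulnC coker_coefE //.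
have -> : (m' ord_max == m ord_max) && (m' ord0 == m ord0) = (m' == m).
  apply/andP/eqP => [[/eqP e1 /eqP e0]|->]; first exact: mnm2P.
  by rewrite !eqxx.
by case: eqP => _; rewrite ?qn1 ?expr1 ?mul1r ?mul0r ?mulr0.
Qed.

(** Off the diagonals j = i modulo N, two independent relations put each monomial in the image. On
    them, residue 0 lies in the image and residue r+1 reduces to r except at r = 0, so only residue
    1 survives: the central multiples of yx. *)
Lemma coker_decomp c : exists P a b, c = cev P * (y * x) + koszul1 a b.
Proof.
pose S (c : A) := exists P a b, c = cev P * (y * x) + koszul1 a b.
have Slin d u v : S u -> S v -> S (d *: u + v).
  move=> [P [a [b ->]]] [P' [a' [b' ->]]].
  exists (d *: P + P'), (d *: a + a'), (d *: b + b').
  by rewrite koszul1P center_evalD center_evalZ mulrDl -weyl_scaleAl scalerDr addrACA.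
have SK a b : S (koszul1 a b).
  by exists 0, a, b; rewrite center_eval0 mul0r add0r.
have S0 : S 0 by rewrite -koszul1_00; apply: SK.
have SZ d u : d != 0 -> S (d *: u) -> S u.
  move=> d0 Su; have -> : u = d^-1 *: (d *: u) + 0.
    by rewrite scalerA mulVf // scale1r addr0.
  exact: Slin.
have SB d u v : S v -> S (u + d *: v) -> S u.
  move=> Sv Suv; have -> : u = - d *: v + (u + d *: v) by rewrite addrCA scaleNr addNr addr0.
  exact: Slin.
have q1 : 1 - q != 0 by rewrite -opprB oppr_eq0 (prim_sub1 N_ge2).
have relA j i : S ((q ^+ i - q) *: mono j.+1 i + qn q i *: mono j i.-1).
  by rewrite -koszul1_mono_l; apply: SK.
have relB j i : S ((q ^+ j - q) *: mono j i.+1 + qn q j *: mono j.-1 i).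
  by rewrite -koszul1_mono_r; apply: SK.
have SJ0 j : S (mono j.+1 0).
  by apply: (SZ (1 - q)) => //; have := relA j 0; rewrite qn0 scale0r addr0 expr0.
have S0I i : S (mono 0 i.+1).
  by apply: (SZ (1 - q)) => //; have := relB 0 i; rewrite qn0 scale0r addr0 expr0.
have S00 : S (mono 0 0).
  by have := relA 0 1; rewrite expr1 subrr scale0r add0r qn1 scale1r.
have Sdiv j i : (N %| i)%N -> S (mono j i).
  case: j => [|j]; first by case: i => [|i].
  move=> d; apply: (SZ (1 - q)) => //; have := relA j i.
  have /eqP -> : qn q i == 0 by rewrite (qn_eq0 N_ge2 q_prim).
  have /eqP -> : q ^+ i == 1 by rewrite (prim_eq1 q_prim).
  by rewrite scale0r addr0.
suff Sm j i : S (mono j i) by elim/mono_ind: c.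
have [e|ne] := eqVneq (j %% N)%N (i %% N)%N; last first.
  case: j ne => [|j] ne; first by case: i ne.
  case: i ne => [|i] ne //.
  (* Eliminating [mono j i] from these two relations leaves q^(i+1) - q^(j+1) times
     [mono j.+1 i.+1], a nonzero coefficient off the diagonal. *)
  have e := relA j i.+1; have e' := relB j.+1 i.
  have neq : q ^+ i.+1 != q ^+ j.+1.
    by rewrite (eq_prim_root_expr q_prim) eq_sym.
  apply: (SZ (q ^+ i.+1 - q ^+ j.+1)); first by rewrite subr_eq0.
  have qnV n : qn q n = (q ^+ n - 1) / (q - 1).
    by rewrite -qnE mulrC mulKf // (prim_sub1 N_ge2).
  have {e e'} := Slin (- qn q i.+1) _ _ e' (Slin (qn q j.+1) _ _ e S0).
  congr S; rewrite !qnV; apply: cf_inj => J I; rewrite !cfE; field.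
  exact: prim_sub1 N_ge2 q_prim.
have lt_r : (i %% N < N)%N by rewrite ltn_pmod.
rewrite (divn_eq j N) (divn_eq i N) e; move: lt_r {e}.
move: (j %/ N)%N (i %/ N)%N (i %% N)%N => b a; elim=> [|r IH] lt_r.
  by apply: Sdiv; rewrite addn0 dvdn_mull.
(* At residue 1 the coefficient q^(aN+1) - q vanishes and no reduction is possible; the monomial is
   u^a v^b yx itself. *)
have [->|r0] := posnP r.
  exists 'X_[mk2 a b], 0, 0; rewrite koszul1_00 addr0.
  rewrite -[y * x]/(y ^+ 1 * x ^+ 1) -/(mono 1 1) center_eval_mono // msuppX.
  rewrite big_seq1 mcoeffX eqxx scale1r mk2_0 mk2_1.
  by rewrite ![(1 + _)%N]addnC ![(N * _)%N]mulnC.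
rewrite !addnS; apply: (SZ (q ^+ (a * N + r).+1 - q)).
  rewrite -addnS exprD mulnC exprM qN expr1n mul1r subr_eq0 -[X in _ != X]expr1.
  rewrite (eq_prim_root_expr q_prim) !modn_small // -lt0n.
  by case: r r0 {IH lt_r}.
apply: (SB (qn q (a * N + r).+1) _ (mono (b * N + r) (a * N + r))).
  exact/IH/ltnW.
exact: relA.
Qed.
End WeylAtRoot.

(** * The submodule describing H^1 and coefficients with respect to its generators *)

Section EulerCoordinates.
Context (k : fieldType).
Implicit Types (s P : center_poly k) (m : euler_module k) (M : 'X_{1..2}).

Lemma mcoeffXi_mul s i M :
  ('X_i * s)@_M = if (0 < M i)%N then s@_(M - U_(i))%MM else 0.
Proof.
rewrite mulrC; case: posnP => [Mi0|Mi]; last first.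
  have le : (U_(i) <= M)%MM by apply/mnm_lepP => j; rewrite mnm1E; case: eqP => // <-.
  by rewrite -{1}(submK le) addmC mcoeffMX.
apply/memN_msupp_eq0; rewrite (perm_mem (msuppMX _ _)).
by apply/mapP => -[M' _ eM]; move: Mi0; rewrite eM mnmDE mnm1E eqxx.
Qed.

Lemma mcoeff_sum_lt n (E : 'X_{1..2} -> k) M :
  (forall M', (n <= mdeg M')%N -> E M' = 0) ->
  (\sum_(M : 'X_{1..2 < n}) E M *: 'X_[M])@_M = E M.
Proof.
move=> E0; have [lt_M|le_M] := ltnP (mdeg M) n; first by rewrite (mcoeff_mpoly E).
rewrite raddf_sum /= big1 ?E0 // => M' _; rewrite mcoeffZ mcoeffX.
case: eqP => [eM|]; last by rewrite mulr0.
by have := bmdeg M'; rewrite eM ltnNge le_M.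
Qed.

Lemma mcoeff_ge s M : (msize s <= mdeg M)%N -> s@_M = 0.
Proof. by move=> le; apply/memN_msupp_eq0/msize_mdeg_ge. Qed.

(* The decomposition s = u s_u + v s_v + s(0, 0), where s_v depends on v only. *)
Definition quot_u s : center_poly k :=
  \sum_(M : 'X_{1..2 < msize s}) s@_(M + U_(ord0))%MM *: 'X_[M].
Definition quot_v s : center_poly k :=
  \sum_(M : 'X_{1..2 < msize s})
     (if (M : 'X_{1..2}) ord0 == 0%N then s@_(M + U_(ord_max))%MM else 0) *: 'X_[M].

Lemma mcoeff_quot_u s M : (quot_u s)@_M = s@_(M + U_(ord0))%MM.
Proof.
apply: (mcoeff_sum_lt (E := fun M => s@_(M + U_(ord0))%MM)) => M' le.
by rewrite mcoeff_ge // mdegD (leq_trans le) // leq_addr.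
Qed.

Lemma mcoeff_quot_v s M : (quot_v s)@_M =
  if M ord0 == 0%N then s@_(M + U_(ord_max))%MM else 0.
Proof.
apply: (mcoeff_sum_lt (E := fun M : 'X_{1..2} =>
  if M ord0 == 0%N then s@_(M + U_(ord_max))%MM else 0)) => M' le.
by rewrite mcoeff_ge ?if_same // mdegD (leq_trans le) // leq_addr.
Qed.

Fact quot_u_linear : linear quot_u.
Proof.
move=> c s s'; apply/mpolyP => M.
by rewrite mcoeffD mcoeffZ !mcoeff_quot_u mcoeffD mcoeffZ.
Qed.
Fact quot_v_linear : linear quot_v.
Proof.
move=> c s s'; apply/mpolyP => M.
rewrite mcoeffD mcoeffZ !mcoeff_quot_v mcoeffD mcoeffZ.
by case: ifP => // _; rewrite mulr0 addr0.
Qed.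

Lemma quot_uvE s : s = 'X_ord0 * quot_u s + 'X_ord_max * quot_v s + s@_0%MM *: 1.
Proof.
apply/mpolyP => M; rewrite !mcoeffD !mcoeffXi_mul mcoeffZ mcoeff1.
rewrite mcoeff_quot_u mcoeff_quot_v.
have sub1 i : (0 < M i)%N -> (M - U_(i) + U_(i))%MM = M.
  by move=> Mi; rewrite submK //; apply/mnm_lepP => j; rewrite mnm1E; case: eqP => // <-.
have [M0|M0] := posnP (M ord0); last first.
  rewrite sub1 // (negbTE (_ : M != 0%MM)) ?mulr0 ?addr0; last first.
    by apply/eqP => e; move: M0; rewrite e mnm0E.
  case: ifP => [M1|_]; last by rewrite addr0.
  by rewrite mnmBE mnm1E /= subn0 gtn_eqF // addr0.
rewrite add0r; have [M1|M1] := posnP (M ord_max).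
  have -> : M = 0%MM by apply: mnm2P; rewrite ?M0 ?M1 mnm0E.
  by rewrite eqxx mulr1 add0r.
rewrite mnmBE M0 sub0n eqxx sub1 // (negbTE (_ : M != 0%MM)) ?mulr0 ?addr0 //.
by apply/eqP => e; move: M1; rewrite e mnm0E.
Qed.

Definition coordX m : center_poly k := m ord0 ord0.
Definition coordY m : center_poly k := m ord0 ord_max.

Lemma euler_moduleP m m' : coordX m = coordX m' -> coordY m = coordY m' -> m = m'.
Proof.
move=> eX eY; apply/matrixP => i j; rewrite (ord1 i).
by case: (ord2P j) => ->.
Qed.

(** The generator [gen_E] contributes nothing to the sum of the coordinates, so the sum determines
    the other two coefficients up to the relation u v [gen_E] = v [gen_u] - u [gen_v]. Assigning uv
    to the u-part fixes a choice that is k-linear but not linear over k[u, v]. *)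
Definition coefU m := quot_u (coordX m + coordY m).
Definition coefV m := quot_v (coordX m + coordY m).
Definition coefH m := coordX m - 'X_ord0 * coefU m.

Lemma coordXD m m' : coordX (m + m') = coordX m + coordX m'.
Proof. by rewrite /coordX mxE. Qed.
Lemma coordYD m m' : coordY (m + m') = coordY m + coordY m'.
Proof. by rewrite /coordY mxE. Qed.
Lemma coordXZ P m : coordX (P *: m) = P * coordX m.
Proof. by rewrite /coordX mxE. Qed.
Lemma coordYZ P m : coordY (P *: m) = P * coordY m.
Proof. by rewrite /coordY mxE. Qed.
Lemma coordXP P m m' : coordX (P *: m + m') = P * coordX m + coordX m'.
Proof. by rewrite coordXD coordXZ. Qed.
Lemma coordYP P m m' : coordY (P *: m + m') = P * coordY m + coordY m'.
Proof. by rewrite coordYD coordYZ. Qed.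

Lemma coordX_x : coordX (euler_x k) = 1.
Proof. by rewrite /coordX /euler_x mxE !eqxx. Qed.
Lemma coordY_x : coordY (euler_x k) = 0.
Proof. by rewrite /coordY /euler_x mxE eqxx. Qed.
Lemma coordX_y : coordX (euler_y k) = 0.
Proof. by rewrite /coordX /euler_y mxE eqxx. Qed.
Lemma coordY_y : coordY (euler_y k) = 1.
Proof. by rewrite /coordY /euler_y mxE !eqxx. Qed.

Lemma coordX_E : coordX (gen_E k) = 1.
Proof.
by rewrite /gen_E -scaleN1r addrC coordXP coordX_x coordX_y mulr0 add0r.
Qed.
Lemma coordY_E : coordY (gen_E k) = -1.
Proof.
by rewrite /gen_E -scaleN1r addrC coordYP coordY_x coordY_y mulr1 addr0.
Qed.
Lemma coordX_u : coordX (gen_u k) = 'X_ord0.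
Proof. by rewrite /gen_u coordXZ coordX_x mulr1. Qed.
Lemma coordY_u : coordY (gen_u k) = 0.
Proof. by rewrite /gen_u coordYZ coordY_x mulr0. Qed.
Lemma coordX_v : coordX (gen_v k) = 0.
Proof. by rewrite /gen_v coordXZ coordX_y mulr0. Qed.
Lemma coordY_v : coordY (gen_v k) = 'X_ord_max.
Proof. by rewrite /gen_v coordYZ coordY_y mulr1. Qed.

Local Opaque gen_E gen_u gen_v.

Lemma coordX_gen P0 P1 P2 : coordX (P0 *: gen_E k + P1 *: gen_u k + P2 *: gen_v k) =
  P0 + 'X_ord0 * P1.
Proof.
have E m m' m'' : coordX (P0 *: m + P1 *: m' + P2 *: m'') =
    P0 * coordX m + P1 * coordX m' + P2 * coordX m''.
  by rewrite coordXD coordXP !coordXZ.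
by rewrite E {E} coordX_E coordX_u coordX_v mulr1 mulr0 addr0 [P1 * _]mulrC.
Qed.
Lemma coordY_gen P0 P1 P2 : coordY (P0 *: gen_E k + P1 *: gen_u k + P2 *: gen_v k) =
  - P0 + 'X_ord_max * P2.
Proof.
have E m m' m'' : coordY (P0 *: m + P1 *: m' + P2 *: m'') =
    P0 * coordY m + P1 * coordY m' + P2 * coordY m''.
  by rewrite coordYD coordYP !coordYZ.
by rewrite E {E} coordY_E coordY_u coordY_v mulrN1 mulr0 addr0 [P2 * _]mulrC.
Qed.

Lemma coordXE m : coordX m = coefH m + 'X_ord0 * coefU m.
Proof. by rewrite subrK. Qed.

(** The sum of the coordinates kills [gen_E] and takes the other generators to u and v, so the
    submodule is the preimage of the ideal (u, v). *)
Lemma H1_submoduleP m : H1_submodule m <-> (coordX m + coordY m)@_0%MM = 0.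
Proof.
split=> [[P0 [P1 [P2 ->]]]|s0].
  rewrite coordX_gen coordY_gen addrACA subrr add0r mcoeffD !mcoeffXi_mul.
  by rewrite !mnm0E addr0.
exists (coefH m), (coefU m), (coefV m).
apply: euler_moduleP; rewrite ?coordX_gen ?coordY_gen -?coordXE //.
have := quot_uvE (coordX m + coordY m); rewrite s0 scale0r addr0 -/(coefU m).
rewrite -/(coefV m) => e; apply: (addrI (coordX m)); rewrite e {1}coordXE.
by rewrite addrACA subrr add0r.
Qed.

Lemma coordYE m : H1_submodule m -> coordY m = - coefH m + 'X_ord_max * coefV m.
Proof.
move=> /H1_submoduleP s0.
have := quot_uvE (coordX m + coordY m); rewrite s0 scale0r addr0 -/(coefU m).
rewrite -/(coefV m) => e; apply: (addrI (coordX m)); rewrite e {1}coordXE.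
by rewrite addrACA subrr add0r.
Qed.

Lemma H1_submodule_lin P m m' : H1_submodule m -> H1_submodule m' ->
  H1_submodule (P *: m + m').
Proof.
move=> /H1_submoduleP s0 /H1_submoduleP s0'; apply/H1_submoduleP.
rewrite coordXP coordYP addrACA -mulrDr mcoeffD s0' addr0.
by rewrite rmorphM /= s0 mulr0.
Qed.

Lemma degree_ltP d m : degree_lt d m <->
  forall M, (d <= mdeg M)%N -> (coordX m)@_M = 0 /\ (coordY m)@_M = 0.
Proof.
split=> [H M le|H i].
  by split; apply: mcoeff_ge; apply: leq_trans (H _) le.
have H' M : (d <= mdeg M)%N -> (m ord0 i)@_M = 0.
  by move=> /H [HX HY]; case: (ord2P i) => ->.
rewrite msizeE; apply/bigmax_leqP_seq => M; rewrite mcoeff_msupp => nz _.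
by rewrite ltnNge; apply: contra nz => /H' ->.
Qed.

Lemma coef_lin (c : k) m m' : let m1 := mpolyC 2 c *: m + m' in
  [/\ coefH m1 = c *: coefH m + coefH m', coefU m1 = c *: coefU m + coefU m'
    & coefV m1 = c *: coefV m + coefV m'].
Proof.
have eU : coefU (mpolyC 2 c *: m + m') = c *: coefU m + coefU m'.
  rewrite /coefU coordXP coordYP !mul_mpolyC addrACA -scalerDr.
  exact: quot_u_linear.
split=> //; last first.
  rewrite /coefV coordXP coordYP !mul_mpolyC addrACA -scalerDr.
  exact: quot_v_linear.
rewrite /coefH eU coordXP mul_mpolyC mulrDr -scalerAr scalerBr opprD.
by rewrite addrACA.
Qed.

Lemma mcoeff_coefU_eq0 d m M : degree_lt d m -> (d <= (mdeg M).+1)%N ->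
  (coefU m)@_M = 0.
Proof.
move=> /degree_ltP H le; rewrite mcoeff_quot_u mcoeffD.
by have [|-> ->] := H (M + U_(ord0))%MM; rewrite ?addr0 // mdegD mdeg1 addn1.
Qed.
Lemma mcoeff_coefV_eq0 d m M : degree_lt d m -> (d <= (mdeg M).+1)%N ->
  (coefV m)@_M = 0.
Proof.
move=> /degree_ltP H le; rewrite mcoeff_quot_v mcoeffD; case: ifP => // _.
by have [|-> ->] := H (M + U_(ord_max))%MM; rewrite ?addr0 // mdegD mdeg1 addn1.
Qed.

Lemma degree_lt0 m : degree_lt 0 m -> m = 0.
Proof.
move=> /degree_ltP H; apply: euler_moduleP; apply/mpolyP => M;
  by have [hX hY] := H M (leq0n _); rewrite ?hX ?hY /coordX /coordY mxE mcoeff0.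
Qed.
End EulerCoordinates.

(** * Derivations prescribed on x and y *)

Section EulerDerivations.
Context (R : comNzRingType) (q h : R).
Local Notation A := (weyl q h).
Local Notation x := (weyl_x q h).
Local Notation y := (weyl_y q h).

Lemma derivation_centralD (z z' : A) (D D' : A -> A) :
  central z -> central z' -> derivation D -> derivation D' ->
  derivation (fun a => z * D a + z' * D' a).
Proof.
move=> zc zc' [Dl DM] [Dl' DM']; split=> [c a b|a b].
  by rewrite Dl Dl' !mulrDr -!weyl_scaleAr scalerDr addrACA.
rewrite DM DM' mulrDl !mulrDr !mulrA (zc a) (zc' a).
by rewrite -!addrA; congr (_ + _); rewrite addrCA.
Qed.

Lemma derivation_eq (D D' : A -> A) : derivation D -> derivation D' ->
  D x = D' x -> D y = D' y -> D =1 D'.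
Proof.
move=> HD HD' ex ey; have [Dl DM] := HD; have [Dl' DM'] := HD'.
elim/weyl_ind => [|c a b Ha Hb|a Ha|a Ha].
- by rewrite !derivation1.
- by rewrite Dl Dl' Ha Hb.
- by rewrite DM DM' ex Ha.
- by rewrite DM DM' ey Ha.
Qed.

Lemma derivation_inner (c : A) : derivation (fun a => a * c - c * a).
Proof.
split=> [d a b|a b].
  rewrite mulrDl mulrDr -weyl_scaleAl -weyl_scaleAr scalerBr opprD.
  by rewrite addrACA.
by rewrite mulrBl mulrBr !mulrA [RHS]addrC addrA subrK.
Qed.

Lemma euler_xy_ex : exists D : A -> A, [/\ derivation D, D x = x & D y = - y].
Proof.
apply: derivation_ex; rewrite /koszul1 mulrN mulNr scalerN opprK.
by rewrite addrACA subrr addNr addr0.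
Qed.

Lemma euler_x_ex : h = 0 -> exists D : A -> A, [/\ derivation D, D x = x & D y = 0].
Proof.
move=> h0; apply: derivation_ex; rewrite /koszul1 mulr0 mul0r scaler0 subr0 addr0.
by rewrite weyl_xy addrC addKr [X in X%:A]h0 scale0r.
Qed.

Lemma euler_y_ex : h = 0 -> exists D : A -> A, [/\ derivation D, D x = 0 & D y = y].
Proof.
move=> h0; apply: derivation_ex; rewrite /koszul1 mulr0 mul0r scaler0 subr0 add0r.
by rewrite weyl_xy addrC addKr [X in X%:A]h0 scale0r.
Qed.

Context (N : nat) (kap : R).
Hypotheses (N_gt0 : (0 < N)%N) (qN : q ^+ N = 1) (qnN : qn q N = 0).
Hypothesis kapE : kap * (q - 1) = h.

(** As [N+1]_q = 1, the value x^(N+1) at x leaves h x^N in the relation. The value kap x^(N-1) at y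
    adds kap (1 - q) x^N, and cancellation forces kap (q - 1) = h; at h = 0 over a field with q
    different from 1, the correction disappears. *)
Lemma euler_u_ex : exists D : A -> A,
  [/\ derivation D, D x = x ^+ N * x & D y = kap *: x ^+ N.-1].
Proof.
apply: derivation_ex; rewrite /koszul1 -exprSr -[x ^+ N.+1](mono0r q h) mono_y.
rewrite -monoS qnS qnN mulr0 addr0 mulr1 exprS qN mulr1 /= mono0r [X in X + _]addrAC subrr add0r.
rewrite -weyl_scaleAr -weyl_scaleAl -exprS -exprSr prednK // scalerA.
by rewrite -scalerBl -scalerDl -kapE [X in X *: _](_ : _ = 0) ?scale0r //; ring.
Qed.

Lemma euler_v_ex : exists D : A -> A,
  [/\ derivation D, D x = kap *: y ^+ N.-1 & D y = y ^+ N * y].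
Proof.
apply: derivation_ex; rewrite /koszul1 -exprSr -[y ^+ N.+1](mono0 q h) x_mono.
rewrite -monoSr qnS qnN mulr0 addr0 mulr1 exprS qN mulr1 /= mono0 [X in _ + X]addrAC subrr add0r.
rewrite -weyl_scaleAr -weyl_scaleAl -exprS -exprSr prednK // scalerA.
by rewrite -scalerBl -scalerDl -kapE [X in X *: _](_ : _ = 0) ?scale0r //; ring.
Qed.
End EulerDerivations.

(** * Spanning and injectivity for H^1 of W_q *)

Section H1.
Context (k : fieldType) (N : nat) (q : k).
Hypotheses (N_ge2 : (2 <= N)%N) (q_prim : N.-primitive_root q).
Local Notation A := (weyl q 1).
Local Notation x := (weyl_x q 1).
Local Notation y := (weyl_y q 1).
Local Notation mono := (pbw_mono q 1).
Local Notation cev := (center_eval N q 1).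
Let qN := prim_expr q_prim.
Let qnN := qn_N N_ge2 q_prim.
Let N0 : (0 < N)%N := ltnW N_ge2.
Let q0 := prim_neq0 N_ge2 q_prim.
Let kap := (q - 1)^-1.

Context (E Du Dv : A -> A).
Hypotheses (E_der : derivation E) (Ex : E x = x) (Ey : E y = - y).
Hypotheses (Du_der : derivation Du) (Dux : Du x = x ^+ N * x)
  (Duy : Du y = kap *: x ^+ N.-1).
Hypotheses (Dv_der : derivation Dv) (Dvx : Dv x = kap *: y ^+ N.-1)
  (Dvy : Dv y = y ^+ N * y).

Local Opaque coefH coefU coefV.

(** For [m] in the submodule, the values at x and y are those of the Euler derivation plus multiples
    of y^(N-1) and x^(N-1) of lower degree; degree arguments see only the first part. *)
Definition euler_lift (m : euler_module k) (a : A) : A :=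
  cev (coefH m) * E a + cev (coefU m) * Du a + cev (coefV m) * Dv a.

Lemma euler_lift_derivation m : derivation (euler_lift m).
Proof.
have ce P := center_eval_central qN qnN P (h := 1).
have D1 := derivation_centralD (ce (coefH m)) (ce (coefU m)) E_der Du_der.
have c1 : central (1 : A) by move=> a; rewrite mul1r mulr1.
have := derivation_centralD c1 (ce (coefV m)) D1 Dv_der.
by congr derivation; apply/funext => a; rewrite mul1r.
Qed.

Lemma center_eval_Xu : cev 'X_ord0 = x ^+ N.
Proof. by rewrite center_evalX // !mnm1E /= muln0 muln1 mono0r. Qed.
Lemma center_eval_Xv : cev 'X_ord_max = y ^+ N.
Proof. by rewrite center_evalX // !mnm1E /= muln0 muln1 mono0. Qed.

Lemma euler_lift_x m : euler_lift m x =
  cev (coordX m) * x + kap *: (cev (coefV m) * y ^+ N.-1).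
Proof.
rewrite /euler_lift Ex Dux Dvx -weyl_scaleAr coordXE [in RHS]center_evalD.
rewrite center_evalM // center_eval_Xu mulrDl; congr (_ + _ + _).
by rewrite [x ^+ N * _ in RHS](central_xN qN qnN) mulrA.
Qed.

Lemma euler_lift_y m : H1_submodule m -> euler_lift m y =
  cev (coordY m) * y + kap *: (cev (coefU m) * x ^+ N.-1).
Proof.
move=> Hm; rewrite /euler_lift Ey Duy Dvy -weyl_scaleAr (coordYE Hm) [in RHS]center_evalD.
rewrite center_evalM // center_eval_Xv mulrDl -!addrA; congr (_ + _).
  by rewrite -[- coefH m]scaleN1r center_evalZ scaleN1r mulrN mulNr.
rewrite addrC; congr (_ + _).
by rewrite [y ^+ N * _ in RHS](central_yN qN qnN) mulrA.
Qed.

Lemma euler_lift_lin c m m' a : euler_lift (mpolyC 2 c *: m + m') a =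
  c *: euler_lift m a + euler_lift m' a.
Proof.
have [eE eU eV] := coef_lin c m m'; rewrite /euler_lift eE eU eV.
rewrite !(center_evalD _ _ _ (_ *: _)) !center_evalZ !mulrDl -!weyl_scaleAl !scalerDr.
by rewrite (addrACA (c *: (cev (coefH m) * E a))) [LHS]addrACA.
Qed.

Lemma euler_lift0 a : euler_lift 0 a = 0.
Proof.
have := euler_lift_lin (-1) 0 0 a; rewrite scaler0 addr0 => ->.
by rewrite scaleN1r addNr.
Qed.

(** Of the two summands N in the bound, one reflects that [m] has degree at most d - 1, the other
    the division by v. *)
Lemma deg_lt_coefV d n n' m a : degree_lt d m -> deg_lt n a ->
  (N * d + n <= n' + N + N)%N -> deg_lt n' (cev (coefV m) * a).
Proof.
move=> md Ha le; apply: (deg_lt_center qN qnN Ha) => M; rewrite mcoeff_msupp => nz.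
have lt : ((mdeg M).+1 < d)%N.
  by rewrite ltnNge; apply: contra nz => le'; rewrite (mcoeff_coefV_eq0 md).
have : (N * (mdeg M).+2 <= N * d)%N by rewrite leq_mul2l lt orbT.
by rewrite !mulnS; lia.
Qed.
Lemma deg_lt_coefU d n n' m a : degree_lt d m -> deg_lt n a ->
  (N * d + n <= n' + N + N)%N -> deg_lt n' (cev (coefU m) * a).
Proof.
move=> md Ha le; apply: (deg_lt_center qN qnN Ha) => M; rewrite mcoeff_msupp => nz.
have lt : ((mdeg M).+1 < d)%N.
  by rewrite ltnNge; apply: contra nz => le'; rewrite (mcoeff_coefU_eq0 md).
have : (N * (mdeg M).+2 <= N * d)%N by rewrite leq_mul2l lt orbT.
by rewrite !mulnS; lia.
Qed.

Lemma deg_lt_Ym n : deg_lt n.+1 (y ^+ n).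
Proof. by have := @deg_lt_mono k q 1 n 0; rewrite mono0 addn0. Qed.
Lemma deg_lt_Xm n : deg_lt n.+1 (x ^+ n).
Proof. by have := @deg_lt_mono k q 1 0 n; rewrite mono0r. Qed.

(** The candidate for the leading term: the coefficients in degree t+1 of [a] on central multiples
    of x and of [b] on central multiples of y. It is zero unless N divides t. *)
Lemma euler_ex t (a b : A) : exists m : euler_module k, forall M,
  (coordX m)@_M = (if (N * mdeg M == t)%N
    then cf (N * M ord_max) (N * M ord0).+1 a else 0) /\
  (coordY m)@_M = (if (N * mdeg M == t)%N
    then cf (N * M ord_max).+1 (N * M ord0) b else 0).
Proof.
pose cX (M : 'X_{1..2}) := if (N * mdeg M == t)%N
  then cf (N * M ord_max) (N * M ord0).+1 a else 0.
pose cY (M : 'X_{1..2}) := if (N * mdeg M == t)%N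
  then cf (N * M ord_max).+1 (N * M ord0) b else 0.
pose PX : center_poly k := \sum_(M : 'X_{1..2 < t.+1}) cX M *: 'X_[M].
pose PY : center_poly k := \sum_(M : 'X_{1..2 < t.+1}) cY M *: 'X_[M].
have nt (M : 'X_{1..2}) : (t.+1 <= mdeg M)%N -> (N * mdeg M == t)%N = false.
  by move=> le; apply/negbTE/eqP => e; move: le; rewrite -e ltnNge leq_pmull.
exists (PX *: euler_x k + PY *: euler_y k) => M; split.
  rewrite coordXP coordXZ coordX_x coordX_y mulr1 mulr0 addr0.
  by rewrite mcoeff_sum_lt // => M' /nt; rewrite /cX => ->.
rewrite coordYP coordYZ coordY_x coordY_y mulr1 mulr0 add0r.
by rewrite mcoeff_sum_lt // => M' /nt; rewrite /cY => ->.
Qed.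

(** In top degree the terms coming from h exceed the degree bound, and the equation is that of a
    derivation of the quantum plane. *)
Lemma koszul1_top (a b : A) j i t : deg_lt t.+2 a -> deg_lt t.+2 b ->
  koszul1 a b = 0 -> (j + i = t)%N ->
  (q ^+ i - 1) * cf j i.+1 a + (q ^+ j - 1) * cf j.+1 i b = 0.
Proof.
move=> Ha Hb ab0 ji; have := congr1 (cf j.+1 i.+1) ab0.
rewrite /koszul1 !cfE cf_mul_y cf_y_mul cf_x_mul cf_mul_x.
rewrite (Ha _ i.+2) ?(Hb j.+2); try lia.
move=> e; apply: (mulfI q0); rewrite mulr0 -{}e !exprS; ring.
Qed.

(** In top degree y^(t+1) arises only from y^t in [a], with coefficient 1 - q. Such a boundary
    monomial has the form of neither an Euler nor an inner leading term. *)
Lemma koszul1_edge_l (a b : A) t : deg_lt t.+1 a -> deg_lt t.+1 b ->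
  koszul1 a b = 0 -> cf t 0 a = 0.
Proof.
move=> Ha Hb ab0; have := congr1 (cf t.+1 0) ab0.
rewrite /koszul1 !cfE cf_mul_y cf_y_mul cf_x_mul cf_mul_x.
rewrite (Ha t.+1) ?(Hb t.+2); try lia.
rewrite expr0 !mulr0 oppr0 !addr0 mul1r => /eqP.
rewrite -[X in X - _]mul1r -mulrBl mulf_eq0 => /orP[|/eqP//].
by rewrite -opprB oppr_eq0 (negbTE (prim_sub1 N_ge2 q_prim)).
Qed.

Lemma koszul1_edge_r (a b : A) t : deg_lt t.+1 a -> deg_lt t.+1 b ->
  koszul1 a b = 0 -> cf 0 t b = 0.
Proof.
move=> Ha Hb ab0; have := congr1 (cf 0 t.+1) ab0.
rewrite /koszul1 !cfE cf_mul_y cf_y_mul cf_x_mul cf_mul_x.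
rewrite (Ha 0 t.+2) ?(Hb 1); try lia.
rewrite expr0 !mulr0 oppr0 !addr0 !add0r mul1r => /eqP.
rewrite -[X in X - _]mul1r -mulrBl mulf_eq0 => /orP[|/eqP//].
by rewrite -opprB oppr_eq0 (negbTE (prim_sub1 N_ge2 q_prim)).
Qed.

Lemma koszul1_const (a b : A) : koszul1 a b = 0 -> cf 0 1 a + cf 1 0 b = 0.
Proof.
move/(congr1 (cf 0 0)).
rewrite /koszul1 !cfE cf_mul_y cf_y_mul cf_x_mul cf_mul_x qn1 => <-; ring.
Qed.

Lemma koszul1_euler_lift m (c : A) :
  koszul1 (euler_lift m x + (x * c - c * x)) (euler_lift m y + (y * c - c * y)) = 0.
Proof.
have c1 : central (1 : A) by move=> a; rewrite mul1r mulr1.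
have D := derivation_centralD c1 c1 (euler_lift_derivation m) (derivation_inner c).
by have := koszul1_derivation D; rewrite !mul1r.
Qed.

Lemma H1_span_step t (a b : A) : deg_lt t.+2 a -> deg_lt t.+2 b ->
  koszul1 a b = 0 -> exists m (c : A), [/\ H1_submodule m,
    forall d, (t < N * d)%N -> degree_lt d m,
    deg_lt t.+1 (a - (euler_lift m x + (x * c - c * x)))
    & deg_lt t.+1 (b - (euler_lift m y + (y * c - c * y)))].
Proof.
move=> Ha Hb ab0; have [m Em] := euler_ex t a b.
have Hm : H1_submodule m.
  apply/H1_submoduleP; rewrite mcoeffD; have [-> ->] := Em 0%MM.
  rewrite mdeg0 muln0; case: eqP => [_|]; last by rewrite addr0.
  by rewrite !mnm0E !muln0 koszul1_const.
have degm d : (t < N * d)%N -> degree_lt d m.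
  move=> lt; apply/degree_ltP => M le; have [-> ->] := Em M.
  have /negbTE -> : (N * mdeg M != t)%N; last by [].
  by rewrite neq_ltn (leq_trans lt) ?orbT // leq_mul2l le orbT.
(* Bracketing with x multiplies the coefficient of y^j x^i by q^j - 1 and bracketing with y by 1 -
   q^i, up to lower degree. The first branch solves for [a], the second for [b], and [koszul1_top]
   makes them compatible; where N divides both indices, [m] takes over. *)
pose g j i : k := if (j + i == t)%N then
    if ~~ (N %| j)%N then cf j i.+1 a / (q ^+ j - 1)
    else if ~~ (N %| i)%N then - cf j.+1 i b / (q ^+ i - 1) else 0
  else 0.
have [|c Ec] := @cf_ex k q 1 t.+1 g.
  by move=> j i H; rewrite /g (_ : (j + i == t)%N = false) //; apply/negbTE/eqP; lia.
have cN j i : (j + i != t)%N -> cf j i c = 0.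
  by move=> /negbTE ne; rewrite Ec /g ne.
have degc : deg_lt t.+1 c by move=> j i lt; apply: cN; lia.
have degt : degree_lt (t %/ N).+1 m by apply: degm; rewrite mulnC ltn_ceil.
have leN : (N * (t %/ N).+1 <= t + N)%N.
  by rewrite mulnS addnC leq_add2r mulnC leq_trunc_div.
have supp (M : 'X_{1..2}) P : (P = coordX m) \/ (P = coordY m) -> M \in msupp P ->
    (N * mdeg M + 2 <= t.+2)%N.
  move=> HP; rewrite mcoeff_msupp; have [e1 e2] := Em M.
  by case: HP => ->; rewrite ?e1 ?e2; case: (N * mdeg M =P t)%N => [->|_];
    rewrite ?addn2 ?eqxx.
have NK n : (N %| n)%N -> (N * (n %/ N) = n)%N by move=> d; rewrite mulnC divnK.
have coordK j i : (N %| j)%N -> (N %| i)%N -> (j + i = t)%N ->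
    (coordX m)@_(mk2 (i %/ N) (j %/ N)) = cf j i.+1 a /\
    (coordY m)@_(mk2 (i %/ N) (j %/ N)) = cf j.+1 i b.
  move=> dj di ji; have [-> ->] := Em (mk2 (i %/ N) (j %/ N)).
  by rewrite mdeg2 mk2_0 mk2_1 mulnDr !NK // addnC ji eqxx.
have q_eq1 n : (N %| n)%N -> q ^+ n = 1 by rewrite -(prim_eq1 q_prim) => /eqP.
have q_neq1 n : ~~ (N %| n)%N -> q ^+ n - 1 != 0.
  by rewrite subr_eq0 (prim_eq1 q_prim).
exists m, c; split=> //.
- have ex : cev (coordX m) * x = cev (coordX m) * mono 0 1 by rewrite mono0r expr1.
  have degX : deg_lt t.+2 (cev (coordX m) * x).
    rewrite ex; apply: (deg_lt_center qN qnN (@deg_lt_mono k q 1 0 1)) => M.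
    by apply: supp; left.
  have degV : deg_lt t.+1 (kap *: (cev (coefV m) * y ^+ N.-1)).
    apply/deg_ltZ/(deg_lt_coefV degt (@deg_lt_Ym _)); rewrite prednK //; lia.
  rewrite euler_lift_x => J I; rewrite leq_eqVlt => /orP[/eqP JI|]; last first.
    move=> lt; apply: (_ : deg_lt t.+2 _) lt.
    apply: deg_ltD => //; apply/deg_ltN/deg_ltD; first exact/deg_ltD/deg_ltW/degV.
    by apply: deg_ltD; [exact: deg_lt_x_mul | exact/deg_ltN/deg_lt_mul_x].
  rewrite !cfD cfN !cfD cfN degV ?JI // addr0 ex cf_center // cf_x_mul cf_mul_x.
  rewrite [cf J.+1 I c]cN ?mulr0 ?addr0; last by apply/eqP; lia.
  case: I JI => [|i] JI.
    rewrite addn0 in JI; rewrite -JI in Ha Hb *.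
    by rewrite (koszul1_edge_l Ha Hb ab0) /= andbF mulr0 subrr addr0 subrr.
  have {}JI : (J + i = t)%N by lia.
  have rel := koszul1_top Ha Hb ab0 JI.
  rewrite Ec /g JI eqxx subn0 subn1 /=.
  have [dJ|nJ] := boolP (N %| J)%N; last first.
    by rewrite /=; field; apply: q_neq1.
  have [di|ni] := boolP (N %| i)%N => /=.
    by have [-> _] := coordK _ _ dJ di JI; ring.
  move: rel; rewrite (q_eq1 _ dJ) subrr mul0r addr0 => /eqP.
  by rewrite mulf_eq0 (negbTE (q_neq1 _ ni)) => /eqP ->; ring.
- have ey : cev (coordY m) * y = cev (coordY m) * mono 1 0 by rewrite mono0 expr1.
  have degY : deg_lt t.+2 (cev (coordY m) * y).
    rewrite ey; apply: (deg_lt_center qN qnN (@deg_lt_mono k q 1 1 0)) => M.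
    by apply: supp; right.
  have degU : deg_lt t.+1 (kap *: (cev (coefU m) * x ^+ N.-1)).
    apply/deg_ltZ/(deg_lt_coefU degt (@deg_lt_Xm _)); rewrite prednK //; lia.
  rewrite euler_lift_y // => J I; rewrite leq_eqVlt => /orP[/eqP JI|]; last first.
    move=> lt; apply: (_ : deg_lt t.+2 _) lt.
    apply: deg_ltD => //; apply/deg_ltN/deg_ltD; first exact/deg_ltD/deg_ltW/degU.
    by apply: deg_ltD; [exact: deg_lt_y_mul | exact/deg_ltN/deg_lt_mul_y].
  rewrite !cfD cfN !cfD cfN degU ?JI // addr0 ey cf_center // cf_y_mul cf_mul_y.
  rewrite [cf J I.+1 c]cN ?mulr0 ?addr0; last by apply/eqP; lia.
  case: J JI => [|j] JI.
    rewrite add0n in JI; rewrite -JI in Ha Hb *.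
    by rewrite (koszul1_edge_r Ha Hb ab0) /= mulr0 subrr addr0 subrr.
  have {}JI : (j + I = t)%N by lia.
  have rel := koszul1_top Ha Hb ab0 JI.
  rewrite Ec /g JI eqxx subn0 subn1 /=.
  have [dj|nj] := boolP (N %| j)%N; last first.
    have nz := q_neq1 _ nj; rewrite /=.
    apply: (mulfI nz); rewrite mulr0 -[RHS]rel; field.
    exact: nz.
  have [dI|nI] := boolP (N %| I)%N => /=.
    by have [_ ->] := coordK _ _ dj dI JI; ring.
  by field; apply: q_neq1.
Qed.

Lemma degree_lt_lin d (c : k) m m' : degree_lt d m -> degree_lt d m' ->
  degree_lt d (mpolyC 2 c *: m + m').
Proof.
move=> /degree_ltP H /degree_ltP H'; apply/degree_ltP => M le.
have [e1 e2] := H M le; have [e1' e2'] := H' M le.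
rewrite coordXP coordYP !mul_mpolyC !mcoeffD !mcoeffZ e1 e2 e1' e2'.
by rewrite mulr0 addr0.
Qed.

Lemma H1_span n (a b : A) : deg_lt n a -> deg_lt n b -> koszul1 a b = 0 ->
  exists m (c : A), [/\ H1_submodule m,
    forall d, (n <= N * d)%N -> degree_lt d m,
    a = euler_lift m x + (x * c - c * x) & b = euler_lift m y + (y * c - c * y)].
Proof.
have H0 : H1_submodule (0 : euler_module k).
  by apply/H1_submoduleP; rewrite /coordX /coordY !mxE addr0 mcoeff0.
have D0 d : degree_lt d (0 : euler_module k).
  by apply/degree_ltP => M _; rewrite /coordX /coordY !mxE mcoeff0.
elim: n a b => [|n IH] a b Ha Hb ab0.
  have z (u : A) : deg_lt 0 u -> u = 0.
    by move=> H; apply: cf_inj => j i; rewrite cf0 H.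
  exists 0, 0; split; first exact: H0.
  - by move=> d _; apply: D0.
  - by rewrite euler_lift0 !mulr0 !mul0r subrr addr0; apply: z.
  - by rewrite euler_lift0 !mulr0 !mul0r subrr addr0; apply: z.
(* The step needs leading degree t+1 at least 1. A pair of constants is zero by the edge lemmas, so
   the bound 1 drops to 0. *)
case: n IH Ha Hb => [|t] IH Ha Hb.
  have [||//|m [c [Hm Hd -> ->]]] := IH a b.
  - move=> j i; case: j => [|j] le; last by apply: Ha.
    by case: i le => [|i] le; [apply: (koszul1_edge_l Ha Hb) | apply: Ha].
  - move=> j i; case: i => [|i] le; last by apply: Hb; rewrite addnS.
    by case: j le => [|j] le; [apply: (koszul1_edge_r Ha Hb) | apply: Hb].
  - by exists m, c; split=> // d le; apply: Hd.
have [m [c [Hm Hd Da Db]]] := H1_span_step Ha Hb ab0.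
have [|m' [c' [Hm' Hd' ea eb]]] := IH _ _ Da Db.
  have := koszul1P (-1) (euler_lift m x + (x * c - c * x))
    (euler_lift m y + (y * c - c * y)) a b.
  rewrite koszul1_euler_lift ab0 scaler0 addr0 => <-.
  by rewrite !scaleN1r [- _ + a]addrC [- _ + b]addrC.
have add (u v w z : A) : u - (v + w) = z -> u = v + w + z.
  by move=> <-; rewrite addrC subrK.
exists (mpolyC 2 1 *: m + m'), (c + c'); split.
- exact: H1_submodule_lin.
- move=> d le; apply: degree_lt_lin; first by apply: Hd; apply: leq_trans le.
  by apply: Hd'; apply: leq_trans le.
- rewrite (add _ _ _ _ ea) euler_lift_lin scale1r addrACA; congr (_ + _).
  by rewrite mulrDr mulrDl opprD addrACA.
- rewrite (add _ _ _ _ eb) euler_lift_lin scale1r addrACA; congr (_ + _).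
  by rewrite mulrDr mulrDl opprD addrACA.
Qed.

Hypothesis N_unit : N%:R != 0 :> k.

Lemma derivation_exp (D : A -> A) (u : A) n : derivation D ->
  D (u ^+ n) = \sum_(i < n) u ^+ i * D u * u ^+ (n.-1 - i).
Proof.
move=> HD; have [Dl DM] := HD; elim: n => [|n IH].
  by rewrite expr0 derivation1 // big_ord0.
rewrite exprS DM IH big_ord_recl expr0 mul1r subn0 mulr_sumr; congr (_ + _).
apply: eq_bigr => i _; rewrite !mulrA -exprS /=; congr (_ * _ ^+ _).
by rewrite /bump /=; have := ltn_ord i; lia.
Qed.

Lemma deg_ltM n m (a b : A) : deg_lt n.+1 a -> deg_lt m b -> deg_lt (n + m) (a * b).
Proof.
move=> Ha Hb; have [e He] := cf_bounded_ex a.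
rewrite (mono_expand He) mulr_suml; apply: deg_lt_sum => j _.
rewrite mulr_suml; apply: deg_lt_sum => i _; rewrite -weyl_scaleAl.
have [le|lt] := leqP (j + i) n; last by rewrite Ha // scale0r; apply: deg_lt0.
apply: deg_ltZ; apply: deg_ltW (deg_lt_mono_mul Hb).
by rewrite addnC leq_add2r.
Qed.

Lemma deg_lt_conj n i j (a : A) (u : A) : (forall e, deg_lt e.+1 (u ^+ e)) ->
  deg_lt n.+1 a -> deg_lt (n + i + j).+1 (u ^+ i * a * u ^+ j).
Proof.
move=> Hu Ha.
have Hi : deg_lt (i + n).+1 (u ^+ i * a) by rewrite -addnS; apply: deg_ltM.
by have := deg_ltM Hi (Hu j); rewrite addnS [(i + n)%N]addnC.
Qed.

Lemma sum_conj_central n (z u w : A) : central z ->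
  \sum_(i < n.+1) u ^+ i * (z * u + w) * u ^+ (n - i) =
  n.+1%:R *: (z * u ^+ n.+1) + \sum_(i < n.+1) u ^+ i * w * u ^+ (n - i).
Proof.
move=> zc; under eq_bigr => i _ do rewrite mulrDr mulrDl.
rewrite big_split /= scaler_nat; congr (_ + _).
rewrite -[n.+1 in RHS]card_ord -sumr_const; apply: eq_bigr => i _.
rewrite mulrA -(zc (u ^+ i)) -!mulrA -exprS -exprD card_ord; congr (_ * _ ^+ _).
by have := ltn_ord i; lia.
Qed.

Lemma inner_exp_central n (D : A -> A) (u w z c : A) : derivation D ->
  (forall a, D a = a * c - c * a) -> central (u ^+ n.+1) -> central z ->
  D u = z * u + w ->
  n.+1%:R *: (z * u ^+ n.+1) + \sum_(i < n.+1) u ^+ i * w * u ^+ (n - i) = 0.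
Proof.
move=> HD Dc uc zc eu; rewrite -(sum_conj_central _ _ _ zc) -eu.
by rewrite -(derivation_exp u n.+1 HD) Dc uc subrr.
Qed.

(** An inner derivation kills the central elements x^N and y^N. By the Leibniz rule the lift sends
    x^N to N times [coordX m] times x^N plus conjugated corrections of smaller degree, so the top
    coefficients of [m] vanish because N is nonzero in k, and the degree descends to 0. *)
Lemma euler_lift_inner_eq0 m (c : A) : H1_submodule m ->
  (forall a, euler_lift m a = a * c - c * a) -> m = 0.
Proof.
move=> Hm Hc; have Dd := euler_lift_derivation m.
have ce P := center_eval_central qN qnN P (h := 1).
suff step d : degree_lt d.+1 m -> degree_lt d m.
  have [d] : exists d, degree_lt d m.
    exists (maxn (msize (coordX m)) (msize (coordY m))); apply/degree_ltP => M.
    by rewrite geq_max => /andP[le le']; split; apply: mcoeff_ge.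
  by elim: d => [|d IH]; [apply: degree_lt0 | move=> /step].
move=> degm; apply/degree_ltP => M le.
have [lt|le'] := ltnP d (mdeg M); first by move/degree_ltP: degm; apply.
have {le le'} eM : mdeg M = d by apply/eqP; rewrite eqn_leq le le'.
have N1 : N = N.-1.+1 by rewrite prednK.
have degs (u w : A) : (forall e, deg_lt e.+1 (u ^+ e)) -> deg_lt (N * d) w ->
    deg_lt (N * d + N) (\sum_(i < N.-1.+1) u ^+ i * w * u ^+ (N.-1 - i)).
  move=> Hu Hw; apply: deg_lt_sum => i _.
  have Hw' : deg_lt (N * d).+1 w by apply: deg_ltW Hw.
  apply: deg_ltW (deg_lt_conj Hu Hw').
  by have := ltn_ord i; lia.
have Nnz (z : k) : N%:R * z = 0 -> z = 0.
  by move=> /eqP; rewrite mulf_eq0 (negbTE N_unit) => /eqP.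
split; apply: Nnz.
- have W : deg_lt (N * d) (kap *: (cev (coefV m) * y ^+ N.-1)).
    apply/deg_ltZ/(deg_lt_coefV degm (@deg_lt_Ym _)); rewrite prednK // mulnS; lia.
  have uc : central (x ^+ N.-1.+1) by rewrite prednK //; apply: central_xN.
  have := inner_exp_central Dd Hc uc (ce _) (euler_lift_x m).
  move/(congr1 (cf (N * M ord_max) (N * M ord0 + N))); rewrite cfD cfZ cf0.
  rewrite degs //; last 2 first.
  + exact: deg_lt_Xm.
  + by rewrite addnA leq_add2r -mulnDr [(M ord_max + _)%N]addnC -mdeg2 eM.
  rewrite addr0 -N1 -(mono0r q 1) cf_center // subn0 addnK leq_addl !dvdn_mulr //=.
  by rewrite !mulKn // mk2K.
- have W : deg_lt (N * d) (kap *: (cev (coefU m) * x ^+ N.-1)).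
    apply/deg_ltZ/(deg_lt_coefU degm (@deg_lt_Xm _)); rewrite prednK // mulnS; lia.
  have uc : central (y ^+ N.-1.+1) by rewrite prednK //; apply: central_yN.
  have := inner_exp_central Dd Hc uc (ce _) (euler_lift_y Hm).
  move/(congr1 (cf (N * M ord_max + N) (N * M ord0))); rewrite cfD cfZ cf0.
  rewrite degs //; last 2 first.
  + exact: deg_lt_Ym.
  + by rewrite addnAC leq_add2r -mulnDr [(M ord_max + _)%N]addnC -mdeg2 eM.
  rewrite addr0 -N1 -(mono0 q 1) cf_center // subn0 addnK leq_addl !dvdn_mulr //=.
  by rewrite !mulKn // mk2K.
Qed.
End H1.

(** * Cochains on finite functions rewritten as maps of one or two arguments *)

Section Cochains.
Context (R : comNzRingType) (A : algType R).

Definition arg1 (u : A) : {ffun 'I_1 -> A} := [ffun=> u].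
Definition arg2 (u v : A) : {ffun 'I_2 -> A} := [ffun i => if i == ord0 then u else v].

Lemma arg1E (a : {ffun 'I_1 -> A}) : a = arg1 (a ord0).
Proof. by apply/ffunP => i; rewrite ffunE (ord1 i). Qed.
Lemma arg2E (a : {ffun 'I_2 -> A}) : a = arg2 (a ord0) (a ord_max).
Proof. by apply/ffunP => i; rewrite ffunE; case: (ord2P i) => ->. Qed.
Lemma arg2_0 u v : arg2 u v ord0 = u. Proof. by rewrite ffunE. Qed.
Lemma arg2_1 u v : arg2 u v ord_max = v. Proof. by rewrite ffunE. Qed.

Lemma hoch_diff0 (f : cochain A 0) (e : {ffun 'I_0 -> A}) a :
  hoch_diff f a = a ord0 * f e - f e * a ord0.
Proof.
rewrite /hoch_diff big_ord0 addr0 expr1 mulN1r.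
have eE (e' : {ffun 'I_0 -> A}) : e' = e by apply/ffunP => -[].
by rewrite !(eE [ffun _ => _]) (ord1 ord_max).
Qed.

Lemma hoch_diff1 (f : cochain A 1) a : hoch_diff f a =
  a ord0 * f (arg1 (a ord_max)) - f (arg1 (a ord0 * a ord_max))
  + f (arg1 (a ord0)) * a ord_max.
Proof.
rewrite /hoch_diff big_ord1 expr1 mulN1r sqrrN expr1n mul1r.
have l0 : lift ord0 ord0 = ord_max :> 'I_2 by apply: val_inj.
have w0 : widen_ord (leqnSn 1) ord0 = ord0 by apply: val_inj.
congr (_ * f _ - f _ + f _ * _); rewrite [LHS]arg1E; congr arg1.
- by rewrite ffunE l0.
- by rewrite ffunE /= w0 l0.
- by rewrite ffunE w0.
Qed.

Lemma hoch_diff2 (f : cochain A 2) (a : {ffun 'I_3 -> A}) (a0 := a ord0)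
  (a1 := a (lift ord0 ord0)) (a2 := a ord_max) : hoch_diff f a =
  a0 * f (arg2 a1 a2) - f (arg2 (a0 * a1) a2) + f (arg2 a0 (a1 * a2))
  - f (arg2 a0 a1) * a2.
Proof.
rewrite /hoch_diff big_ord_recl big_ord1 /= expr1 mulN1r.
have -> : (-1) ^+ 3 = -1 :> A by rewrite !exprS expr0 mulr1 mulrNN mulr1 mulN1r.
rewrite /bump /= addn0 sqrrN expr1n mul1r mulN1r addrA.
have l1 : lift ord0 ord_max = ord_max :> 'I_3 by apply: val_inj.
have w0 : widen_ord (leqnSn 2) ord0 = ord0 by apply: val_inj.
have w1 : widen_ord (leqnSn 2) ord_max = lift ord0 ord0 by apply: val_inj.
have m1 : lift ord0 ord0 = ord_max :> 'I_2 by apply: val_inj.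
congr (_ * f _ - f _ + f _ - f _ * _); rewrite [LHS]arg2E; congr arg2;
  by rewrite !ffunE /= ?m1 ?l1 ?w0 ?w1.
Qed.

Lemma multilinear1P (f : cochain A 1) :
  multilinear f <-> linear (fun u => f (arg1 u)).
Proof.
have E (a : {ffun 'I_1 -> A}) i u : finfun [eta a with i |-> u] = arg1 u.
  by apply/ffunP => j; rewrite !ffunE (ord1 i) (ord1 j).
split=> [H c u v|H a i c u v]; last by rewrite !E H.
by have := H (arg1 0) ord0 c u v; rewrite !E.
Qed.

Lemma multilinear2P (f : cochain A 2) : multilinear f <->
  (forall u, linear (fun v => f (arg2 u v))) /\
  (forall v, linear (fun u => f (arg2 u v))).
Proof.
have E0 (a : {ffun 'I_2 -> A}) u :
    finfun [eta a with ord0 |-> u] = arg2 u (a ord_max).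
  by apply/ffunP => j; rewrite !ffunE /=; case: (ord2P j) => ->.
have E1 (a : {ffun 'I_2 -> A}) u :
    finfun [eta a with ord_max |-> u] = arg2 (a ord0) u.
  by apply/ffunP => j; rewrite !ffunE /=; case: (ord2P j) => ->.
split=> [H|[H1 H0] a i c u v].
  split=> [u c v v'|v c u u'].
    by have := H (arg2 u 0) ord_max c v v'; rewrite !E1 !arg2_0.
  by have := H (arg2 0 v) ord0 c u u'; rewrite !E0 !arg2_1.
by case: (ord2P i) => ->; rewrite ?E0 ?E1 ?H0 ?H1.
Qed.

Lemma cocycle1P (f : cochain A 1) :
  cocycle f <-> derivation (fun u => f (arg1 u)).
Proof.
split=> [[/multilinear1P fl fc]|[fl fM]].
  split=> // u v; have /eqP := fc (arg2 u v).
  rewrite hoch_diff1 arg2_0 arg2_1 addrAC subr_eq0 => /eqP <-.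
  by rewrite addrC.
split=> [|a]; first exact/multilinear1P.
have /= e := fM (a ord0) (a ord_max).
by rewrite hoch_diff1 e opprD addrCA subrr addr0 addNr.
Qed.

Lemma cocycle1_cochain1 (D : A -> A) : derivation D -> cocycle (cochain1 D).
Proof.
move=> HD; apply/cocycle1P; congr derivation: HD.
by apply/funext => u; rewrite /cochain1 ffunE.
Qed.

Lemma coboundary1P (f : cochain A 1) : coboundary f <->
  exists c, forall a, f a = a ord0 * c - c * a ord0.
Proof.
split=> [[g [_ fg]]|[c fc]].
  by exists (g [ffun=> 0]) => a; rewrite fg (hoch_diff0 _ [ffun=> 0]).
exists (fun=> c); split=> [a []//|a].
by rewrite (hoch_diff0 _ [ffun=> 0]) fc.
Qed.

Lemma cohomologous1P (f g : cochain A 1) : cohomologous f g <->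
  exists c, forall u, f (arg1 u) = g (arg1 u) + (u * c - c * u).
Proof.
rewrite /cohomologous; split=> [/coboundary1P[c fc]|[c fc]].
  exists c => u; have := fc (arg1 u); rewrite /= ffunE => <-.
  by rewrite addrC subrK.
apply/coboundary1P; exists c => a; rewrite [a in LHS]arg1E /= fc.
by rewrite addrC addKr.
Qed.

Lemma cohomologous1_refl (f g : cochain A 1) : f =1 g -> cohomologous f g.
Proof.
move=> fg; apply/cohomologous1P; exists 0 => u.
by rewrite fg mulr0 mul0r subrr addr0.
Qed.
End Cochains.

Section Cochains2.
Context (R : comNzRingType) (q h : R).
Local Notation A := (weyl q h).

Lemma cocycle2P (f : cochain A 2) :
  cocycle f <-> cocycle2 (fun u v => f (arg2 u v)).
Proof.
split=> [[/multilinear2P[f1 f0] fc]|[f1 f0 fA]].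
  split=> // u v w.
  have := fc [ffun i : 'I_3 => if i == ord0 then u else if i == ord_max then w else v].
  rewrite hoch_diff2 !ffunE /= => E; apply/eqP; rewrite -subr_eq0 -[X in _ == X]E.
  by apply/eqP; rewrite opprD addrA [X in X - _ = _]addrAC.
split=> [|a]; first exact/multilinear2P.
have /= e := fA (a ord0) (a (lift ord0 ord0)) (a ord_max).
by rewrite hoch_diff2 [X in X - _ = _]addrAC e [X in X - _ - _]addrC addrK subrr.
Qed.

Lemma coboundary2P (f : cochain A 2) : coboundary f <->
  exists g : A -> A, linear g /\ forall a, f a = hoch1 g (a ord0) (a ord_max).
Proof.
split=> [[g [/multilinear1P gl fg]]|[g [gl fg]]].
  by exists (fun u => g (arg1 u)); split=> // a; rewrite fg hoch_diff1.
exists (cochain1 g); split=> [|a].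
  apply/multilinear1P => c u v; rewrite /cochain1 !ffunE; exact: gl.
by rewrite fg hoch_diff1 /cochain1 !ffunE.
Qed.
End Cochains2.

(** * Compatibility with the specializations of hbar *)

Section Specialize.
Context (k : fieldType) (q t : k).
Local Notation H := (weyl q%:P ('X : {poly k})).
Local Notation xh := (weyl_x q%:P ('X : {poly k})).
Local Notation yh := (weyl_y q%:P ('X : {poly k})).
Local Notation at_t := (hbar_at t : weyl_hbar q -> weyl q t).

Lemma hbar_atD (a b : H) : at_t (a + b) = at_t a + at_t b.
Proof. exact: (rmorphD (hbar_at t : {rmorphism weyl_hbar q -> weyl q t})). Qed.
Lemma hbar_at0 : at_t 0 = 0.
Proof. exact: (rmorph0 (hbar_at t : {rmorphism weyl_hbar q -> weyl q t})). Qed.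
Lemma hbar_atN (a : H) : at_t (- a) = - at_t a.
Proof. exact: (rmorphN (hbar_at t : {rmorphism weyl_hbar q -> weyl q t})). Qed.
Lemma hbar_atM (a b : H) : at_t (a * b) = at_t a * at_t b.
Proof. exact: (rmorphM (hbar_at t : {rmorphism weyl_hbar q -> weyl q t})). Qed.
Lemma hbar_at1 : at_t 1 = 1.
Proof. exact: (rmorph1 (hbar_at t : {rmorphism weyl_hbar q -> weyl q t})). Qed.
Lemma hbar_atX (a : H) n : at_t (a ^+ n) = at_t a ^+ n.
Proof. exact: (rmorphXn (hbar_at t : {rmorphism weyl_hbar q -> weyl q t})). Qed.
Lemma hbar_atS c (a : H) : at_t (c *: a) = c.[t] *: at_t a.
Proof. exact: hbar_atZ. Qed.
Lemma hbar_atP c (a b : H) : at_t (c *: a + b) = c.[t] *: at_t a + at_t b.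
Proof. by rewrite hbar_atD hbar_atS. Qed.

Lemma hbar_at_mono j i : at_t (pbw_mono q%:P 'X j i) = pbw_mono q t j i.
Proof. by rewrite /pbw_mono hbar_atM !hbar_atX hbar_at_x hbar_at_y. Qed.

Lemma hbar_at_derivation (Dh : H -> H) (D : weyl q t -> weyl q t) :
  derivation Dh -> derivation D ->
  at_t (Dh xh) = D (weyl_x q t) -> at_t (Dh yh) = D (weyl_y q t) ->
  forall a : H, at_t (Dh a) = D (at_t a).
Proof.
move=> HD HD' ex ey; have [Dl DM] := HD; have [Dl' DM'] := HD'.
elim/weyl_ind => [|c a b Ha Hb|a Ha|a Ha].
- by rewrite hbar_at1 !derivation1 // hbar_at0.
- by rewrite Dl !hbar_atP Dl' Ha Hb.
- by rewrite DM hbar_atD !hbar_atM ex Ha hbar_at_x DM'.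
- by rewrite DM hbar_atD !hbar_atM ey Ha hbar_at_y DM'.
Qed.

Lemma qn_polyC n : qn q%:P n = (qn q n)%:P.
Proof. by rewrite /qn rmorph_sum; apply: eq_bigr => i _; rewrite /= rmorphXn. Qed.

Lemma dqn_polyC n : dqn q%:P n = (dqn q n)%:P.
Proof. by elim: n => //= n ->; rewrite qn_polyC polyCM polyCD. Qed.

Lemma hbar_at_ext (F F' : H -> weyl q t) :
  (forall c a b, F (c *: a + b) = c.[t] *: F a + F b) ->
  (forall c a b, F' (c *: a + b) = c.[t] *: F' a + F' b) ->
  (forall j i, F (pbw_mono q%:P 'X j i) = F' (pbw_mono q%:P 'X j i)) -> F =1 F'.
Proof.
move=> HF HF' Hm.
have F0 (f : H -> weyl q t) : (forall c a b, f (c *: a + b) = c.[t] *: f a + f b) -> f 0 = 0.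
  by move=> Hf; have := Hf (-1) 0 0; rewrite scaler0 addr0 hornerN hornerC scaleN1r addNr.
elim/mono_ind => [|c a b Ha Hb|j i]; first by rewrite !F0.
  by rewrite HF HF' Ha Hb.
exact: Hm.
Qed.

(** The coefficients of [zeta] on the basis are universal expressions in q and h, so the operator
    over k[X] specializes to the one over k; the 2-cocycle built from it inherits this. *)
Lemma hbar_at_zeta (a : H) : at_t (zeta a) = zeta (at_t a).
Proof.
apply: (hbar_at_ext (F := fun a => at_t (zeta a)) (F' := fun a => zeta (at_t a))) => [c u v|c u v|j i].
- by rewrite zeta_linear hbar_atP.
- by rewrite hbar_atP zeta_linear.
rewrite hbar_at_mono !zeta_mono hbar_atP hbar_atS !hbar_at_mono dqn_polyC.
by rewrite !hornerM -[_%:R]polyC_natr horner_exp !hornerC hornerX.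
Qed.

Lemma hbar_at_zetaX i (b : H) : at_t (zetaX i b) = zetaX i (at_t b).
Proof.
elim: i => [|i IH] /=; first exact: hbar_at0.
by rewrite hbar_atD hbar_atM hbar_at_x IH hbar_at_zeta hbar_atM hbar_atX hbar_at_x.
Qed.

Lemma hbar_at_dq_prod (a b : H) : at_t (dq_prod a b) = dq_prod (at_t a) (at_t b).
Proof.
apply: (hbar_at_ext (F := fun a => at_t (dq_prod a b))
  (F' := fun a => dq_prod (at_t a) (at_t b))) => [c u v|c u v|j i].
- by rewrite dq_prod_linl hbar_atP.
- by rewrite hbar_atP dq_prod_linl.
by rewrite hbar_at_mono !dq_prod_mono hbar_atM hbar_atX hbar_at_y hbar_at_zetaX.
Qed.

Lemma hbar_at_euler_square (a : H) : at_t (euler_square a) = euler_square (at_t a).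
Proof.
apply: (hbar_at_ext (F := fun a => at_t (euler_square a))
  (F' := fun a => euler_square (at_t a))) => [c u v|c u v|j i].
- by rewrite euler_square_linear hbar_atP.
- by rewrite hbar_atP euler_square_linear.
rewrite hbar_at_mono !euler_square_mono hbar_atS hbar_at_mono.
by rewrite -polyC_natr hornerC.
Qed.

Lemma hbar_at_sym_dq_prod e (a b : H) :
  at_t (sym_dq_prod e a b) = sym_dq_prod e.[t] (at_t a) (at_t b).
Proof.
rewrite /sym_dq_prod hbar_atP hbar_at_dq_prod /hoch1 !hbar_atD hbar_atN !hbar_atM.
by rewrite !hbar_at_euler_square hbar_atM.
Qed.
End Specialize.

(** * The differentiated product on the quantum plane *)

Section QuantumPlane.
Context (k : fieldType) (q : k).
Local Notation A := (weyl q 0).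
Local Notation x := (weyl_x q 0).
Local Notation y := (weyl_y q 0).
Context (dx dy : A -> A).
Hypotheses (dx_der : derivation dx) (dxx : dx x = x) (dxy : dx y = 0).
Hypotheses (dy_der : derivation dy) (dyx : dy x = 0) (dyy : dy y = y).

Lemma euler_exp (D : A -> A) (c : k) u n : derivation D -> D u = c *: u ->
  D (u ^+ n) = (n%:R * c) *: u ^+ n.
Proof.
move=> HD Du; have [_ DM] := HD; elim: n => [|n IH].
  by rewrite derivation1 // mul0r scale0r.
rewrite exprS DM Du IH -weyl_scaleAl -weyl_scaleAr -scalerDl -natr1.
by congr (_ *: _); ring.
Qed.

Lemma dx_mono j i : dx (pbw_mono q 0 j i) = i%:R *: pbw_mono q 0 j i.
Proof.
have [_ DM] := dx_der; rewrite /pbw_mono DM.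
rewrite (euler_exp (c := 0) j dx_der) ?scale0r // (euler_exp (c := 1) i dx_der) ?scale1r //.
by rewrite mulr0 scale0r mul0r add0r mulr1 weyl_scaleAr.
Qed.
Lemma dy_mono j i : dy (pbw_mono q 0 j i) = j%:R *: pbw_mono q 0 j i.
Proof.
have [_ DM] := dy_der; rewrite /pbw_mono DM.
rewrite (euler_exp (c := 1) j dy_der) ?scale1r // (euler_exp (c := 0) i dy_der) ?scale0r //.
by rewrite mulr0 scale0r mulr0 addr0 mulr1 weyl_scaleAl.
Qed.

Lemma zeta_plane (b : A) : zeta b = x * dy b.
Proof.
have [dl _] := dy_der; elim/mono_ind: b => [|c a b Ha Hb|j i].
- by rewrite linear0 (lin0 dl) mulr0.
- by rewrite zeta_linear dl mulrDr -weyl_scaleAr Ha Hb.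
rewrite zeta_mono dy_mono -weyl_scaleAr x_mono !mul0r !scale0r !addr0.
by rewrite scalerA.
Qed.

Lemma zetaX_plane i (b : A) : zetaX i b = i%:R *: (x ^+ i * dy b).
Proof.
have [_ DM] := dy_der; elim: i => [|i IH] /=; first by rewrite scale0r.
rewrite IH zeta_plane DM (euler_exp (c := 0) i dy_der) ?scale0r //.
rewrite mulr0 scale0r mul0r add0r -weyl_scaleAr !mulrA -exprS -natr1.
by rewrite scalerDl scale1r.
Qed.

(** At h = 0 the product of y^j x^i and y^s x^r is q^(i s) times a monomial, and q d/dq multiplies
    it by i s: the eigenvalue of [dx] on the first factor times that of [dy] on the second. *)
Lemma dq_prod_plane (a b : A) : dq_prod a b = dx a * dy b.
Proof.
have [dl _] := dx_der; elim/mono_ind: a => [|c a a' H H'|j i].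
- by rewrite (lin0 (dq_prod_linl b)) (lin0 dl) mul0r.
- by rewrite dq_prod_linl dl mulrDl -weyl_scaleAl H H'.
rewrite dq_prod_mono zetaX_plane dx_mono -weyl_scaleAr -weyl_scaleAl.
by rewrite /pbw_mono mulrA.
Qed.

Lemma euler_square_plane (a : A) : euler_square a = dx (dy a).
Proof.
have [dl _] := dx_der; have [dl' _] := dy_der.
elim/mono_ind: a => [|c a a' H H'|j i].
- by rewrite (lin0 dl') (lin0 dl) (lin0 (@euler_square_linear _ _ _)).
- by rewrite dl' dl (euler_square_linear c) H H'.
by rewrite euler_square_mono dy_mono (linZ _ _ dl) dx_mono scalerA natrM mulrC.
Qed.

Lemma sym_dq_prod_plane (a b : A) : 2%:R != 0 :> k ->
  sym_dq_prod 2^-1 a b = 2^-1 *: (dx a * dy b - dy a * dx b).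
Proof.
move=> n2; have [dl dM] := dx_der; have [dl' dM'] := dy_der.
rewrite /sym_dq_prod dq_prod_plane /hoch1 !euler_square_plane dM' (linD dl) !dM.
apply: cf_inj => j i; rewrite !cfE; field.
exact: n2.
Qed.
End QuantumPlane.

Lemma central_lin (R : comNzRingType) (q h c : R) (z z' : weyl q h) :
  central z -> central z' -> central (c *: z + z').
Proof.
by move=> Hz Hz' a; rewrite mulrDl mulrDr -weyl_scaleAl -weyl_scaleAr Hz Hz'.
Qed.

Lemma central_mul (R : comNzRingType) (q h : R) (z z' : weyl q h) :
  central z -> central z' -> central (z * z').
Proof. by move=> Hz Hz' a; rewrite -mulrA Hz' mulrA Hz mulrA. Qed.

Lemma central_exp (R : comNzRingType) (q h : R) (z : weyl q h) n :
  central z -> central (z ^+ n).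
Proof.
move=> Hz; elim: n => [|n IH] a; first by rewrite mulr1 mul1r.
by rewrite exprS; apply: central_mul.
Qed.

(** * Lifts over k[hbar] of derivations and of the wedge product *)

Section Lifting.
Context (k : fieldType) (N : nat) (q : k).
Hypotheses (N_ge2 : (2 <= N)%N) (q_prim : N.-primitive_root q).
Local Notation H := (weyl q%:P ('X : {poly k})).
Local Notation xh := (weyl_x q%:P ('X : {poly k})).
Local Notation yh := (weyl_y q%:P ('X : {poly k})).
Let qN := prim_expr q_prim.
Let qnN := qn_N N_ge2 q_prim.
Let N0 : (0 < N)%N := ltnW N_ge2.

Let qhN : q%:P ^+ N = 1 :> {poly k}.
Proof. by rewrite -rmorphXn /= qN. Qed.
Let qnhN : qn (q%:P : {poly k}) N = 0.
Proof. by rewrite qn_polyC qnN. Qed.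

(** A single central element of the deformation specializes correctly at every t, so combinations of
    derivations with central coefficients can be lifted as a whole. *)
Lemma center_lift P : exists2 z : H, central z &
  forall t, hbar_at t (z : weyl_hbar q) = center_eval N q t P.
Proof.
exists (\sum_(m <- msupp P) (P@_m)%:P *: pbw_mono q%:P 'X (N * m ord_max) (N * m ord0)).
  elim/big_rec: _ => [|m z _ Hz]; first by move=> a; rewrite mul0r mulr0.
  apply: central_lin Hz; rewrite /pbw_mono !exprM.
  by apply: central_mul; apply: central_exp; [apply: central_yN | apply: central_xN].
move=> t; rewrite center_evalE //; elim: (msupp P) => [|m s IH].
  by rewrite !big_nil hbar_at0.
by rewrite !big_cons hbar_atP hbar_at_mono IH hornerC.
Qed.

Context (dx dy : weyl q 0 -> weyl q 0).
Hypotheses (dx_der : derivation dx) (dxx : dx (weyl_x q 0) = weyl_x q 0)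
  (dxy : dx (weyl_y q 0) = 0).
Hypotheses (dy_der : derivation dy) (dyx : dy (weyl_x q 0) = 0)
  (dyy : dy (weyl_y q 0) = weyl_y q 0).

Lemma euler_derivation_derivation m : derivation (euler_derivation N dx dy m).
Proof.
by apply: derivation_centralD => //; apply: center_eval_central.
Qed.

Lemma lift_to_weyl1 (Dh : H -> H) (D0 : weyl q 0 -> weyl q 0)
    (D1 : weyl q 1 -> weyl q 1) :
  derivation Dh -> derivation D0 -> derivation D1 ->
  hbar_at 0 (Dh xh : weyl_hbar q) = D0 (weyl_x q 0) ->
  hbar_at 0 (Dh yh : weyl_hbar q) = D0 (weyl_y q 0) ->
  hbar_at 1 (Dh xh : weyl_hbar q) = D1 (weyl_x q 1) ->
  hbar_at 1 (Dh yh : weyl_hbar q) = D1 (weyl_y q 1) ->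
  lift_to_weyl (cochain1 D0) (cochain1 D1).
Proof.
move=> Hh H0 H1 x0 y0 x1 y1.
have H00 := hbar_at_derivation Hh H0 x0 y0.
have H11 := hbar_at_derivation Hh H1 x1 y1.
exists (cochain1 (Dh : weyl_hbar q -> weyl_hbar q)).
split; first split.
- exact: (cocycle1_cochain1 (A := weyl_hbar q)).
- move=> a; rewrite /cochain1.
  rewrite ffunE. exact: H00.
- by move=> a; rewrite /cochain1 ffunE; apply: H11.
Qed.

Let kap := (q - 1)^-1.
Context (E Du Dv : weyl q 1 -> weyl q 1).
Local Notation x := (weyl_x q 1).
Local Notation y := (weyl_y q 1).
Hypotheses (E_der : derivation E) (Ex : E x = x) (Ey : E y = - y).
Hypotheses (Du_der : derivation Du) (Dux : Du x = x ^+ N * x)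
  (Duy : Du y = kap *: x ^+ N.-1).
Hypotheses (Dv_der : derivation Dv) (Dvx : Dv x = kap *: y ^+ N.-1)
  (Dvy : Dv y = y ^+ N * y).

Lemma euler_lift_lift m : H1_submodule m ->
  lift_to_weyl (cochain1 (euler_derivation N dx dy m))
    (cochain1 (euler_lift N E Du Dv m)).
Proof.
move=> Hm.
have [Eh [Eh_der Ehx Ehy]] := euler_xy_ex (q%:P : {poly k}) 'X.
(* With h = 'X the correction constant is divisible by hbar: the corrections vanish at 0 and become
   those of [Du] and [Dv] at 1. *)
have kapE : (kap%:P * 'X) * (q%:P - 1) = 'X :> {poly k}.
  rewrite mulrAC -polyC1 -polyCB -polyCM mulVf ?polyC1 ?mul1r //.
  exact: prim_sub1 N_ge2 q_prim.
have [Uh [Uh_der Uhx Uhy]] := euler_u_ex N0 qhN qnhN kapE.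
have [Vh [Vh_der Vhx Vhy]] := euler_v_ex N0 qhN qnhN kapE.
have [z0 z0c Ez0] := center_lift (coefH m).
have [z1 z1c Ez1] := center_lift (coefU m).
have [z2 z2c Ez2] := center_lift (coefV m).
pose Dh a : H := z0 * Eh a + z1 * Uh a + z2 * Vh a.
have Dh_der : derivation Dh.
  have c1 : central (1 : H) by move=> a; rewrite mul1r mulr1.
  have D01 := derivation_centralD z0c z1c Eh_der Uh_der.
  have := derivation_centralD c1 z2c D01 Vh_der.
  by congr derivation; apply/funext => a; rewrite mul1r.
pose x0 := weyl_x q 0; pose y0 := weyl_y q 0.
have cXu : center_eval N q 0 'X_ord0 = x0 ^+ N.
  by rewrite center_evalX // !mnm1E /= muln0 muln1 mono0r.
have cXv : center_eval N q 0 'X_ord_max = y0 ^+ N.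
  by rewrite center_evalX // !mnm1E /= muln0 muln1 mono0.
have HD := euler_lift_derivation N_ge2 q_prim E_der Du_der Dv_der m.
apply: (lift_to_weyl1 Dh_der (euler_derivation_derivation m) HD);
  rewrite /Dh ?Ehx ?Ehy ?Uhx ?Uhy ?Vhx ?Vhy !hbar_atD !hbar_atM ?hbar_atS ?hbar_atN
    ?hbar_atM !hbar_atX !hbar_at_x !hbar_at_y Ez0 Ez1 Ez2 ?hornerM ?hornerC ?hornerX.
- rewrite mulr0 scale0r mulr0 addr0 /euler_derivation dxx dyx mulr0 addr0.
  rewrite -/(coordX m) coordXE [in RHS]center_evalD (@center_evalM k N q 0 qN qnN) cXu mulrDl.
  by rewrite -(center_eval_central qN qnN (coefU m) (x0 ^+ N)) mulrA.
- rewrite mulr0 scale0r mulr0 addr0 /euler_derivation dxy dyy mulr0 add0r.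
  rewrite -/(coordY m) (coordYE Hm) [in RHS]center_evalD (@center_evalM k N q 0 qN qnN) cXv.
  rewrite mulrDl -(center_eval_central qN qnN (coefV m) (y0 ^+ N)) mulrA.
  by rewrite -[- coefH m]scaleN1r center_evalZ scaleN1r mulrN mulNr.
- by rewrite /euler_lift Ex Dux Dvx mulr1.
- by rewrite /euler_lift Ey Duy Dvy mulr1.
Qed.

Lemma sym_dq_prod_lift : 2%:R != 0 :> k ->
  let w : cochain (weyl q 1) 2 := fun a => sym_dq_prod 2^-1 (a ord0) (a ord_max) in
  cocycle w /\ lift_to_weyl (wedge dx dy) w.
Proof.
move=> n2 w.
have cw (R : comNzRingType) (p h e : R) :
    cocycle ((fun a => sym_dq_prod e (a ord0) (a ord_max)) : cochain (weyl p h) 2).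
  apply/cocycle2P; have := @sym_dq_prod_cocycle R p h e.
  congr cocycle2; apply/funext => u; apply/funext => v; by rewrite arg2_0 arg2_1.
split; first exact: cw.
exists (fun a => sym_dq_prod (2^-1)%:P (a ord0 : H) (a ord_max : H)).
split; first split.
- exact: cw.
- move=> a; rewrite hbar_at_sym_dq_prod hornerC (sym_dq_prod_plane dx_der dxx dxy dy_der dyx dyy) //.
  by rewrite /wedge /cup !ffunE.
- by move=> a; rewrite hbar_at_sym_dq_prod hornerC /w !ffunE.
Qed.
End Lifting.

(** * Coefficients of the generators; central multiples of 2-cocycles *)

Section Generators.
Context (k : fieldType).

Lemma quot_u0 : quot_u (0 : center_poly k) = 0.
Proof. by apply/mpolyP => M; rewrite mcoeff_quot_u !mcoeff0. Qed.
Lemma quot_v0 : quot_v (0 : center_poly k) = 0.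
Proof. by apply/mpolyP => M; rewrite mcoeff_quot_v !mcoeff0 if_same. Qed.

Lemma quot_u_Xu : quot_u ('X_ord0 : center_poly k) = 1.
Proof.
apply/mpolyP => M; rewrite mcoeff_quot_u mcoeffX mcoeff1.
by rewrite -[X in (X == _)%MM]add0m eqm_add2r eq_sym.
Qed.
Lemma quot_v_Xu : quot_v ('X_ord0 : center_poly k) = 0.
Proof.
apply/mpolyP => M; rewrite mcoeff_quot_v mcoeffX mcoeff0; case: eqP => // M0.
by case: eqP => // /mnmP/(_ ord0); rewrite mnmDE !mnm1E M0.
Qed.
Lemma quot_u_Xv : quot_u ('X_ord_max : center_poly k) = 0.
Proof.
apply/mpolyP => M; rewrite mcoeff_quot_u mcoeffX mcoeff0.
by case: eqP => // /mnmP/(_ ord0); rewrite mnmDE !mnm1E addn1.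
Qed.
Lemma quot_v_Xv : quot_v ('X_ord_max : center_poly k) = 1.
Proof.
apply/mpolyP => M; rewrite mcoeff_quot_v mcoeffX mcoeff1.
rewrite -{1}[U_(ord_max)%MM]add0m eqm_add2r [0%MM == M]eq_sym.
case: (M ord0 =P 0%N) => // M0; case: (M =P 0%MM) => // M00.
by case: M0; rewrite M00 mnm0E.
Qed.

Lemma coef_E : [/\ coefH (gen_E k) = 1, coefU (gen_E k) = 0 & coefV (gen_E k) = 0].
Proof.
rewrite /coefH /coefU /coefV coordX_E coordY_E subrr.
by rewrite quot_u0 quot_v0 mulr0 subr0.
Qed.
Lemma coef_u : [/\ coefH (gen_u k) = 0, coefU (gen_u k) = 1 & coefV (gen_u k) = 0].
Proof.
rewrite /coefH /coefU /coefV coordX_u coordY_u addr0.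
by rewrite quot_u_Xu quot_v_Xu mulr1 subrr.
Qed.
Lemma coef_v : [/\ coefH (gen_v k) = 0, coefU (gen_v k) = 0 & coefV (gen_v k) = 1].
Proof.
rewrite /coefH /coefU /coefV coordX_v coordY_v.
by rewrite !add0r quot_u_Xv quot_v_Xv mulr0 oppr0.
Qed.

Lemma H1_submodule_E : H1_submodule (gen_E k).
Proof. by apply/H1_submoduleP; rewrite coordX_E coordY_E subrr mcoeff0. Qed.
Lemma H1_submodule_u : H1_submodule (gen_u k).
Proof.
apply/H1_submoduleP; rewrite coordX_u coordY_u addr0 mcoeffX.
by rewrite mnm1_eq0.
Qed.
Lemma H1_submodule_v : H1_submodule (gen_v k).
Proof.
apply/H1_submoduleP; rewrite coordX_v coordY_v add0r mcoeffX.
by rewrite mnm1_eq0.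
Qed.

Lemma degree_lt_scale d e (P : center_poly k) m : (msize P <= d.+1)%N ->
  degree_lt e.+1 m -> degree_lt (d + e).+1 (P *: m).
Proof.
move=> HP Hm i; rewrite mxE; have [->|P0] := eqVneq P 0; first by rewrite mul0r msize0.
have [->|m0] := eqVneq (m ord0 i) 0; first by rewrite mulr0 msize0.
rewrite msizeM //; have := leq_add HP (Hm i); rewrite addSn addnS.
by case: (msize P + _)%N.
Qed.
End Generators.

Lemma cocycle2_central (R : comNzRingType) (q h : R) (z : weyl q h) f :
  central z -> cocycle2 f -> cocycle2 (fun u v => z * f u v).
Proof.
move=> zc [f1 f0 fA]; split=> [u c v v'|v c u u'|u v w].
- by rewrite f1 mulrDr -weyl_scaleAr.
- by rewrite f0 mulrDr -weyl_scaleAr.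
- by rewrite mulrA -(zc u) -!mulrA -!mulrDr fA.
Qed.

Lemma koszul2_central (R : comNzRingType) (q h : R) (z : weyl q h) f :
  koszul2 (fun u v => z * f u v) = z * koszul2 f.
Proof. by rewrite /koszul2 mulrDr mulrBr -!weyl_scaleAr. Qed.

(** * H^1 and H^2 of W_q as modules over the center *)

Section Cohomology.
Context (k : fieldType) (N : nat) (q : k).
Hypotheses (N_ge2 : (2 <= N)%N) (q_prim : N.-primitive_root q).
Local Notation A := (weyl q 1).
Local Notation x := (weyl_x q 1).
Local Notation y := (weyl_y q 1).
Local Notation cev := (center_eval N q 1).
Let qN := prim_expr q_prim.
Let qnN := qn_N N_ge2 q_prim.
Let N0 : (0 < N)%N := ltnW N_ge2.
Let kap := (q - 1)^-1.
Context (E Du Dv : A -> A).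
Hypotheses (E_der : derivation E) (Ex : E x = x) (Ey : E y = - y).
Hypotheses (Du_der : derivation Du) (Dux : Du x = x ^+ N * x)
  (Duy : Du y = kap *: x ^+ N.-1).
Hypotheses (Dv_der : derivation Dv) (Dvx : Dv x = kap *: y ^+ N.-1)
  (Dvy : Dv y = y ^+ N * y).
Local Notation Phi := (euler_lift N E Du Dv).
Let Phi_der := euler_lift_derivation N_ge2 q_prim E_der Du_der Dv_der.

Lemma derivation_euler_lift n (D : A -> A) : derivation D ->
  deg_lt n (D x) -> deg_lt n (D y) ->
  exists m c, [/\ H1_submodule m, forall d, (n <= N * d)%N -> degree_lt d m
    & forall a, D a = Phi m a + (a * c - c * a)].
Proof.
move=> HD Dx Dy.
have [m [c [Hm Hd ex ey]]] := H1_span N_ge2 q_prim E_der Ex Ey Du_der Dux Duy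
  Dv_der Dvx Dvy Dx Dy (koszul1_derivation HD).
exists m, c; split=> // a.
have c1 : central (1 : A) by move=> u; rewrite mul1r mulr1.
have HD' := derivation_centralD c1 c1 (Phi_der m) (derivation_inner c).
have := derivation_eq HD HD' _ _ a; rewrite !mul1r; apply; [exact: ex|exact: ey].
Qed.

Lemma cocycle1_euler_lift (f : cochain A 1) : cocycle f ->
  exists2 m, H1_submodule m & cohomologous f (cochain1 (Phi m)).
Proof.
move=> /cocycle1P HD; have [n Hn] := deg_lt_ex (f (arg1 x)).
have [n' Hn'] := deg_lt_ex (f (arg1 y)).
have [|//|m [c [Hm _ Hc]]] := derivation_euler_lift (n := maxn n n') HD.
- exact: deg_ltW (leq_maxl _ _) Hn.
- exact: deg_ltW (leq_maxr _ _) Hn'.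
exists m => //; apply/cohomologous1P; exists c => u.
by rewrite Hc /cochain1 ffunE.
Qed.

(** Both derivations have the same main parts at x and y, so their difference takes values built
    from corrections alone, below degree N (d + e). The degree control in the spanning result then
    bounds the remaining class. *)
Lemma center_act_euler_lift d e P m : H1_submodule m -> (msize P <= d.+1)%N ->
  degree_lt e.+1 m -> exists m', [/\ H1_submodule m', degree_lt (d + e) m'
    & cohomologous (center_act N P (cochain1 (Phi m)))
        (cochain1 (Phi (P *: m)) \+ cochain1 (Phi m'))].
Proof.
move=> Hm HP Hdm.
have HPm : H1_submodule (P *: m).
  rewrite -[P *: m]addr0; apply: H1_submodule_lin => //.
  by apply/H1_submoduleP; rewrite /coordX /coordY !mxE addr0 mcoeff0.
have HdPm := degree_lt_scale HP Hdm.
have ce Q := center_eval_central qN qnN Q (h := 1).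
have cN1 : central (- 1 : A) by move=> u; rewrite mulN1r mulrN1.
have HD := derivation_centralD (ce P) cN1 (Phi_der m) (Phi_der (P *: m)).
have degP (a : A) : deg_lt (N * e)%N a -> deg_lt (N * (d + e)) (cev P * a).
  move=> Ha; apply: (deg_lt_center qN qnN Ha) => M /msize_mdeg_lt lt.
  by rewrite -mulnDr leq_mul2l leq_add2r -ltnS (leq_trans lt) ?orbT.
have lift_x := euler_lift_x N_ge2 q_prim Ex Dux Dvx.
have lift_y := euler_lift_y N_ge2 q_prim Ey Duy Dvy.
have [||m' [c [Hm' Hd' Hc]]] := derivation_euler_lift (n := (N * (d + e))%N) HD.
- rewrite !lift_x mulrDr mulrA coordXZ center_evalM // mulN1r opprD addrACA subrr.
  rewrite add0r; apply: deg_ltD.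
    apply: degP => //; apply: deg_ltZ.
    by apply: (deg_lt_coefV N_ge2 q_prim Hdm (@deg_lt_Ym k q _)); rewrite prednK // mulnS; lia.
  apply/deg_ltN/deg_ltZ.
  by apply: (deg_lt_coefV N_ge2 q_prim HdPm (@deg_lt_Ym k q _)); rewrite prednK // mulnS; lia.
- rewrite !lift_y // mulrDr mulrA coordYZ center_evalM // mulN1r opprD addrACA subrr.
  rewrite add0r; apply: deg_ltD.
    apply: degP => //; apply: deg_ltZ.
    by apply: (deg_lt_coefU N_ge2 q_prim Hdm (@deg_lt_Xm k q _)); rewrite prednK // mulnS; lia.
  apply/deg_ltN/deg_ltZ.
  by apply: (deg_lt_coefU N_ge2 q_prim HdPm (@deg_lt_Xm k q _)); rewrite prednK // mulnS; lia.
exists m'; split=> //; first exact: Hd'.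
apply/cohomologous1P; exists c => u; rewrite /center_act /cochain1 /= ffunE.
have := Hc u; rewrite mulN1r => /eqP; rewrite subr_eq => /eqP ->.
by rewrite addrC addrA.
Qed.

(** Under [koszul2], f minus Q w becomes (P - q Q) yx modulo the image, where P comes from
    [coker_decomp]. Hence Q = q^-1 P splits the difference, and the forms [coker_form] show that no
    other Q does. *)
Lemma cocycle2_center_act (w : A -> A -> A) (f : cochain A 2) : cocycle2 w ->
  koszul2 w = q *: (y * x) -> cocycle f ->
  exists! P, cohomologous f (center_act N P (fun a => w (a ord0) (a ord_max))).
Proof.
move=> wc wk /cocycle2P fc; pose F u v := f (arg2 u v).
have ce Q := center_eval_central qN qnN Q (h := 1).
have q0 := prim_neq0 N_ge2 q_prim.
have [P [a [b Ek]]] := coker_decomp N_ge2 q_prim (koszul2 F).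
pose G Q u v := -1 *: (cev Q * w u v) + F u v.
have kG Q : koszul2 (G Q) = cev (P - q *: Q) * (y * x) + koszul1 a b.
  rewrite koszul2_lin koszul2_central wk Ek center_evalB center_evalZ mulrBl.
  by rewrite -weyl_scaleAl -weyl_scaleAr scaleN1r addrA [- _ + _]addrC.
have cohG Q : cohomologous f (center_act N Q (fun a => w (a ord0) (a ord_max))) <->
    exists g, linear g /\ forall u v, G Q u v = hoch1 g u v.
  rewrite /cohomologous coboundary2P; split=> -[g [gl gE]]; exists g; split=> // u.
    move=> v; have := gE (arg2 u v); rewrite arg2_0 arg2_1 => <-.
    by rewrite /= /center_act arg2_0 arg2_1 /G scaleN1r addrC.
  rewrite -gE /G /F -arg2E /= /center_act scaleN1r addrC //.
exists (q^-1 *: P); split=> [|Q].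
  apply/cohG; have [||g [gl _ _ gE]] := @cocycle2_split k q 1 (G (q^-1 *: P)) a b.
  - by apply: cocycle2_lin => //; apply: cocycle2_central.
  - by rewrite kG scalerA divff // scale1r subrr center_eval0 mul0r add0r.
  by exists g.
move=> /cohG[g [gl gE]].
have e : koszul2 (G Q) = koszul1 (g x) (g y).
  by rewrite -(koszul2_hoch1 gl) /koszul2 !gE.
apply: (scalerI q0); rewrite scalerA divff // scale1r; apply/eqP; rewrite -subr_eq0.
apply/eqP/mpolyP => M; rewrite mcoeff0.
have := congr1 (coker_form N M) e.
rewrite kG -[_ * (y * x)]scale1r (coker_formP _ M) !(coker_form_koszul1 N_ge2 q_prim).
rewrite mul1r addr0 (coker_form_center N_ge2 q_prim) => /eqP.
have q1 : 1 - q != 0 by rewrite -opprB oppr_eq0 (prim_sub1 N_ge2 q_prim).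
by rewrite mulf_eq0 invr_eq0 mulf_eq0 (negbTE q0) (negbTE q1) !orbF => /eqP.
Qed.
End Cohomology.

Theorem theorem12 (k : fieldType) (N : nat) (q : k)
  (char0 : [pchar k] =i pred0) (N_ge2 : (2 <= N)%N)
  (q_prim : N.-primitive_root q) :
  (* the center of W_q is the polynomial ring k[x^N, y^N] *)
  (injective (center_eval N q 1) /\
   forall c : weyl q 1, central c <-> exists P, c = center_eval N q 1 P) /\
  exists dx dy : weyl q 0 -> weyl q 0,
  [/\ (* dx = x d/dx and dy = y d/dy on the quantum plane *)
      [/\ derivation dx, dx (weyl_x q 0) = weyl_x q 0
        & dx (weyl_y q 0) = 0],
      [/\ derivation dy, dy (weyl_x q 0) = 0
        & dy (weyl_y q 0) = weyl_y q 0],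
      (* H^1 *)
      exists E Du Dv : weyl q 1 -> weyl q 1,
      [/\ [/\ derivation E, E (weyl_x q 1) = weyl_x q 1
            & E (weyl_y q 1) = - weyl_y q 1],
          [/\ lift_to_weyl (cochain1 (euler_derivation N dx dy (gen_E k)))
                (cochain1 E),
              lift_to_weyl (cochain1 (euler_derivation N dx dy (gen_u k)))
                (cochain1 Du)
            & lift_to_weyl (cochain1 (euler_derivation N dx dy (gen_v k)))
                (cochain1 Dv)],
          (* the three classes span H^1 over the center *)
          forall f : cochain (weyl q 1) 1, cocycle f ->
            exists P0 P1 P2, cohomologous f
              (center_act N P0 (cochain1 E) \+ center_act N P1 (cochain1 Du)
               \+ center_act N P2 (cochain1 Dv))
        & (* H^1 is identified with H1_submodule, the class of a lift being
             represented by the element which is lifted *)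
          exists Phi : euler_module k -> cochain (weyl q 1) 1,
          [/\ forall m, H1_submodule m ->
                lift_to_weyl (cochain1 (euler_derivation N dx dy m)) (Phi m),
              [/\ cohomologous (Phi (gen_E k)) (cochain1 E),
                  cohomologous (Phi (gen_u k)) (cochain1 Du)
                & cohomologous (Phi (gen_v k)) (cochain1 Dv)],
              forall (c : k) m m', H1_submodule m -> H1_submodule m' ->
                cohomologous (Phi (mpolyC 2 c *: m + m'))
                  (c \*: Phi m \+ Phi m'),
              (forall m, H1_submodule m -> coboundary (Phi m) -> m = 0) /\
              (forall f : cochain (weyl q 1) 1, cocycle f ->
                 exists2 m, H1_submodule m & cohomologous f (Phi m))
            & forall (d e : nat) P m, H1_submodule m ->
                (msize P <= d.+1)%N -> degree_lt e.+1 m ->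
                exists m', [/\ H1_submodule m', degree_lt (d + e) m'
                  & cohomologous (center_act N P (Phi m))
                      (Phi (P *: m) \+ Phi m')]]]
    & (* H^2 *)
      exists2 w : cochain (weyl q 1) 2,
        cocycle w /\ lift_to_weyl (wedge dx dy) w &
        forall f : cochain (weyl q 1) 2, cocycle f ->
          exists! P, cohomologous f (center_act N P w)].
Proof.
have nz n : (0 < n)%N -> n%:R != 0 :> k.
  by move/pcharf0P: char0 => -> ; rewrite lt0n.
have N0 : (0 < N)%N := ltnW N_ge2.
have qN := prim_expr q_prim; have qnN := qn_N N_ge2 q_prim.
split; first by split; [exact: center_eval_inj | exact: centralP].
have [dx [dx_der dxx dxy]] := euler_x_ex q (erefl (0 : k)).
have [dy [dy_der dyx dyy]] := euler_y_ex q (erefl (0 : k)).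
have [E [E_der Ex Ey]] := euler_xy_ex q (1 : k).
have kapE : (q - 1)^-1 * (q - 1) = 1 by rewrite mulVf // (prim_sub1 N_ge2 q_prim).
have [Du [Du_der Dux Duy]] := euler_u_ex N0 qN qnN kapE.
have [Dv [Dv_der Dvx Dvy]] := euler_v_ex N0 qN qnN kapE.
pose Phi m := euler_lift N E Du Dv m.
have Phi_lift m : H1_submodule m -> lift_to_weyl
    (cochain1 (euler_derivation N dx dy m)) (cochain1 (Phi m)).
  exact: (euler_lift_lift N_ge2 q_prim dx_der dxx dxy dy_der dyx dyy E_der Ex Ey
    Du_der Dux Duy Dv_der Dvx Dvy).
have [PhiE Phiu Phiv] : [/\ Phi (gen_E k) = E, Phi (gen_u k) = Du & Phi (gen_v k) = Dv].
  split; apply/funext => a; rewrite /Phi /euler_lift.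
  - have [-> -> ->] := coef_E k.
    by rewrite center_eval1 center_eval0 !mul0r !addr0 mul1r.
  - have [-> -> ->] := coef_u k.
    by rewrite center_eval1 center_eval0 !mul0r addr0 add0r mul1r.
  - have [-> -> ->] := coef_v k.
    by rewrite center_eval1 center_eval0 !mul0r !add0r mul1r.
exists dx, dy.
apply: And4; [exact: And3 dx_der dxx dxy | exact: And3 dy_der dyx dyy | |].
  exists E, Du, Dv.
  apply: And4; first exact: And3 E_der Ex Ey.
  - rewrite -PhiE -Phiu -Phiv.
    apply: And3; apply: Phi_lift; first exact: H1_submodule_E.
      exact: H1_submodule_u.
    exact: H1_submodule_v.
  - move=> f /(cocycle1_euler_lift N_ge2 q_prim E_der Ex Ey Du_der Dux Duy
      Dv_der Dvx Dvy)[m Hm cf].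
    by exists (coefH m), (coefU m), (coefV m).
  exists (fun m => cochain1 (Phi m)); split.
  - exact: Phi_lift.
  - by rewrite PhiE Phiu Phiv; split; apply: cohomologous1_refl.
  - move=> c m m' _ _; apply: cohomologous1_refl => a.
    exact: euler_lift_lin.
  - split=> [m Hm /coboundary1P[c Hc]|f].
      apply: (euler_lift_inner_eq0 N_ge2 q_prim E_der Ex Ey Du_der Dux Duy
        Dv_der Dvx Dvy (nz N N0) (c := c) Hm) => a.
      by have := Hc (arg1 a); rewrite /cochain1 !ffunE.
    exact: (cocycle1_euler_lift N_ge2 q_prim E_der Ex Ey Du_der Dux Duy
      Dv_der Dvx Dvy).
  - move=> d e P m Hm HP Hd.
    exact: (center_act_euler_lift N_ge2 q_prim E_der Ex Ey Du_der Dux Duy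
      Dv_der Dvx Dvy).
have [wc wl] := sym_dq_prod_lift dx_der dxx dxy dy_der dyx dyy (nz 2 isT).
exists (fun a => sym_dq_prod 2^-1 (a ord0) (a ord_max)); first by split.
move=> f; apply: (cocycle2_center_act N_ge2 q_prim).
  exact: sym_dq_prod_cocycle.
exact: koszul2_sym_dq_prod.
Qed.
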